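(* Let $k\ge1$ and assume $\operatorname{char}(\mathbb{F})\ne2$. The cohomology algebra $H(R_k)$ is isomorphic to an exterior algebra generated by the classes of $h_{k,1},\dots,h_{k,k}$.
   Context: Let $\mathbb{F}$ be a field and $\hbar\in\mathbb{F}$ nonzero. $R_k$ is the dga over $\mathbb{F}$ generated by $T_i$ ($1\le i\le k-1$), $\xi_j$ ($1\le j\le k$) with relations $T_i^2=1+\hbar T_i$, $T_iT_{i+1}T_i=T_{i+1}T_iT_{i+1}$, $T_iT_{i'}=T_{i'}T_i$ for $|i-i'|>1$; $\xi_j^2=0$, $\xi_j\xi_{j'}=-\xi_{j'}\xi_j$ for $j\ne j'$; $\xi_iT_i=T_i\xi_{i+1}$, $\xi_{i+1}T_i=T_i\xi_i-\hbar(\xi_i-\xi_{i+1})$, $\xi_jT_i=T_i\xi_j$ for $j\ne i,i+1$. Gradings: $\deg\xi_j=1$, $\deg T_i=0$. Differential: $d(1)=0$, $d(T_i)=\xi_i-\xi_{i+1}$, $d(\xi_j)=0$, with $d(ab)=d(a)b+(-1)^{\deg a}a\,d(b)$. Note $T_i^{-1}=T_i-\hbar$. View $R_{k-1}\subset R_k$ as the subalgebra generated by $T_1,\dots,T_{k-2},\xi_1,\dots,\xi_{k-1}$. The elements $h_{k,i}\in R_k$, $i\in\mathbb{Z}$, are defined by $h_{1,1}=\xi_1$, $h_{1,i}=0$ for $i\ne1$, and for $k>1$ $$h_{k,i}=h_{k-1,i}-T_{k-1}^{-1}h_{k-1,i-1}+h_{k-1,i-1}T_{k-1}-T_{k-1}^{-1}h_{k-1,i-2}T_{k-1}.$$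 For $1\le i\le k$ they are closed of degree $1$. *)

(* Defs.v *)
From HB Require Import structures.
From mathcomp Require Import all_boot all_order all_algebra.
From mathcomp Require Import finmap zify boolp monalg.

Set Implicit Arguments.
Unset Strict Implicit.
Unset Printing Implicit Defensive.

Import GRing.Theory.
Local Open Scope ring_scope.
Local Open Scope quotient_scope.

(** * Quotient of an algebra by a proper two-sided ideal *)

(* [idealr] is the library's predicate for proper ideals absorbing on the
   left ([a * u \in I]); right absorption is added here.  The library only
   equips [{quot I}] with a ring structure over commutative rings. *)
HB.mixin Record isRightAbsorbing (R : nzRingType) (S : R -> bool) := {
  right_absorbing_subproof : forall u a : R, S u -> S (u * a)
}.

#[short(type="ideal2")]
HB.structure Definition Ideal2 (R : nzRingType) :=
  {S of Idealr R S & isRightAbsorbing R S}.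

Section QuotAlg.
Variables (F : comNzRingType) (A : algType F) (I : ideal2 A).

Definition quot_alg := Quotient.quot I.

HB.instance Definition _ := GRing.Zmodule.on quot_alg.

Definition quot_proj (x : A) : quot_alg := \pi_(Quotient.quot I) x.
Definition quot_repr (x : quot_alg) : A := repr (x : Quotient.quot I).

Lemma quot_reprK : cancel quot_repr quot_proj.
Proof. by move=> x; apply: reprK. Qed.

Lemma quot_projP x y : quot_proj x = quot_proj y <-> x - y \in I.
Proof.
rewrite Quotient.idealrBE; split; first by move=> h; apply/eqP.
by move/eqP.
Qed.

Lemma quot_proj_repr x : quot_repr (quot_proj x) - x \in I.
Proof. apply/(quot_projP (quot_repr (quot_proj x)) x). exact: quot_reprK. Qed.

Lemma quot_proj_zmod : zmod_morphism quot_proj.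
Proof. exact: (raddfB (\pi_(Quotient.quot I))). Qed.
HB.instance Definition _ :=
  GRing.isZmodMorphism.Build A quot_alg quot_proj quot_proj_zmod.

Lemma ideal2_mulr u a : u \in I -> u * a \in I.
Proof. exact: right_absorbing_subproof. Qed.

Definition quot_one : quot_alg := quot_proj 1.
Definition quot_mul : quot_alg -> quot_alg -> quot_alg :=
  locked (fun x y => quot_proj (quot_repr x * quot_repr y)).
Definition quot_scale : F -> quot_alg -> quot_alg :=
  locked (fun a x => quot_proj (a *: quot_repr x)).

Lemma quot_mulE x y : quot_mul (quot_proj x) (quot_proj y) = quot_proj (x * y).
Proof.
rewrite /quot_mul -lock.
apply/quot_projP; rewrite -[_ - _](subrKA (x * quot_repr (quot_proj y))).
rewrite -mulrBl -mulrBr; apply: rpredD.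
  by apply: ideal2_mulr; apply: quot_proj_repr.
by apply: idealMr; apply: quot_proj_repr.
Qed.

Lemma quot_scaleE a x : quot_scale a (quot_proj x) = quot_proj (a *: x).
Proof.
rewrite /quot_scale -lock; apply/quot_projP; rewrite -scalerBr -mulr_algl.
by apply: idealMr; apply: quot_proj_repr.
Qed.

Lemma quot_mulA : associative quot_mul.
Proof.
move=> x y z; rewrite -(quot_reprK x) -(quot_reprK y) -(quot_reprK z).
by rewrite !quot_mulE mulrA.
Qed.
Lemma quot_mul1 : left_id quot_one quot_mul.
Proof. by move=> x; rewrite -(quot_reprK x) quot_mulE mul1r. Qed.
Lemma quot_1mul : right_id quot_one quot_mul.
Proof. by move=> x; rewrite -(quot_reprK x) quot_mulE mulr1. Qed.
Lemma quot_mulDl : left_distributive quot_mul +%R.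
Proof.
move=> x y z; rewrite -(quot_reprK x) -(quot_reprK y) -(quot_reprK z).
by rewrite -raddfD !quot_mulE -raddfD mulrDl.
Qed.
Lemma quot_mulDr : right_distributive quot_mul +%R.
Proof.
move=> x y z; rewrite -(quot_reprK x) -(quot_reprK y) -(quot_reprK z).
by rewrite -raddfD !quot_mulE -raddfD mulrDr.
Qed.
Lemma quot_one_neq0 : quot_one != 0.
Proof.
apply/eqP; rewrite -[RHS](raddf0 quot_proj) => /quot_projP.
by rewrite subr0 idealr1.
Qed.

HB.instance Definition _ := GRing.Zmodule_isNzRing.Build quot_alg
  quot_mulA quot_mul1 quot_1mul quot_mulDl quot_mulDr quot_one_neq0.

Lemma quot_scaleA a b x :
  quot_scale a (quot_scale b x) = quot_scale (a * b) x.
Proof. by rewrite -(quot_reprK x) !quot_scaleE scalerA. Qed.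
Lemma quot_scale1 : left_id 1 quot_scale.
Proof. by move=> x; rewrite -(quot_reprK x) quot_scaleE scale1r. Qed.
Lemma quot_scaleDr : right_distributive quot_scale +%R.
Proof.
move=> a x y; rewrite -(quot_reprK x) -(quot_reprK y).
by rewrite -raddfD !quot_scaleE -raddfD scalerDr.
Qed.
Lemma quot_scaleDl x : {morph quot_scale^~ x : a b / a + b}.
Proof.
by move=> a b; rewrite -(quot_reprK x) !quot_scaleE -raddfD scalerDl.
Qed.

HB.instance Definition _ := GRing.Zmodule_isLmodule.Build F quot_alg
  quot_scaleA quot_scale1 quot_scaleDr quot_scaleDl.

Lemma quot_projM x y : quot_proj (x * y) = quot_proj x * quot_proj y.
Proof. by rewrite -quot_mulE. Qed.
Lemma quot_proj_monoid : monoid_morphism quot_proj.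
Proof. by split=> // x y; apply: quot_projM. Qed.
Lemma quot_projZ : scalable quot_proj.
Proof. by move=> a x; rewrite -quot_scaleE. Qed.

Lemma quot_scaleAl a (x y : quot_alg) : a *: (x * y) = (a *: x) * y.
Proof.
rewrite -(quot_reprK x) -(quot_reprK y).
by rewrite -quot_projM -!quot_projZ -quot_projM scalerAl.
Qed.

HB.instance Definition _ :=
  GRing.Lmodule_isLalgebra.Build F quot_alg quot_scaleAl.

Lemma quot_scaleAr a (x y : quot_alg) : a *: (x * y) = x * (a *: y).
Proof.
rewrite -(quot_reprK x) -(quot_reprK y).
by rewrite -quot_projM -!quot_projZ -quot_projM scalerAr.
Qed.

HB.instance Definition _ :=
  GRing.Lalgebra_isAlgebra.Build F quot_alg quot_scaleAr.
HB.instance Definition _ :=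
  GRing.isMonoidMorphism.Build A quot_alg quot_proj quot_proj_monoid.
HB.instance Definition _ :=
  GRing.isScalable.Build F A quot_alg *:%R quot_proj quot_projZ.

End QuotAlg.

(** * Algebras given by generators and relations *)

Section FreeAlgebra.
Variables (F : comNzRingType) (X : choiceType).

(* [{fmonom X}] is the free monoid on [X], i.e. words in [X], so its monoid
   algebra is the free associative unital algebra F<X>.  The operations are
   those of [malg], locked so that unification does not unfold them. *)
Definition free_alg := {malg F[{fmonom X}]}.
HB.instance Definition _ := GRing.Zmodule.on free_alg.

Definition free_mul : free_alg -> free_alg -> free_alg := locked (@fgmul _ _).
Definition free_scale : F -> free_alg -> free_alg := locked (@fgscale _ _).

Lemma free_mulE : free_mul = @fgmul _ _. Proof. by rewrite /free_mul -lock. Qed.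
Lemma free_scaleE : free_scale = @fgscale _ _.
Proof. by rewrite /free_scale -lock. Qed.

Implicit Types (m : {fmonom X}) (x y z : free_alg).

Definition free_word : {fmonom X} -> free_alg := locked (fun m => << m >>).

Lemma free_wordE m : free_word m = << m >>.
Proof. by rewrite /free_word -lock. Qed.

Definition free_gen (g : X) : free_alg := free_word (fmu g).

Lemma free_mulA : associative free_mul.
Proof. by rewrite free_mulE; apply: fgmulA. Qed.
Lemma free_mul1 : left_id (free_word mone) free_mul.
Proof. by rewrite free_mulE free_wordE; apply: fgmul1g. Qed.
Lemma free_1mul : right_id (free_word mone) free_mul.
Proof. by rewrite free_mulE free_wordE; apply: fgmulg1. Qed.
Lemma free_mulDl : left_distributive free_mul +%R.
Proof. by rewrite free_mulE; apply: fgmulgDl. Qed.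
Lemma free_mulDr : right_distributive free_mul +%R.
Proof. by rewrite free_mulE; apply: fgmulgDr. Qed.
Lemma free_one_neq0 : free_word mone != 0.
Proof. by rewrite free_wordE; apply: fgoner_eq0. Qed.

HB.instance Definition _ := GRing.Zmodule_isNzRing.Build free_alg
  free_mulA free_mul1 free_1mul free_mulDl free_mulDr free_one_neq0.

Lemma free_scaleA a b x : free_scale a (free_scale b x) = free_scale (a * b) x.
Proof. by rewrite free_scaleE; apply: fgscaleA. Qed.
Lemma free_scale1 : left_id 1 free_scale.
Proof. by rewrite free_scaleE; apply: fgscale1r. Qed.
Lemma free_scaleDr : right_distributive free_scale +%R.
Proof. by rewrite free_scaleE; apply: fgscaleDr. Qed.
Lemma free_scaleDl x : {morph free_scale^~ x : a b / a + b}.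
Proof. by rewrite free_scaleE; apply: fgscaleDl. Qed.

HB.instance Definition _ := GRing.Zmodule_isLmodule.Build F free_alg
  free_scaleA free_scale1 free_scaleDr free_scaleDl.

Lemma free_wordZ (a : F) m : << a *g m >> = a *: free_word m.
Proof.
rewrite [RHS]/GRing.scale /= free_scaleE free_wordE; apply/malgP=> k.
by rewrite fgscaleE !mcoeffU mulrnAr mulr1.
Qed.

Lemma free_wordM m1 m2 : free_word (mmul m1 m2) = free_word m1 * free_word m2.
Proof. by rewrite [RHS]/GRing.mul /= free_mulE !free_wordE fgmulUU mulr1. Qed.

Lemma free_word1 : free_word mone = 1. Proof. by []. Qed.

Lemma free_algE x : x = \sum_(m <- msupp x) x@_m *: free_word m.
Proof. by rewrite {1}[x]monalgE; apply: eq_bigr => m _; rewrite free_wordZ. Qed.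

Lemma free_coeffZ a x m : (a *: x)@_m = a * x@_m.
Proof. by rewrite [X in X@__]/GRing.scale /= free_scaleE fgscaleE. Qed.

Lemma free_alg_ind (P : free_alg -> Prop) :
    (forall m, P (free_word m)) -> P 0 ->
    (forall x y, P x -> P y -> P (x + y)) -> (forall a x, P x -> P (a *: x)) ->
  forall x, P x.
Proof.
move=> Pw P0 PD PZ x; rewrite (free_algE x).
by apply: (big_ind P) => // m _; apply/PZ/Pw.
Qed.

Lemma free_wordZM a b m1 m2 : (a *: free_word m1) * (b *: free_word m2) =
  (a * b) *: (free_word m1 * free_word m2).
Proof.
rewrite -!free_wordZ -free_wordM -free_wordZ.
by rewrite [LHS]/GRing.mul /= free_mulE fgmulUU.
Qed.

Lemma free_scaleAl a x y : a *: (x * y) = (a *: x) * y.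
Proof.
elim/free_alg_ind: x a => [m a|a|x x' IH IH' a|b x IH a].
- elim/free_alg_ind: y => [m'||y y' IH IH'|b y IH].
  + by rewrite -[X in _ = _ * X]scale1r free_wordZM mulr1.
  + by rewrite !mulr0 scaler0.
  + by rewrite !mulrDr scalerDr IH IH'.
  + rewrite (free_algE y) !scaler_sumr !mulr_sumr scaler_sumr.
    apply: eq_bigr => k _; rewrite scalerA free_wordZM.
    by rewrite -[X in X * _]scale1r free_wordZM mul1r scalerA.
- by rewrite mul0r !scaler0 mul0r.
- by rewrite mulrDl !scalerDr IH IH' mulrDl.
- by rewrite scalerA -!IH scalerA.
Qed.

HB.instance Definition _ :=
  GRing.Lmodule_isLalgebra.Build F free_alg free_scaleAl.

Lemma free_scaleAr a x y : a *: (x * y) = x * (a *: y).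
Proof.
elim/free_alg_ind: x => [m||x x' IH IH'|b x IH].
- elim/free_alg_ind: y a => [m' a|a|y y' IH IH' a|b y IH a].
  + by rewrite -[X in _ = X * _]scale1r free_wordZM mul1r.
  + by rewrite scaler0 !mulr0 scaler0.
  + by rewrite scalerDr !mulrDr scalerDr IH IH'.
  + by rewrite scalerA -!IH scalerA.
- by rewrite !mul0r scaler0.
- by rewrite !mulrDl scalerDr IH IH'.
- by rewrite -!scalerAl -IH !scalerA mulrC.
Qed.

HB.instance Definition _ :=
  GRing.Lalgebra_isAlgebra.Build F free_alg free_scaleAr.

Section LinearExtension.
Variables (V : lmodType F) (h : {fmonom X} -> V).

Definition free_lin x : V := \sum_(m <- msupp x) x@_m *: h m.

Lemma free_linEw (d : {fset {fmonom X}}) x :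
  fsubset (msupp x) d -> free_lin x = \sum_(m <- d) x@_m *: h m.
Proof.
move=> le; rewrite [LHS](big_fset_incl _ le) => //= m _ /mcoeff_outdom ->.
by rewrite scale0r.
Qed.

Lemma free_lin_linear : linear free_lin.
Proof.
move=> a x y; pose d := (msupp x `|` msupp y)%fset.
rewrite (@free_linEw d x) ?fsubsetUl // (@free_linEw d y) ?fsubsetUr //.
rewrite (@free_linEw d (a *: x + y)); last first.
  apply: fsubset_trans (msuppD_le _ _) _.
  apply: fsetSU; apply/fsubsetP => m; rewrite -!mcoeff_neq0 free_coeffZ.
  by apply: contra_neq => ->; rewrite mulr0.
rewrite scaler_sumr -big_split /=; apply: eq_bigr => m _.
by rewrite mcoeffD free_coeffZ scalerDl scalerA.
Qed.

HB.instance Definition _ :=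
  GRing.isLinear.Build F free_alg V *:%R free_lin free_lin_linear.

Lemma free_lin_word m : free_lin (free_word m) = h m.
Proof.
rewrite free_wordE (@free_linEw (fset1 m)) ?msuppU_le // big_seq_fset1.
by rewrite mcoeffUU scale1r.
Qed.
End LinearExtension.

End FreeAlgebra.

Section FreeEvaluation.
Variables (F : comNzRingType) (X : choiceType).

Lemma fmonom_ind (P : {fmonom X} -> Prop) :
    P mone -> (forall g m, P m -> P (mmul (fmu g) m)) -> forall m, P m.
Proof.
move=> P1 PS [s]; elim: s => [|g s IH].
  by move: P1; congr P; apply/eqP; rewrite -val_eqE /= fm1.
by move: (PS g _ IH); congr P; apply/eqP; rewrite -val_eqE /= fmM fmU.
Qed.

Variables (S : algType F) (f : X -> S).

Definition free_eval : free_alg F X -> S :=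
  free_lin (fun m : {fmonom X} => \prod_(g <- m) f g).

Lemma free_eval_linear : linear free_eval.
Proof. exact: free_lin_linear. Qed.
HB.instance Definition _ :=
  GRing.isLinear.Build F (free_alg F X) S *:%R free_eval free_eval_linear.

Lemma free_eval_word m : free_eval (free_word F m) = \prod_(g <- m) f g.
Proof. exact: free_lin_word. Qed.

Lemma free_eval_gen g : free_eval (free_gen F g) = f g.
Proof. by rewrite free_eval_word fmU big_seq1. Qed.

Lemma free_eval_monoid : monoid_morphism free_eval.
Proof.
split; first by rewrite -free_word1 free_eval_word fm1 big_nil.
move=> x y; elim/free_alg_ind: x => [m||x x' IH IH'|a x IH].
- elim/free_alg_ind: y => [m'||y y' IH IH'|a y IH].
  + by rewrite -free_wordM !free_eval_word fmM big_cat.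
  + by rewrite mulr0 !linear0 mulr0.
  + by rewrite mulrDr !linearD /= IH IH' mulrDr.
  + by rewrite -scalerAr !linearZ /= IH scalerAr.
- by rewrite mul0r !linear0 mul0r.
- by rewrite mulrDl !linearD /= IH IH' mulrDl.
- by rewrite -scalerAl !linearZ /= IH scalerAl.
Qed.

HB.instance Definition _ :=
  GRing.isMonoidMorphism.Build (free_alg F X) S free_eval free_eval_monoid.

Lemma free_evalM x y : free_eval (x * y) = free_eval x * free_eval y.
Proof. exact: rmorphM. Qed.
Lemma free_evalD x y : free_eval (x + y) = free_eval x + free_eval y.
Proof. exact: raddfD. Qed.
Lemma free_evalN x : free_eval (- x) = - free_eval x.
Proof. exact: raddfN. Qed.
Lemma free_evalZ a x : free_eval (a *: x) = a *: free_eval x.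
Proof. exact: linearZ. Qed.
Lemma free_eval1 : free_eval 1 = 1. Proof. exact: rmorph1. Qed.
Lemma free_eval0 : free_eval 0 = 0. Proof. exact: raddf0. Qed.

Definition free_evalE := (free_eval_gen, free_eval1, free_eval0, free_evalM,
  free_evalD, free_evalN, free_evalZ).

End FreeEvaluation.

Section Relations.
Variables (F : comNzRingType) (A : algType F) (rel : A -> A -> Prop).

(* The two-sided ideal generated by the differences [l - r], for the
   relations [l = r] in [rel]. *)
Inductive rel_span : A -> Prop :=
| Rel_span a l r b : rel l r -> rel_span (a * (l - r) * b)
| Rel_span0 : rel_span 0
| Rel_spanD x y : rel_span x -> rel_span y -> rel_span (x + y).

Definition rel_ideal : A -> bool := fun x => `[< rel_span x >].

Lemma rel_span_mul a x b : rel_span x -> rel_span (a * x * b).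
Proof.
elim=> {x} [a' l r b' lr||x y _ IHx _ IHy].
- have -> : a * (a' * (l - r) * b') * b = (a * a') * (l - r) * (b' * b).
    by rewrite !mulrA.
  exact: Rel_span.
- by rewrite mulr0 mul0r; apply: Rel_span0.
- by rewrite mulrDr mulrDl; apply: Rel_spanD.
Qed.

Lemma rel_ideal_closed : ~ rel_span 1 -> idealr_closed rel_ideal.
Proof.
move=> n1; split.
- by apply/asboolP; apply: Rel_span0.
- by apply/negP => /asboolP.
- move=> a u v /asboolP hu /asboolP hv; apply/asboolP; apply: Rel_spanD => //.
  by rewrite -[a * u]mulr1; apply: rel_span_mul.
Qed.

Lemma rel_ideal_absorbing (u a : A) : rel_ideal u -> rel_ideal (u * a).
Proof.
move=> /asboolP hu; apply/asboolP; rewrite -[u]mul1r.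
exact: rel_span_mul.
Qed.

Lemma rel_idealP (l r : A) : rel l r -> l - r \in rel_ideal.
Proof.
move=> lr; apply/asboolP; rewrite -[l - r]mulr1 -[l - r]mul1r.
exact: Rel_span.
Qed.

Lemma rel_span_kernel (S : nzRingType) (f : {rmorphism A -> S}) :
  (forall l r, rel l r -> f l = f r) -> forall x, rel_span x -> f x = 0.
Proof.
move=> frel x; elim=> {x} [a l r b /frel lr||x y _ IHx _ IHy].
- by rewrite !rmorphM rmorphB /= lr subrr mulr0 mul0r.
- exact: rmorph0.
- by rewrite rmorphD /= IHx IHy addr0.
Qed.

Lemma rel_span_proper (S : nzRingType) (f : {rmorphism A -> S}) :
  (forall l r, rel l r -> f l = f r) -> ~ rel_span 1.
Proof.
move=> frel /(rel_span_kernel frel) /eqP.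
by rewrite rmorph1 oner_eq0.
Qed.

End Relations.

(** * The algebra R_k *)

Section HeckeDGA.
Variables (F : fieldType) (k : nat) (hbar : F).

Lemma ltn_ord_predS (i : 'I_k.-1) : (i.+1 < k)%N.
Proof. by case: k i => [|n] [i ilt] //=. Qed.

(* [ord_lo i] and [ord_hi i] are the positions [i] and [i+1] exchanged by the
   [i]-th simple transposition. *)
Definition ord_lo (i : 'I_k.-1) : 'I_k := widen_ord (leq_pred k) i.
Definition ord_hi (i : 'I_k.-1) : 'I_k := Ordinal (ltn_ord_predS i).

(* The generators, with indices shifted to start at 0: [inl i] with [i < k-1]
   stands for T_(i+1), and [inr j] with [j < k] for xi_(j+1). *)
Definition dgh_gen := ('I_k.-1 + 'I_k)%type.

Local Notation fT i := (free_gen F (inl i : dgh_gen)).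
Local Notation fX j := (free_gen F (inr j : dgh_gen)).

Inductive dgh_rel : free_alg F dgh_gen -> free_alg F dgh_gen -> Prop :=
| Rel_quad i : dgh_rel (fT i * fT i) (1 + hbar *: fT i)
| Rel_braid (i i' : 'I_k.-1) : i' = i.+1 :> nat ->
    dgh_rel (fT i * fT i' * fT i) (fT i' * fT i * fT i')
| Rel_far (i i' : 'I_k.-1) : (i.+1 < i')%N || (i'.+1 < i)%N ->
    dgh_rel (fT i * fT i') (fT i' * fT i)
| Rel_xi_sq j : dgh_rel (fX j * fX j) 0
| Rel_xi_anti j j' : j != j' -> dgh_rel (fX j * fX j') (- (fX j' * fX j))
| Rel_xi_lo i : dgh_rel (fX (ord_lo i) * fT i) (fT i * fX (ord_hi i))
| Rel_xi_hi i :
    dgh_rel (fX (ord_hi i) * fT i)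
            (fT i * fX (ord_lo i) - hbar *: (fX (ord_lo i) - fX (ord_hi i)))
| Rel_xi_far i j : j != ord_lo i -> j != ord_hi i ->
    dgh_rel (fX j * fT i) (fT i * fX j).

Definition dgh_ideal := rel_ideal dgh_rel.

(* [1] is not in the ideal: send every xi_j to 0 and every T_i to one matrix
   that satisfies the quadratic relation. *)
Definition dgh_aug_gen (g : dgh_gen) : 'M[F]_2 :=
  if g is inl _ then
    \matrix_(a, b) (if a == 0 then if b == 0 then 0 else 1
                    else if b == 0 then 1 else hbar)
  else 0.

Lemma dgh_aug_rel l r : dgh_rel l r ->
  free_eval dgh_aug_gen l = free_eval dgh_aug_gen r.
Proof.
case=> {l r} [i|i i' _|i i' _|j|j j' _|i|i|i j _ _]; rewrite !free_evalE //=;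
  rewrite ?mulr0 ?mul0r ?oppr0 ?subrr ?addr0 ?scaler0 ?subr0 //.
apply/matrixP=> a b; rewrite !mxE !big_ord_recl big_ord0 !mxE /=.
by case: a b => [[|[|a]] //= ?] [[|[|b]] //= ?];
  rewrite ?(mulr0, mul0r, mulr1, mul1r, addr0, add0r).
Qed.

Lemma dgh_ideal_closed : idealr_closed dgh_ideal.
Proof. exact/rel_ideal_closed/(rel_span_proper dgh_aug_rel). Qed.

HB.instance Definition _ :=
  isIdealr.Build (free_alg F dgh_gen) dgh_ideal dgh_ideal_closed.
HB.instance Definition _ := isRightAbsorbing.Build (free_alg F dgh_gen) dgh_ideal
  (@rel_ideal_absorbing _ _ dgh_rel).

Definition dgh := quot_alg dgh_ideal.
HB.instance Definition _ := GRing.Algebra.on dgh.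

Definition dgh_proj : free_alg F dgh_gen -> dgh := @quot_proj _ _ dgh_ideal.
HB.instance Definition _ := GRing.LRMorphism.on dgh_proj.

Lemma dgh_projM x y : dgh_proj (x * y) = dgh_proj x * dgh_proj y.
Proof. exact: rmorphM. Qed.
Lemma dgh_projD x y : dgh_proj (x + y) = dgh_proj x + dgh_proj y.
Proof. exact: raddfD. Qed.
Lemma dgh_projN x : dgh_proj (- x) = - dgh_proj x.
Proof. exact: raddfN. Qed.
Lemma dgh_projZ a x : dgh_proj (a *: x) = a *: dgh_proj x.
Proof. exact: linearZ. Qed.
Lemma dgh_proj1 : dgh_proj 1 = 1. Proof. exact: rmorph1. Qed.
Lemma dgh_proj0 : dgh_proj 0 = 0. Proof. exact: raddf0. Qed.

Definition dgh_projE :=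
  (dgh_projM, dgh_projD, dgh_projN, dgh_projZ, dgh_proj1, dgh_proj0).

Definition dghG (g : dgh_gen) : dgh := dgh_proj (free_gen F g).
Definition dghT (i : 'I_k.-1) : dgh := dghG (inl i).
Definition dghX (j : 'I_k) : dgh := dghG (inr j).

Lemma dgh_relP l r : dgh_rel l r -> dgh_proj l = dgh_proj r.
Proof. by move=> lr; apply/quot_projP; apply: rel_idealP. Qed.

Lemma dgh_proj_word m : dgh_proj (free_word F m) = \prod_(g <- m) dghG g.
Proof.
elim/fmonom_ind: m => [|g m IH]; first by rewrite fm1 big_nil rmorph1.
by rewrite free_wordM rmorphM /= IH fmM fmU big_cons.
Qed.

Lemma dgh_ind (P : dgh -> Prop) :
    P 1 -> (forall g x, P x -> P (dghG g * x)) -> P 0 ->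
    (forall x y, P x -> P y -> P (x + y)) -> (forall a x, P x -> P (a *: x)) ->
  forall x, P x.
Proof.
move=> P1 PG P0 PD PZ x; rewrite -(quot_reprK x) -/dgh_proj.
elim/free_alg_ind: (quot_repr x) => [m||y z Py Pz|a y Py].
- rewrite dgh_proj_word; elim: (fmonom_val m) => [|g s IH].
    by rewrite big_nil.
  by rewrite big_cons; apply: PG.
- by rewrite raddf0.
- by rewrite raddfD; apply: PD.
- by rewrite linearZ; apply: PZ.
Qed.

(** ** Universal property *)

Section Evaluation.
Variables (S : algType F) (f : dgh_gen -> S).

Definition dgh_eval (x : dgh) : S := free_eval f (quot_repr x).

Hypothesis frel : forall l r, dgh_rel l r -> free_eval f l = free_eval f r.

Lemma dgh_evalE x : dgh_eval (dgh_proj x) = free_eval f x.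
Proof.
apply/eqP; rewrite -subr_eq0 -rmorphB; apply/eqP.
apply: (rel_span_kernel frel); apply/asboolP.
exact: (@quot_proj_repr _ _ dgh_ideal).
Qed.

Lemma dgh_eval_linear : linear dgh_eval.
Proof.
move=> a x y; rewrite -(quot_reprK x) -(quot_reprK y) -/dgh_proj.
by rewrite -linearP !dgh_evalE linearP.
Qed.

Lemma dgh_evalM : {morph dgh_eval : x y / x * y}.
Proof.
move=> x y; rewrite -(quot_reprK x) -(quot_reprK y) -/dgh_proj.
by rewrite -rmorphM !dgh_evalE rmorphM.
Qed.

Lemma dgh_eval1 : dgh_eval 1 = 1.
Proof. by rewrite -(rmorph1 dgh_proj) dgh_evalE rmorph1. Qed.

Lemma dgh_evalG g : dgh_eval (dghG g) = f g.
Proof. by rewrite dgh_evalE free_eval_gen. Qed.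

End Evaluation.

(** ** Grading and differential *)

Definition dgh_gdeg (g : dgh_gen) : nat := if g is inr _ then 1 else 0.
Definition dgh_wdeg (m : {fmonom dgh_gen}) : nat :=
  (\sum_(g <- m) dgh_gdeg g)%N.

(* [x] is homogeneous of degree [n]: it is a combination of words of
   degree [n]. *)
Definition dgh_homog (n : nat) (x : dgh) : Prop :=
  exists2 y, dgh_proj y = x & {in msupp y, forall m, dgh_wdeg m = n}.

(* The sign automorphism, equal to (-1)^n on elements of degree [n]. *)
Definition dgh_sgn_gen (g : dgh_gen) : dgh := (-1) ^+ dgh_gdeg g * dghG g.
Definition dgh_sgn : dgh -> dgh := dgh_eval dgh_sgn_gen.

Definition dgh_diff_gen (g : dgh_gen) : dgh :=
  if g is inl i then dghX (ord_lo i) - dghX (ord_hi i) else 0.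

(* The differential on words, by the graded Leibniz rule. *)
Fixpoint dgh_diff_word (s : seq dgh_gen) : dgh :=
  if s is g :: s' then
    dgh_diff_gen g * \prod_(g' <- s') dghG g'
      + (-1) ^+ dgh_gdeg g * dghG g * dgh_diff_word s'
  else 0.

Definition dgh_diff_free : free_alg F dgh_gen -> dgh :=
  free_lin (fun m : {fmonom dgh_gen} => dgh_diff_word m).
HB.instance Definition _ := GRing.isLinear.Build F (free_alg F dgh_gen) dgh *:%R
  dgh_diff_free (free_lin_linear (fun m : {fmonom dgh_gen} => dgh_diff_word m)).

Definition dgh_diff (x : dgh) : dgh := dgh_diff_free (quot_repr x).

Lemma dghT_quad i : dghT i * dghT i = 1 + hbar *: dghT i.
Proof. by have /dgh_relP := Rel_quad i; rewrite !dgh_projE. Qed.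
Lemma dghT_braid (i i' : 'I_k.-1) : i' = i.+1 :> nat ->
  dghT i * dghT i' * dghT i = dghT i' * dghT i * dghT i'.
Proof. by move=> /Rel_braid /dgh_relP; rewrite !dgh_projE. Qed.
Lemma dghT_far (i i' : 'I_k.-1) : (i.+1 < i')%N || (i'.+1 < i)%N ->
  dghT i * dghT i' = dghT i' * dghT i.
Proof. by move=> /Rel_far /dgh_relP; rewrite !dgh_projE. Qed.
Lemma dghX_sq j : dghX j * dghX j = 0.
Proof. by have /dgh_relP := Rel_xi_sq j; rewrite !dgh_projE. Qed.
Lemma dghX_anti j j' : dghX j * dghX j' = - (dghX j' * dghX j).
Proof.
have [->|/Rel_xi_anti /dgh_relP] := eqVneq j j'; first by rewrite dghX_sq oppr0.
by rewrite !dgh_projE.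
Qed.
Lemma dghXT_lo i : dghX (ord_lo i) * dghT i = dghT i * dghX (ord_hi i).
Proof. by have /dgh_relP := Rel_xi_lo i; rewrite !dgh_projE. Qed.
Lemma dghXT_hi i : dghX (ord_hi i) * dghT i =
  dghT i * dghX (ord_lo i) - hbar *: (dghX (ord_lo i) - dghX (ord_hi i)).
Proof. by have /dgh_relP := Rel_xi_hi i; rewrite !dgh_projE. Qed.
Lemma dghXT_far i j : j != ord_lo i -> j != ord_hi i ->
  dghX j * dghT i = dghT i * dghX j.
Proof.
by move=> lo hi; have /dgh_relP := Rel_xi_far lo hi; rewrite !dgh_projE.
Qed.

Lemma dgh_sgn_rel l r : dgh_rel l r ->
  free_eval dgh_sgn_gen l = free_eval dgh_sgn_gen r.
Proof.
have sT i : dgh_sgn_gen (inl i) = dghT i by rewrite /dgh_sgn_gen expr0 mul1r.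
have sX j : dgh_sgn_gen (inr j) = - dghX j.
  by rewrite /dgh_sgn_gen expr1 mulN1r.
case=> {l r} [i|i i' e|i i' e|j|j j' _|i|i|i j lo hi]; rewrite !free_evalE ?sT ?sX.
- exact: dghT_quad.
- exact: dghT_braid.
- exact: dghT_far.
- by rewrite mulrNN dghX_sq.
- by rewrite !mulrNN dghX_anti.
- by rewrite mulNr mulrN dghXT_lo.
- by rewrite mulNr mulrN dghXT_hi -[- dghX _ - _]opprD scalerN -opprD.
- by rewrite mulNr mulrN dghXT_far.
Qed.

Lemma dgh_sgnM x y : dgh_sgn (x * y) = dgh_sgn x * dgh_sgn y.
Proof. exact: (dgh_evalM dgh_sgn_rel). Qed.
Lemma dgh_sgn1 : dgh_sgn 1 = 1. Proof. exact: (dgh_eval1 dgh_sgn_rel). Qed.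
Lemma dgh_sgn_linear : linear dgh_sgn.
Proof. exact: (dgh_eval_linear dgh_sgn_rel). Qed.
HB.instance Definition _ :=
  GRing.isLinear.Build F dgh dgh *:%R dgh_sgn dgh_sgn_linear.
Lemma dgh_sgnD x y : dgh_sgn (x + y) = dgh_sgn x + dgh_sgn y.
Proof. exact: raddfD. Qed.
Lemma dgh_sgnN x : dgh_sgn (- x) = - dgh_sgn x.
Proof. exact: raddfN. Qed.
Lemma dgh_sgnZ a x : dgh_sgn (a *: x) = a *: dgh_sgn x.
Proof. exact: linearZ. Qed.
Lemma dgh_sgn0 : dgh_sgn 0 = 0. Proof. exact: raddf0. Qed.

Lemma dgh_sgn_word m : dgh_sgn (dgh_proj (free_word F m)) =
  (-1) ^+ dgh_wdeg m * dgh_proj (free_word F m).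
Proof.
rewrite /dgh_sgn dgh_evalE; last exact: dgh_sgn_rel.
rewrite free_eval_word dgh_proj_word /dgh_wdeg.
elim: (fmonom_val m) => [|g s IH]; first by rewrite !big_nil expr0 mulr1.
rewrite !big_cons IH /dgh_sgn_gen exprD -!mulrA; congr (_ * _).
by rewrite !mulrA (commr_sign (dghG g)).
Qed.

Lemma dgh_sgn_homog n x : dgh_homog n x -> dgh_sgn x = (-1) ^+ n * x.
Proof.
case=> y <- hy.
have -> : dgh_proj y = \sum_(m <- msupp y) y@_m *: dgh_proj (free_word F m).
  rewrite {1}(free_algE y) raddf_sum; apply: eq_bigr => m _; exact: dgh_projZ.
rewrite raddf_sum mulr_sumr big_seq [RHS]big_seq; apply: eq_bigr => m /hy <-.
by rewrite /= dgh_sgnZ dgh_sgn_word scalerAr.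
Qed.

Lemma dgh_diff_free_word m : dgh_diff_free (free_word F m) = dgh_diff_word m.
Proof. exact: free_lin_word. Qed.

Lemma dgh_diff_freeD x y :
  dgh_diff_free (x + y) = dgh_diff_free x + dgh_diff_free y.
Proof. exact: raddfD. Qed.
Lemma dgh_diff_freeN x : dgh_diff_free (- x) = - dgh_diff_free x.
Proof. exact: raddfN. Qed.
Lemma dgh_diff_freeZ a x : dgh_diff_free (a *: x) = a *: dgh_diff_free x.
Proof. exact: linearZ. Qed.
Lemma dgh_diff_free0 : dgh_diff_free 0 = 0. Proof. exact: raddf0. Qed.

Lemma dgh_diff_freeM x y : dgh_diff_free (x * y) =
  dgh_diff_free x * dgh_proj y + dgh_sgn (dgh_proj x) * dgh_diff_free y.
Proof.
elim/free_alg_ind: x => [m||x x' IH IH'|a x IH].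
- elim/free_alg_ind: y => [m'||y y' IH IH'|a y IH].
  + rewrite -free_wordM !dgh_diff_free_word dgh_sgn_word !dgh_proj_word.
    rewrite fmM /dgh_wdeg; elim: (fmonom_val m) => [|g s IH] /=.
      by rewrite !big_nil mul0r add0r expr0 !mul1r.
    rewrite IH big_cat !big_cons /= mulrDl mulrDr -!mulrA -addrA.
    congr (_ + (_ + _)); rewrite exprD !mulrA; congr (_ * _).
    by rewrite -!mulrA; congr (_ * _); rewrite !mulrA (commr_sign (dghG g)).
  + by rewrite mulr0 dgh_diff_free0 dgh_proj0 !mulr0 addr0.
  + by rewrite mulrDr !dgh_diff_freeD dgh_projD IH IH' !mulrDr addrACA.
  + by rewrite -scalerAr !dgh_diff_freeZ dgh_projZ IH -!scalerAr scalerDr.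
- by rewrite mul0r dgh_diff_free0 dgh_proj0 dgh_sgn0 !mul0r addr0.
- by rewrite mulrDl !dgh_diff_freeD dgh_projD dgh_sgnD IH IH' !mulrDl addrACA.
- by rewrite -scalerAl !dgh_diff_freeZ dgh_projZ dgh_sgnZ IH -!scalerAl scalerDr.
Qed.

Lemma dgh_diff_free1 : dgh_diff_free 1 = 0.
Proof. by rewrite -free_word1 dgh_diff_free_word fm1. Qed.

Lemma dgh_diff_free_gen g : dgh_diff_free (free_gen F g) = dgh_diff_gen g.
Proof. by rewrite dgh_diff_free_word fmU /= big_nil !mulr1 mulr0 addr0. Qed.

Lemma dgh_sgnG g : dgh_sgn (dghG g) = (-1) ^+ dgh_gdeg g * dghG g.
Proof. exact: (dgh_evalG dgh_sgn_rel). Qed.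

Lemma dgh_sgnT i : dgh_sgn (dghT i) = dghT i.
Proof. by rewrite /dghT dgh_sgnG mul1r. Qed.
Lemma dgh_sgnX j : dgh_sgn (dghX j) = - dghX j.
Proof. by rewrite /dghX dgh_sgnG mulN1r. Qed.

Local Notation delta i := (dghX (ord_lo i) - dghX (ord_hi i)).

Lemma dgh_delta_quad i : delta i * dghT i = - (dghT i * delta i) + hbar *: delta i.
Proof.
rewrite mulrBl dghXT_lo dghXT_hi mulrBr !opprB addrCA addrC -addrA.
by congr (_ + _); rewrite addrC.
Qed.

Lemma dgh_delta_braid (i i' : 'I_k.-1) : i' = i.+1 :> nat ->
  delta i * dghT i' * dghT i + dghT i * delta i' * dghT i
    + dghT i * dghT i' * delta i =
  delta i' * dghT i * dghT i' + dghT i' * delta i * dghT i'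
    + dghT i' * dghT i * delta i'.
Proof.
move=> e; have mid : ord_lo i' = ord_hi i by apply: val_inj.
set s := dghT i; set t := dghT i'.
set x1 := dghX (ord_lo i); set x2 := dghX (ord_hi i); set x3 := dghX (ord_hi i').
have x1s : x1 * s = s * x2 by exact: dghXT_lo.
have x2s : x2 * s = s * x1 - hbar *: (x1 - x2) by exact: dghXT_hi.
have x2t : x2 * t = t * x3 by rewrite /x2 -mid; exact: dghXT_lo.
have x3t : x3 * t = t * x2 - hbar *: (x2 - x3).
  by rewrite /x2 -mid; exact: dghXT_hi.
have x3s : x3 * s = s * x3.
  by rewrite /x3 /s dghXT_far //; apply/eqP => /(congr1 val) /=; lia.
have x1t : x1 * t = t * x1.
  by rewrite /x1 /t dghXT_far //; apply/eqP => /(congr1 val) /=; lia.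
have ss : s * s = 1 + hbar *: s by exact: dghT_quad.
have tt : t * t = 1 + hbar *: t by exact: dghT_quad.
have h1 : (x1 - x2) * t = t * (x1 - x3) by rewrite mulrBl x1t x2t mulrBr.
have h2 : (x1 - x3) * s = s * (x2 - x3) by rewrite mulrBl x1s x3s mulrBr.
have h3 : (x2 - x3) * s = s * (x1 - x3) - hbar *: (x1 - x2).
  by rewrite mulrBl x2s x3s mulrBr addrAC.
have h4 : (x1 - x3) * t = t * (x1 - x2) + hbar *: (x2 - x3).
  by rewrite mulrBl x1t x3t opprB mulrBr addrCA addrC.
rewrite mid -/x2.
have -> : (x1 - x2) * t * s = t * s * (x2 - x3).
  by rewrite h1 -[LHS]mulrA h2 mulrA.
have -> : s * (x2 - x3) * s = (x1 - x3) + hbar *: (s * (x2 - x3)).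
  rewrite -[LHS]mulrA h3 mulrBr mulrA ss mulrDl mul1r -scalerAr -scalerAl.
  rewrite -addrA -scalerBr -mulrBr; congr (_ + _ *: (_ * _)).
  by rewrite opprB addrC addrA subrK.
have -> : t * (x1 - x2) * t = (x1 - x3) + hbar *: (t * (x1 - x3)).
  by rewrite -[LHS]mulrA h1 mulrA tt mulrDl mul1r -scalerAl.
have -> : (x2 - x3) * s * t = s * t * (x1 - x2) - hbar *: (t * (x1 - x3))
    + hbar *: (s * (x2 - x3)).
  by rewrite h3 mulrBl -scalerAl h1 -[s * _ * t]mulrA h4 mulrDr mulrA -scalerAr addrAC.
set A := t * s * _; set S := hbar *: _; set B := s * t * _; set C := hbar *: _.
set P := x1 - x3; rewrite -addrA [RHS]addrC; congr (_ + _).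
by rewrite [B - C + S]addrAC [P + C]addrC addrA subrK addrC [P + S]addrC addrA.
Qed.

Lemma dgh_diff_rel l r : dgh_rel l r -> dgh_diff_free l = dgh_diff_free r.
Proof.
pose dfE := (dgh_diff_freeD, dgh_diff_freeN, dgh_diff_freeZ, dgh_diff_free0,
  dgh_diff_freeM, dgh_diff_free1, dgh_diff_free_gen, dgh_projM).
case=> {l r} [i|i i' e|i i' far|j|j j' _|i|i|i j lo hi]; rewrite !dfE /=;
  rewrite -?/(dghG _) -?/(dghT _) -?/(dghX _) ?dgh_sgnM ?dgh_sgnT ?dgh_sgnX.
- by rewrite dgh_delta_quad add0r addrAC addNr add0r.
- rewrite [(_ * _ + _ * _) * dghT i]mulrDl [(_ * _ + _ * _) * dghT i']mulrDl.
  exact: dgh_delta_braid.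
- have ll : ord_lo i != ord_lo i' by apply/eqP => /(congr1 val) /=; lia.
  have lh : ord_lo i != ord_hi i' by apply/eqP => /(congr1 val) /=; lia.
  have hl : ord_hi i != ord_lo i' by apply/eqP => /(congr1 val) /=; lia.
  have hh : ord_hi i != ord_hi i' by apply/eqP => /(congr1 val) /=; lia.
  rewrite mulrBl !dghXT_far // mulrBr mulrBr mulrBl !dghXT_far 1?eq_sym //.
  by rewrite addrC.
- by rewrite mul0r mulr0 addr0.
- by rewrite !mul0r !mulr0 !addr0 oppr0.
- rewrite mul0r add0r mulr0 addr0 mulNr mulrBr mulrBl !dghX_sq.
  by rewrite sub0r subr0 opprK.
- rewrite mul0r add0r mulr0 addr0 subr0 scaler0 subr0 mulNr mulrBr mulrBl !dghX_sq.
  by rewrite sub0r subr0.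
- rewrite mul0r add0r mulr0 addr0 mulNr mulrBr mulrBl.
  by rewrite (dghX_anti j) (dghX_anti j (ord_hi i)) opprB opprK addrC.
Qed.

Lemma dgh_diffE x : dgh_diff (dgh_proj x) = dgh_diff_free x.
Proof.
apply/eqP; rewrite -subr_eq0 -dgh_diff_freeN -dgh_diff_freeD; apply/eqP.
have /asboolP : quot_repr (dgh_proj x) - x \in dgh_ideal.
  exact: quot_proj_repr.
elim=> [a l r b lr||y z _ IHy _ IHz].
- have pi0 : dgh_proj (l - r) = 0.
    by rewrite dgh_projD dgh_projN (dgh_relP lr) subrr.
  have d0 : dgh_diff_free (l - r) = 0.
    by rewrite dgh_diff_freeD dgh_diff_freeN (dgh_diff_rel lr) subrr.
  rewrite !dgh_diff_freeM dgh_projM pi0 d0 !mulr0 addr0 mul0r add0r.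
  by rewrite dgh_sgn0 mul0r.
- exact: dgh_diff_free0.
- by rewrite dgh_diff_freeD IHy IHz addr0.
Qed.

Lemma dgh_projP (P : dgh -> Prop) : (forall y, P (dgh_proj y)) -> forall x, P x.
Proof. by move=> h x; rewrite -(quot_reprK x). Qed.

Lemma dgh_diff_linear : linear dgh_diff.
Proof.
move=> a; elim/dgh_projP=> x; elim/dgh_projP=> y.
by rewrite -dgh_projZ -dgh_projD !dgh_diffE dgh_diff_freeD dgh_diff_freeZ.
Qed.
HB.instance Definition _ :=
  GRing.isLinear.Build F dgh dgh *:%R dgh_diff dgh_diff_linear.

Lemma dgh_diffD x y : dgh_diff (x + y) = dgh_diff x + dgh_diff y.
Proof. exact: raddfD. Qed.
Lemma dgh_diffN x : dgh_diff (- x) = - dgh_diff x.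
Proof. exact: raddfN. Qed.
Lemma dgh_diffZ a x : dgh_diff (a *: x) = a *: dgh_diff x.
Proof. exact: linearZ. Qed.
Lemma dgh_diff0 : dgh_diff 0 = 0. Proof. exact: raddf0. Qed.

Lemma dgh_diff1 : dgh_diff 1 = 0.
Proof. by rewrite -dgh_proj1 dgh_diffE dgh_diff_free1. Qed.
Lemma dgh_diffT i : dgh_diff (dghT i) = dghX (ord_lo i) - dghX (ord_hi i).
Proof. by rewrite dgh_diffE dgh_diff_free_gen. Qed.
Lemma dgh_diffX j : dgh_diff (dghX j) = 0.
Proof. by rewrite dgh_diffE dgh_diff_free_gen. Qed.

Lemma dgh_diffM x y :
  dgh_diff (x * y) = dgh_diff x * y + dgh_sgn x * dgh_diff y.
Proof.
elim/dgh_projP: x => x; elim/dgh_projP: y => y.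
by rewrite -dgh_projM !dgh_diffE dgh_diff_freeM.
Qed.

Lemma dgh_leibniz n x y : dgh_homog n x ->
  dgh_diff (x * y) = dgh_diff x * y + (-1) ^+ n * (x * dgh_diff y).
Proof. by move=> hx; rewrite dgh_diffM (dgh_sgn_homog hx) mulrA. Qed.

Lemma dgh_diff_sgn x : dgh_diff (dgh_sgn x) = - dgh_sgn (dgh_diff x).
Proof.
elim/dgh_ind: x => [|g x IH||x y IHx IHy|a x IH].
- by rewrite dgh_sgn1 dgh_diff1 dgh_sgn0 oppr0.
- have hg : dgh_diff (dgh_sgn (dghG g)) = - dgh_sgn (dgh_diff (dghG g)).
    case: g => [i|j]; rewrite -/(dghT _) -/(dghX _).
      by rewrite dgh_sgnT dgh_diffT dgh_sgnD dgh_sgnN !dgh_sgnX opprD !opprK.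
    by rewrite dgh_sgnX dgh_diffN dgh_diffX dgh_sgn0.
  rewrite dgh_sgnM !dgh_diffM hg IH dgh_sgnD !dgh_sgnM.
  by rewrite mulrN mulNr opprD.
- by rewrite dgh_sgn0 dgh_diff0 dgh_sgn0 oppr0.
- by rewrite dgh_sgnD !dgh_diffD IHx IHy dgh_sgnD opprD.
- by rewrite dgh_sgnZ !dgh_diffZ IH dgh_sgnZ scalerN.
Qed.

Lemma dgh_diff_diff x : dgh_diff (dgh_diff x) = 0.
Proof.
elim/dgh_ind: x => [|g x IH||x y IHx IHy|a x IH].
- by rewrite dgh_diff1 dgh_diff0.
- have hg : dgh_diff (dgh_diff (dghG g)) = 0.
    case: g => [i|j]; rewrite -/(dghT _) -/(dghX _).
      by rewrite dgh_diffT dgh_diffD dgh_diffN !dgh_diffX subrr.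
    by rewrite dgh_diffX dgh_diff0.
  rewrite dgh_diffM dgh_diffD !dgh_diffM hg IH dgh_diff_sgn mul0r mulr0.
  by rewrite add0r addr0 mulNr subrr.
- by rewrite !dgh_diff0.
- by rewrite !dgh_diffD IHx IHy addr0.
- by rewrite !dgh_diffZ IH scaler0.
Qed.

Lemma dgh_sgnK x : dgh_sgn (dgh_sgn x) = x.
Proof.
elim/dgh_ind: x => [|g x IH||x y IHx IHy|a x IH].
- by rewrite !dgh_sgn1.
- rewrite !dgh_sgnM IH; congr (_ * _).
  case: g => [i|j]; rewrite -/(dghT _) -/(dghX _); first by rewrite !dgh_sgnT.
  by rewrite dgh_sgnX dgh_sgnN dgh_sgnX opprK.
- by rewrite !dgh_sgn0.
- by rewrite !dgh_sgnD IHx IHy.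
- by rewrite !dgh_sgnZ IH.
Qed.

(** ** Cohomology *)

Definition dgh_closed : dgh -> bool := fun x => dgh_diff x == 0.

Lemma dgh_closed_subalg : GRing.subalg_closed dgh_closed.
Proof.
split=> [|a x y /eqP hx /eqP hy|x y /eqP hx /eqP hy]; apply/eqP.
- exact: dgh_diff1.
- by rewrite dgh_diffD dgh_diffZ hx hy scaler0 addr0.
- by rewrite dgh_diffM hx hy mul0r mulr0 addr0.
Qed.
HB.instance Definition _ := GRing.isSubalgClosed.Build F dgh dgh_closed
  (GRing.subalg_closed_semi dgh_closed_subalg).

Record cocycle : Type :=
  Cocycle { cocycle_val : dgh; cocycleP : dgh_closed cocycle_val }.

HB.instance Definition _ := [isSub for cocycle_val].
HB.instance Definition _ := [Choice of cocycle by <:].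
HB.instance Definition _ := [SubChoice_isSubAlgebra of cocycle by <:].

Definition coboundary : cocycle -> bool :=
  fun z => `[< exists w, cocycle_val z = dgh_diff w >].

Lemma dgh_aug_diff w : dgh_eval dgh_aug_gen (dgh_diff w) = 0.
Proof.
pose e := dgh_eval dgh_aug_gen.
have eM x y : e (x * y) = e x * e y by exact: (dgh_evalM dgh_aug_rel).
have eP a x y : e (a *: x + y) = a *: e x + e y.
  exact: (dgh_eval_linear dgh_aug_rel).
have e0 : e 0 = 0 by have := eP (-1) 0 0; rewrite scaler0 addr0 scaleN1r addNr.
have eG g : e (dghG g) = dgh_aug_gen g by exact: (dgh_evalG dgh_aug_rel).
have eX j : e (dghX j) = 0 by exact: eG.
rewrite -/e; elim/dgh_ind: w => [|g x IH||x y IHx IHy|a x IH].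
- by rewrite dgh_diff1.
- rewrite dgh_diffM -(scale1r (_ * _)) eP !eM IH mulr0 addr0 scale1r.
  case: g => [i|j]; rewrite -/(dghT _) -/(dghX _).
    by rewrite dgh_diffT addrC -scaleN1r eP !eX scaler0 addr0 mul0r.
  by rewrite dgh_diffX e0 mul0r.
- by rewrite dgh_diff0.
- by rewrite dgh_diffD -(scale1r (dgh_diff x)) eP IHx IHy scaler0 addr0.
- by rewrite dgh_diffZ -[_ *: _]addr0 eP IH e0 scaler0 addr0.
Qed.

Lemma coboundary_closed : idealr_closed coboundary.
Proof.
split=> [||a u v /asboolP[w hw] /asboolP[w' hw']].
- by apply/asboolP; exists 0; rewrite dgh_diff0.
- apply/negP => /asboolP[w hw].
  have := dgh_aug_diff w; rewrite -hw (dgh_eval1 dgh_aug_rel) => /eqP.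
  by rewrite oner_eq0.
- apply/asboolP; exists (dgh_sgn (cocycle_val a) * w + w').
  rewrite dgh_diffD dgh_diffM dgh_diff_sgn (eqP (cocycleP a)) dgh_sgn0 oppr0.
  by rewrite mul0r add0r dgh_sgnK -hw -hw'.
Qed.

Lemma coboundary_absorbing (u a : cocycle) : coboundary u -> coboundary (u * a).
Proof.
move=> /asboolP[w hw]; apply/asboolP; exists (w * cocycle_val a).
by rewrite dgh_diffM (eqP (cocycleP a)) mulr0 addr0 -hw.
Qed.

HB.instance Definition _ := isIdealr.Build cocycle coboundary coboundary_closed.
HB.instance Definition _ :=
  isRightAbsorbing.Build cocycle coboundary coboundary_absorbing.

Definition cohomology := quot_alg coboundary.
HB.instance Definition _ := GRing.Algebra.on cohomology.

Definition coh_class : cocycle -> cohomology := @quot_proj _ _ coboundary.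

Lemma coh_classP (z z' : cocycle) : coh_class z = coh_class z' <->
  exists w, cocycle_val z - cocycle_val z' = dgh_diff w.
Proof.
split=> [/quot_projP /asboolP // | h].
by apply/quot_projP/asboolP.
Qed.

(** ** The elements h_(k,i) *)

(* Generators indexed from 1 by natural numbers; 0 out of range. *)
Definition dghTn (i : nat) : dgh :=
  if i is i'.+1 then oapp dghT 0 (insub i') else 0.
Definition dghXn (j : nat) : dgh :=
  if j is j'.+1 then oapp dghX 0 (insub j') else 0.

Definition dghTinv (i : nat) : dgh := dghTn i - hbar%:A.

Lemma dghTinvP i : (0 < i < k)%N ->
  dghTn i * dghTinv i = 1 /\ dghTinv i * dghTn i = 1.
Proof.
case: i => [//|i] /andP[_ ik]; have ik' : (i < k.-1)%N by lia.
rewrite /dghTinv /= (insubT (fun i => i < k.-1)%N ik') /=.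
by rewrite mulrBl mulrBr dghT_quad mulr_algl mulr_algr addrK.
Qed.

(* [dgh_h n i] is h_(n,i) for 1 <= n <= k, read in R_k through the inclusion
   of R_n in R_k; the value at [n = 0] is a placeholder. *)
Fixpoint dgh_h (n : nat) (i : int) : dgh :=
  match n with
  | 0%N => 0
  | 1%N => if i == 1 then dghXn 1 else 0
  | (m.+1)%N => dgh_h m i
      - dghTinv m * dgh_h m (i - 1)
      + dgh_h m (i - 1) * dghTn m
      - dghTinv m * dgh_h m (i - 2) * dghTn m
  end.

End HeckeDGA.

(** * Exterior algebras *)

Section Exterior.
Variables (F : fieldType) (k : nat).

(* The exterior algebra of F^k is the tensor algebra, i.e. the free algebra on
   the standard basis, modulo the squares of all vectors. *)
Definition ext_vec (v : 'rV[F]_k) : free_alg F 'I_k :=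
  \sum_(i < k) v 0 i *: free_gen F i.

Inductive ext_rel : free_alg F 'I_k -> free_alg F 'I_k -> Prop :=
| Ext_sq v : ext_rel (ext_vec v * ext_vec v) 0.

Definition ext_ideal := rel_ideal ext_rel.

Lemma ext_ideal_closed : idealr_closed ext_ideal.
Proof.
apply: rel_ideal_closed.
pose S : algType F := F^o; pose e := free_eval (fun _ : 'I_k => 0 : S).
apply: (@rel_span_proper _ _ _ S e) => l r [v].
rewrite /= free_evalM free_eval0 /ext_vec raddf_sum big1 ?mul0r // => i _.
by rewrite /= free_evalZ free_eval_gen scaler0.
Qed.

HB.instance Definition _ :=
  isIdealr.Build (free_alg F 'I_k) ext_ideal ext_ideal_closed.
HB.instance Definition _ := isRightAbsorbing.Build (free_alg F 'I_k) ext_ideal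
  (@rel_ideal_absorbing _ _ ext_rel).

Definition exterior := quot_alg ext_ideal.
HB.instance Definition _ := GRing.Algebra.on exterior.

Definition ext_gen (i : 'I_k) : exterior :=
  @quot_proj _ _ ext_ideal (free_gen F i).

End Exterior.

(* Main.v *)
(* Number generators from 0, so that R_(n+1) is generated by T_i, i < n, and
   xi_j, j <= n.  It is a free right module over the subalgebra
   B = R_n + xi_n R_n, with basis b_j = T_j ... T_(n-1) for 0 <= j <= n.  Write d
   as a part that preserves the xi_n-degree and a part d_n that raises it; d_n is
   right linear over R_n and sends b_j to -b_(j+1) plus later terms.  Hence its
   kernel is b_n R_n = R_n, its cokernel is b_0 R_n, and
   H(R_(n+1)) = H(R_n) + h H(R_n) for every closed h of the form
   b_0 xi_n + (terms without b_0 xi_n).  The element h_(n+1,n+1) has this form,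
   while h_(n+1,i), for i <= n, is a unitriangular combination of the h_(n,j),
   so that an induction on n applies.

   The generating series satisfy
   h_(k+1)(s) = (1 - s T^-1) h_k(s) (1 + s T), where T is the last generator of
   R_(k+1).  This gives d h_k(s) = s {xi, h_k(s)} with xi the last odd generator
   of R_k, hence closedness up to degree k.  It also gives a reflection equation
   for h_k(s) and h_k(t), by the Yang-Baxter equation for the factors a + b T;
   its coefficients say that the h_(k,i), i <= k, anticommute in R_k itself. *)
From Stdlib Require Ncring Ncring_tac.
From HB Require Import structures.
Require Import Defs.
From mathcomp Require Import all_boot all_order all_algebra.
From mathcomp Require Import zify boolp.

Set Implicit Arguments.
Unset Strict Implicit.
Unset Printing Implicit Defensive.

Import Order.TTheory GRing.Theory Num.Theory.
Local Open Scope ring_scope.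

(** * The algebra of endomorphisms of a nonzero module *)

(** Since R_(n+1) is a quotient by relations, nothing visibly keeps the b_j independent over B. So
    left multiplication is written out in the expected coordinates, as operators on B^(n+1). Once
    these satisfy the defining relations, R_(n+1) acts, and applying an element to the vector of 1
    reads off its coordinates. Only the T_i and the first xi are given by formulas: the other xi
    must be the conjugates xi_(j+1) = T_j^-1 xi_j T_j, and their relations follow from three
    conditions on the first xi.

    Because the h_(k,i) anticommute on the nose and not only up to boundaries, the exterior algebra
    maps to R_k itself by an algebra morphism. The induction can thus work with elements of R_n
    modulo boundaries, starting from R_0 = F, and cohomology appears only at the end. Characteristic
    different from 2 turns anticommutation into the vanishing of the squares of all linear
    combinations, which the exterior relations demand. *)

Section Endomorphisms.
Variables (F : comNzRingType) (V : lmodType F).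

Record endo_map := EndoMap { endo_fun :> V -> V; endo_linear : linear endo_fun }.

HB.instance Definition _ := gen_eqMixin endo_map.
HB.instance Definition _ := gen_choiceMixin endo_map.
HB.instance Definition _ (f : endo_map) :=
  GRing.isLinear.Build F V V *:%R (endo_fun f) (endo_linear f).

Lemma endoP (f g : endo_map) : (forall v, f v = g v) <-> f = g.
Proof.
split=> [|-> //]; case: f g => [f fl] [g gl] /= /funext fg.
by case: _ / fg gl => gl; congr EndoMap; apply: Prop_irrelevance.
Qed.

Lemma endo_mapZ (f : endo_map) a v : f (a *: v) = a *: f v.
Proof. exact: linearZ. Qed.

Fact endo0_subproof : linear (fun _ : V => 0 : V).
Proof. by move=> a u v; rewrite scaler0 addr0. Qed.
Fact endoD_subproof (f g : endo_map) : linear (fun v => f v + g v).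
Proof. by move=> a u v; rewrite !linearP /= scalerDr addrACA. Qed.
Fact endoN_subproof (f : endo_map) : linear (fun v => - f v).
Proof. by move=> a u v; rewrite linearP opprD scalerN. Qed.
Fact endoZ_subproof c (f : endo_map) : linear (fun v => c *: f v).
Proof. by move=> a u v; rewrite linearP scalerDr !scalerA mulrC. Qed.
Fact endo1_subproof : linear (fun v : V => v).
Proof. by []. Qed.
Fact endoM_subproof (f g : endo_map) : linear (fun v => f (g v)).
Proof. by move=> a u v; rewrite !linearP. Qed.

Definition endo0 := EndoMap endo0_subproof.
Definition endo1 := EndoMap endo1_subproof.
Definition endoD f g := EndoMap (endoD_subproof f g).
Definition endoN f := EndoMap (endoN_subproof f).
Definition endoZ c f := EndoMap (endoZ_subproof c f).
Definition endoM f g := EndoMap (endoM_subproof f g).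

Fact endoDA : associative endoD.
Proof. by move=> f g h; apply/endoP=> v; apply: addrA. Qed.
Fact endoDC : commutative endoD.
Proof. by move=> f g; apply/endoP=> v; apply: addrC. Qed.
Fact endo0D : left_id endo0 endoD.
Proof. by move=> f; apply/endoP=> v; apply: add0r. Qed.
Fact endoNr : left_inverse endo0 endoN endoD.
Proof. by move=> f; apply/endoP=> v; apply: addNr. Qed.
HB.instance Definition _ :=
  GRing.isZmodule.Build endo_map endoDA endoDC endo0D endoNr.

Fact endoZA a b f : endoZ a (endoZ b f) = endoZ (a * b) f.
Proof. by apply/endoP=> v; apply: scalerA. Qed.
Fact endo1Z : left_id 1 endoZ.
Proof. by move=> f; apply/endoP=> v; apply: scale1r. Qed.
Fact endoZDr : right_distributive endoZ +%R.
Proof. by move=> a f g; apply/endoP=> v; apply: scalerDr. Qed.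
Fact endoZDl f : {morph endoZ^~ f : a b / a + b}.
Proof. by move=> a b; apply/endoP=> v; apply: scalerDl. Qed.
HB.instance Definition _ :=
  GRing.Zmodule_isLmodule.Build F endo_map endoZA endo1Z endoZDr endoZDl.

Variables (v0 : V) (v0_neq0 : v0 != 0).

(* A nonzero vector makes the ring nontrivial, as [algType] requires. *)
Definition endo of v0 != 0 := endo_map.
Notation End := (endo v0_neq0).
HB.instance Definition _ := GRing.Lmodule.on End.

Fact endoMA : associative (endoM : End -> End -> End).
Proof. by move=> f g h; apply/endoP. Qed.
Fact endo1M : left_id (endo1 : End) endoM.
Proof. by move=> f; apply/endoP. Qed.
Fact endoM1 : right_id (endo1 : End) endoM.
Proof. by move=> f; apply/endoP. Qed.
Fact endoMDl : left_distributive (endoM : End -> End -> End) +%R.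
Proof. by move=> f g h; apply/endoP. Qed.
Fact endoMDr : right_distributive (endoM : End -> End -> End) +%R.
Proof. by move=> f g h; apply/endoP=> v; apply: linearD. Qed.
Fact endo1_neq0 : (endo1 : End) != 0.
Proof. by apply: contra_neq v0_neq0 => /endoP/(_ v0). Qed.
HB.instance Definition _ := GRing.Zmodule_isNzRing.Build End
  endoMA endo1M endoM1 endoMDl endoMDr endo1_neq0.

Fact endoZAl a (f g : End) : a *: (f * g) = (a *: f) * g.
Proof. by apply/endoP. Qed.
HB.instance Definition _ := GRing.Lmodule_isLalgebra.Build F End endoZAl.
Fact endoZAr a (f g : End) : a *: (f * g) = f * (a *: g).
Proof. by apply/endoP=> v; apply: esym (endo_mapZ f a (g v)). Qed.
HB.instance Definition _ := GRing.Lalgebra_isAlgebra.Build F End endoZAr.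

Lemma endo_mulE (f g : End) v : (f * g) v = f (g v). Proof. by []. Qed.
Lemma endo_addE (f g : End) v : (f + g) v = f v + g v. Proof. by []. Qed.
Lemma endo_oppE (f : End) v : (- f) v = - f v. Proof. by []. Qed.
Lemma endo_scaleE a (f : End) v : (a *: f) v = a *: f v. Proof. by []. Qed.
Lemma endo_oneE v : (1 : End) v = v. Proof. by []. Qed.
Lemma endo_zeroE v : (0 : End) v = 0. Proof. by []. Qed.
Definition endoE :=
  (endo_mulE, endo_addE, endo_oppE, endo_scaleE, endo_oneE, endo_zeroE).
End Endomorphisms.

(** * Presentations of R_k indexed by natural numbers *)

Section Presentation.
Variables (F : fieldType) (hbar : F) (S : algType F).
Implicit Types (T X : nat -> S).

Record hecke_rels (k : nat) T : Prop := HeckeRels {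
  rels_quad : forall i, (i.+1 < k)%N -> T i * T i = 1 + hbar *: T i;
  rels_braid : forall i, (i.+2 < k)%N ->
    T i * T i.+1 * T i = T i.+1 * T i * T i.+1;
  rels_far : forall i j, (i.+1 < j)%N -> (j.+1 < k)%N -> T i * T j = T j * T i
}.

Record xi_rels (k : nat) T X : Prop := XiRels {
  rels_sq : forall j, (j < k)%N -> X j * X j = 0;
  rels_anti : forall i j, (i < j < k)%N -> X i * X j = - (X j * X i);
  rels_lo : forall i, (i.+1 < k)%N -> X i * T i = T i * X i.+1;
  rels_hi : forall i, (i.+1 < k)%N ->
    X i.+1 * T i = T i * X i - hbar *: (X i - X i.+1);
  rels_xiT : forall i j, (i.+1 < k)%N -> (j < k)%N -> j != i -> j != i.+1 ->
    X j * T i = T i * X j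
}.

Definition gen_eval k T X (g : dgh_gen k) : S :=
  match g with inl i => T i | inr j => X j end.

Lemma gen_eval_rel k T X : hecke_rels k T -> xi_rels k T X ->
  forall l r, dgh_rel (k := k) hbar l r ->
  free_eval (gen_eval T X) l = free_eval (gen_eval T X) r.
Proof.
case=> quad braid far [sq anti lo hi xiT].
have lt (i : 'I_k.-1) : (i.+1 < k)%N by exact: ltn_ord_predS.
move=> l r [{l r} i|i i' e|i i' /orP[] h|j|j j' ne|i|i|i j h1 h2];
  rewrite !free_evalE /=.
- exact: quad (lt i).
- by rewrite e; apply: braid; have := lt i'; rewrite e.
- exact: far h (lt i').
- exact: esym (far _ _ h (lt i)).
- exact: sq.
- case: (ltngtP j j') => h; first by apply: anti; rewrite h ltn_ord.
  + by rewrite [in RHS]anti ?opprK // h ltn_ord.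
  + by case/eqP: ne; apply: val_inj.
- exact: lo (lt i).
- exact: hi (lt i).
- exact: xiT (lt i) (ltn_ord j) h1 h2.
Qed.

Definition Tinv T i := T i - hbar%:A.

Fixpoint xi_tower T (x : S) (j : nat) : S :=
  if j is i.+1 then Tinv T i * xi_tower T x i * T i else x.

Section Tower.
Variables (k : nat) (T : nat -> S).
Hypothesis hT : hecke_rels k T.

Lemma T_TinvK i : (i.+1 < k)%N -> T i * Tinv T i = 1.
Proof. by move=> h; rewrite mulrBr (rels_quad hT) // mulr_algr addrK. Qed.
Lemma Tinv_TK i : (i.+1 < k)%N -> Tinv T i * T i = 1.
Proof. by move=> h; rewrite mulrBl (rels_quad hT) // mulr_algl addrK. Qed.

Lemma Tinv_mulE i x y z :
  Tinv T i * x * y * z = - hbar *: (x * (y * z)) + T i * (x * (y * z)).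
Proof.
by rewrite -!mulrA mulrBl mulr_algl scaleNr addrC.
Qed.

Lemma comm_Tinv i y : T i * y = y * T i -> Tinv T i * y = y * Tinv T i.
Proof. by move=> h; rewrite mulrBl mulrBr h mulr_algl mulr_algr. Qed.

(** The three conditions on the first xi. The last one is the anticommutation of [x] with T_0^-1 x
    T_0, multiplied by T_0 on the left and simplified with x^2 = 0. *)
Variable x : S.
Hypotheses (x_sq : x * x = 0)
  (xT : forall i, (0 < i)%N -> (i.+1 < k)%N -> x * T i = T i * x)
  (xT0 : (1 < k)%N -> T 0 * x * T 0 * x * T 0 = - (x * T 0 * x)).
Local Notation X := (xi_tower T x).

Lemma xi_tower_below i j : (j < i)%N -> (i.+1 < k)%N -> X j * T i = T i * X j.
Proof.
elim: j => [|j IH] ji ik /=; first exact: xT.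
have jT : T j * T i = T i * T j by apply: (rels_far hT); lia.
have jI : Tinv T j * T i = T i * Tinv T j by exact: comm_Tinv.
by rewrite -mulrA jT mulrA -[_ * X j * T i]mulrA IH // 1?ltnW // mulrA jI !mulrA.
Qed.

Lemma braid_Tinv i : (i.+2 < k)%N ->
  Tinv T i.+1 * Tinv T i * T i.+1 = T i * Tinv T i.+1 * Tinv T i.
Proof.
move=> ik; have ik' := ltnW ik.
have inv : Tinv T i.+1 * Tinv T i * (T i * T i.+1) = 1.
  by rewrite mulrA -(mulrA _ (Tinv T i)) Tinv_TK // mulr1 Tinv_TK.
rewrite -[RHS]mul1r -inv -!mulrA; congr (_ * (_ * _)).
rewrite (mulrA (T i.+1)) (mulrA (T i)) (mulrA (T i) (T i.+1)) (rels_braid hT) //.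
by rewrite -!mulrA (mulrA _ (Tinv T i.+1)) T_TinvK // mul1r T_TinvK // mulr1.
Qed.

(** The case j = i + 2 carries the content: X_j is X_i conjugated by T_i T_(i+1). The braid relation
    turns a T_i on the right into T_(i+1), which passes X_i and becomes T_i again on the left. *)
Lemma xi_tower_above i j : (i.+1 < j)%N -> (j < k)%N -> X j * T i = T i * X j.
Proof.
elim: j => [//|j IH] ij jk /=.
have [ji|ji] := eqVneq j i.+1.
  rewrite {}ji in jk IH ij *; rewrite /= !mulrA -[_ * T i * T i.+1]mulrA.
  rewrite -[_ * (T i * T i.+1) * T i]mulrA (rels_braid hT) // !mulrA.
  have h : X i * T i.+1 = T i.+1 * X i by exact: xi_tower_below.
  by rewrite -(mulrA _ (X i)) h !mulrA braid_Tinv.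
have jT : T j * T i = T i * T j by apply/esym/(rels_far hT) => //; lia.
have jI : Tinv T j * T i = T i * Tinv T j by exact: comm_Tinv.
have jX : X j * T i = T i * X j by apply: IH; lia.
by rewrite -mulrA jT mulrA -[_ * X j * T i]mulrA jX mulrA jI !mulrA.
Qed.

Lemma xi_tower_sq j : (j < k)%N -> X j * X j = 0.
Proof.
elim: j => [//|j IH] jk /=; rewrite !mulrA -[_ * T j * Tinv T j]mulrA T_TinvK //.
by rewrite mulr1 -(mulrA _ (X j) (X j)) IH 1?ltnW // mulr0 mul0r.
Qed.

Lemma conj_anti i y z : (i.+1 < k)%N -> y * T i = T i * y ->
  y * z = - (z * y) ->
  y * (Tinv T i * z * T i) = - (Tinv T i * z * T i * y).
Proof.
move=> ik yT yz; have yI : Tinv T i * y = y * Tinv T i by exact: comm_Tinv.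
by rewrite !mulrA -yI -(mulrA _ y z) yz mulrN mulNr -!mulrA yT.
Qed.

Lemma xi_tower_anti i j : (i < j < k)%N -> X i * X j = - (X j * X i).
Proof.
case/andP; elim: i j => [|i IH] [//|j] ij jk; last first.
  have h : X i * X j.+1 = - (X j.+1 * X i) by apply: IH => //; exact: ltnW.
  apply/esym/(canLR (@opprK _)); apply: conj_anti.
  - by move: ij jk; lia.
  - exact: xi_tower_above.
  - by rewrite h opprK.
elim: j {ij} jk => [|j IH] jk; last first.
  apply: conj_anti => //; first exact: xT.
  by apply: IH; exact: ltnW.
have inj : injective ( *%R (T 0)).
  by move=> y z yz; rewrite -[y]mul1r -[z]mul1r -(Tinv_TK jk) -!mulrA yz.
apply: inj; rewrite /= mulrN !mulrA T_TinvK // mul1r /Tinv mulrBr mulr_algr.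
by rewrite !mulrBl -scalerAl -(mulrA _ x x) x_sq mulr0 scaler0 mul0r subr0 xT0.
Qed.

Lemma xi_tower_rels : xi_rels k T X.
Proof.
split=> [||i ik|i ik|i j ik jk ji ji'].
- exact: xi_tower_sq.
- exact: xi_tower_anti.
- by rewrite /= !mulrA T_TinvK // mul1r.
- rewrite /= -[LHS]mulrA (rels_quad hT) // mulrDr mulr1 -scalerAr scalerBr.
  by rewrite opprB addrA mulrBl mulr_algl [RHS]addrAC addrC.
- case: (ltngtP j i) => h; first exact: xi_tower_below.
    by apply: xi_tower_above => //; rewrite ltn_neqAle eq_sym ji'.
  by rewrite h eqxx in ji.
Qed.
End Tower.
End Presentation.

(** * The generators of R_k, indexed from 0 by natural numbers *)

HB.lock Definition tt (F : fieldType) (hbar : F) (k i : nat) : dgh k hbar :=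
  dghTn k hbar i.+1.
HB.lock Definition xx (F : fieldType) (hbar : F) (k j : nat) : dgh k hbar :=
  dghXn k hbar j.+1.

Section Relations.
Variables (F : fieldType) (hbar : F) (k : nat).
Local Notation R := (dgh k hbar).
Local Notation tt := (tt hbar k).
Local Notation xx := (xx hbar k).

Lemma tt_ord (i : 'I_k.-1) : tt i = dghT hbar i.
Proof. by rewrite tt.unlock /= valK. Qed.
Lemma xx_ord (j : 'I_k) : xx j = dghX hbar j.
Proof. by rewrite xx.unlock /= valK. Qed.

Lemma ord_pred_ex i : (i.+1 < k)%N -> exists j : 'I_k.-1, i = j.
Proof.
move=> ik; have ik' : (i < k.-1)%N by rewrite -ltnS (ltn_predK ik).
by exists (Ordinal ik').
Qed.
Lemma ord_ex j : (j < k)%N -> exists i : 'I_k, j = i.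
Proof. by move=> jk; exists (Ordinal jk). Qed.

Lemma tt_rels : hecke_rels hbar k tt.
Proof.
split=> [i ik|i ik|i j ij jk].
- by have [o ->] := ord_pred_ex ik; rewrite tt_ord dghT_quad.
- have [o e] := ord_pred_ex ik; have [o' e'] := ord_pred_ex (ltnW ik).
  by rewrite e e' !tt_ord; apply: dghT_braid; rewrite -e -e'.
- have ik : (i.+1 < k)%N by lia.
  have [o e] := ord_pred_ex ik; have [o' e'] := ord_pred_ex jk.
  by rewrite e e' !tt_ord; apply: dghT_far; rewrite -e -e' ij.
Qed.

Lemma xx_rels : xi_rels hbar k tt xx.
Proof.
split=> [j jk|i j /andP[ij jk]|i ik|i ik|i j ik jk n1 n2].
- by have [o ->] := ord_ex jk; rewrite xx_ord dghX_sq.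
- have [o ->] := ord_ex jk; have [o' ->] := ord_ex (ltn_trans ij jk).
  by rewrite !xx_ord dghX_anti.
- have [o e] := ord_pred_ex ik; have := dghXT_lo hbar o.
  by rewrite -!xx_ord -tt_ord /= -e.
- have [o e] := ord_pred_ex ik; have := dghXT_hi hbar o.
  by rewrite -!xx_ord -tt_ord /= -e.
- have [o e] := ord_pred_ex ik; have [o' e'] := ord_ex jk.
  rewrite e e' xx_ord tt_ord; apply: dghXT_far; rewrite -val_eqE /= -e -e' //.
Qed.

Lemma xx_tower j : (j.+1 < k)%N -> xx j.+1 = Tinv hbar tt j * xx j * tt j.
Proof.
move=> h; rewrite -mulrA (rels_lo xx_rels) // mulrA.
by rewrite (Tinv_TK tt_rels) // mul1r.
Qed.
End Relations.

(** * R_(n+1) acts on a free right module over R_n and one more xi *)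

Section Model.
Variables (F : fieldType) (hbar : F) (n : nat).
Local Notation R := (dgh n hbar).
Local Notation T := (tt hbar n).
Local Notation x := (xx hbar n 0).

(* A pair [(y, y')] stands for y + xi y', where xi anticommutes with the
   xi_j of R_n and commutes with its T_i. *)
Definition ext_pair : Type := (R * R)%type.
HB.instance Definition _ := GRing.Lmodule.on ext_pair.
Local Notation B := ext_pair.
Implicit Types (p : B) (g : nat -> B).

Definition pairT i p : B := (T i * p.1, T i * p.2).
Definition pairx p : B := (x * p.1, - (x * p.2)).
Definition pairxi p : B := (0, p.1).

Lemma pairP p q : p.1 = q.1 -> p.2 = q.2 -> p = q.
Proof. by case: p q => a b [c d] /= -> ->. Qed.

Lemma pairT_linear i : linear (pairT i).
Proof. by move=> a p q; apply: pairP; rewrite /= mulrDr scalerAr. Qed.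
HB.instance Definition _ i :=
  GRing.isLinear.Build F B B *:%R (pairT i) (pairT_linear i).
Lemma pairx_linear : linear pairx.
Proof.
by move=> a p q; apply: pairP; rewrite /= mulrDr ?opprD -?scalerAr ?scalerN.
Qed.
HB.instance Definition _ := GRing.isLinear.Build F B B *:%R pairx pairx_linear.
Lemma pairxi_linear : linear pairxi.
Proof. by move=> a p q; apply: pairP; rewrite /= ?scaler0 ?addr0. Qed.
HB.instance Definition _ := GRing.isLinear.Build F B B *:%R pairxi pairxi_linear.

Lemma pairTD i p q : pairT i (p + q) = pairT i p + pairT i q.
Proof. exact: linearD. Qed.
Lemma pairTZ i a p : pairT i (a *: p) = a *: pairT i p.
Proof. exact: linearZ. Qed.
Definition pairT_lin := (pairTD, pairTZ).

Lemma pairxD p q : pairx (p + q) = pairx p + pairx q.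
Proof. exact: linearD. Qed.
Lemma pairxZ a p : pairx (a *: p) = a *: pairx p.
Proof. exact: linearZ. Qed.
Lemma pairxiD p q : pairxi (p + q) = pairxi p + pairxi q.
Proof. exact: linearD. Qed.
Lemma pairxiZ a p : pairxi (a *: p) = a *: pairxi p.
Proof. exact: linearZ. Qed.
Definition pairx_lin := (pairxD, pairxZ, pairxiD, pairxiZ).

Lemma pairT_quad i p : (i.+1 < n)%N ->
  pairT i (pairT i p) = p + hbar *: pairT i p.
Proof.
move=> h; have q := rels_quad (tt_rels hbar n) h.
by apply: pairP; rewrite /= mulrA q mulrDl mul1r scalerAl.
Qed.
Lemma pairT_braid i p : (i.+2 < n)%N ->
  pairT i (pairT i.+1 (pairT i p)) = pairT i.+1 (pairT i (pairT i.+1 p)).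
Proof.
move=> h; have q := rels_braid (tt_rels hbar n) h.
by apply: pairP; rewrite /= !mulrA q.
Qed.
Lemma pairT_far i j p : (i.+1 < j)%N -> (j.+1 < n)%N ->
  pairT i (pairT j p) = pairT j (pairT i p).
Proof.
move=> h h'; have q := rels_far (tt_rels hbar n) h h'.
by apply: pairP; rewrite /= !mulrA q.
Qed.
Lemma pairx_sq p : (0 < n)%N -> pairx (pairx p) = 0.
Proof.
move=> h; have q := rels_sq (xx_rels hbar n) h.
by apply: pairP; rewrite /= ?mulrN ?opprK !mulrA q mul0r.
Qed.
Lemma pairxT i p : (0 < i)%N -> (i.+1 < n)%N ->
  pairx (pairT i p) = pairT i (pairx p).
Proof.
move=> i0 h.
have q : x * T i = T i * x by apply: (rels_xiT (xx_rels hbar n)) => //; lia.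
by apply: pairP; rewrite /= ?mulrN !mulrA q.
Qed.
Lemma xT0_rel : (1 < n)%N -> T 0 * x * T 0 * x * T 0 = - (x * T 0 * x).
Proof.
move=> h; have lo := rels_lo (xx_rels hbar n) h.
have x1 := rels_sq (xx_rels hbar n) h.
have h' : (0 < 1 < n)%N by [].
rewrite -!mulrA lo (mulrA (T 0) (T 0)) (rels_quad (tt_rels hbar n)) //.
rewrite mulrDl mul1r !mulrDr -scalerAl -!scalerAr (mulrA x (T 0) (xx hbar n 1)) lo.
rewrite -(mulrA (T 0)) x1 !mulr0 scaler0 addr0.
by rewrite (rels_anti (xx_rels hbar n) h') mulrN (mulrA (T 0)) -lo mulrA.
Qed.
Lemma pairxT0 p : (1 < n)%N ->
  pairT 0 (pairx (pairT 0 (pairx (pairT 0 p)))) = - pairx (pairT 0 (pairx p)).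
Proof.
move=> h; have q := xT0_rel h.
by apply: pairP; rewrite /= ?mulrN ?opprK !mulrA q ?mulNr ?opprK.
Qed.
Lemma pairxi_sq p : pairxi (pairxi p) = 0. Proof. by []. Qed.
Lemma pairxiT i p : pairxi (pairT i p) = pairT i (pairxi p).
Proof. by apply: pairP; rewrite /= ?mulr0. Qed.
Lemma pairxix p : pairxi (pairx p) = - pairx (pairxi p).
Proof. by apply: pairP; rewrite /= ?mulr0 ?oppr0 ?opprK. Qed.

(* Coordinates with respect to b_j = T_j ... T_(n-1), for j <= n. *)
Definition opT i g j : B :=
  if j == i.+1 then g i else if j == i then g i.+1 + hbar *: g i
  else if (i < j)%N then pairT i (g j) else pairT i.-1 (g j).
(** The two operators encode T_i b_(i+1) = b_i, T_i b_i = b_(i+1) + hbar b_i, T_i b_j = b_j T_i for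
    j > i + 1, T_i b_j = b_j T_(i-1) for j < i, and xi_0 b_0 = b_0 xi_n, xi_0 b_j = b_j xi_0 for j >
    0. *)
Definition opx g j : B := if j == 0 then pairxi (g 0%N) else pairx (g j).

Lemma opT_hi i g : opT i g i.+1 = g i. Proof. by rewrite /opT eqxx. Qed.
Lemma opT_lo i g : opT i g i = g i.+1 + hbar *: g i.
Proof. by rewrite /opT -[i == _]/(i == 1 + i)%N (ltn_eqF (ltnSn i)) eqxx. Qed.
Lemma opT_gt i g j : (i.+1 < j)%N -> opT i g j = pairT i (g j).
Proof.
by move=> h; rewrite /opT (gtn_eqF h) (gtn_eqF (ltnW h)) (ltnW h).
Qed.
Lemma opT_lt i g j : (j < i)%N -> opT i g j = pairT i.-1 (g j).
Proof.
by move=> h; rewrite /opT (ltn_eqF (leqW h)) (ltn_eqF h) ltnNge (ltnW h).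
Qed.
Definition opTE := (opT_hi, opT_lo).
Lemma opx0 g : opx g 0 = pairxi (g 0%N). Proof. by []. Qed.
Lemma opxS g j : (0 < j)%N -> opx g j = pairx (g j). Proof. by case: j. Qed.

Lemma opT_quad i g j : (i < n)%N -> (j <= n)%N ->
  opT i (opT i g) j = g j + hbar *: opT i g j.
Proof.
move=> i_n jn; case: (ltngtP j i) => [h|h|->]; last by rewrite !opTE.
  by rewrite !opT_lt // pairT_quad //; lia.
move: h; rewrite leq_eqVlt => /predU1P[<-|h]; first by rewrite !opTE.
by rewrite !opT_gt // pairT_quad //; lia.
Qed.

Lemma opT_braid i g j : (i.+1 < n)%N -> (j <= n)%N ->
  opT i (opT i.+1 (opT i g)) j = opT i.+1 (opT i (opT i.+1 g)) j.
Proof.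
move=> i_n jn; case: (ltngtP j i) => [h|h|->].
- by rewrite !opT_lt //; [case: i i_n h => // i i_n h; rewrite pairT_braid|lia..].
- move: h; rewrite leq_eqVlt => /predU1P[<-|h].
    rewrite !opTE !(@opT_lt i.+1 _ i) // (@opT_gt i _ i.+2) // !opTE.
    by rewrite linearD linearZ.
  move: h; rewrite leq_eqVlt => /predU1P[<-|h].
    by rewrite !opT_hi !(@opT_gt i _ i.+2) // !(@opT_lt i.+1 _ i) // !opT_hi.
  by rewrite !opT_gt // ?pairT_braid //; lia.
- rewrite !opTE !(@opT_lt i.+1 _ i) //= (@opT_gt i _ i.+2) // !opTE.
  rewrite (@opT_lt i.+1 _ i) //= !pairT_lin pairT_quad // !scalerDr -!addrA; congr (_ + _).
  by rewrite addrCA.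
Qed.

Lemma opT_far i i' g j : (i.+1 < i')%N -> (i' < n)%N -> (j <= n)%N ->
  opT i (opT i' g) j = opT i' (opT i g) j.
Proof.
move=> ii' i'n jn; have lt_ii' := ltnW ii'.
case: (ltngtP j i) => [h|h|->].
- have h' := ltn_trans h lt_ii'.
  by rewrite !(opT_lt _ h, opT_lt _ h'); apply: pairT_far; lia.
- move: h; rewrite leq_eqVlt => /predU1P[<-|h].
    by rewrite opT_hi (opT_lt _ lt_ii') (opT_lt _ ii') opT_hi.
  case: (ltngtP j i') => [h'|h'|->].
  + by rewrite !(opT_gt _ h, opT_lt _ h'); apply: pairT_far; lia.
  + move: h'; rewrite leq_eqVlt => /predU1P[<-|h'].
      by rewrite opT_hi (opT_gt _ (leqW ii')) (opT_gt _ ii') opT_hi.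
    by rewrite !(opT_gt _ h, opT_gt _ h'); apply: pairT_far => //; lia.
  + rewrite opT_lo !(opT_gt _ ii') (opT_gt _ (leqW ii')) opT_lo.
    by rewrite pairT_lin pairTZ.
- rewrite opT_lo (opT_lt _ lt_ii') (opT_lt _ ii') (opT_lt _ lt_ii') opT_lo.
  by rewrite pairT_lin pairTZ.
Qed.

Lemma opx_sq g j : (j <= n)%N -> opx (opx g) j = 0.
Proof.
case: j => [|j] jn; first by rewrite !opx0.
by rewrite !opxS // pairx_sq //; lia.
Qed.

Lemma opxT i g j : (0 < i < n)%N -> (j <= n)%N ->
  opx (opT i g) j = opT i (opx g) j.
Proof.
case/andP=> i0 i_n jn; case: (ltngtP j i) => [h|h|->].
- rewrite opT_lt //; case: j jn h => [|j] jn h; rewrite ?opx0 ?opxS // opT_lt //.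
    exact: pairxiT.
  by apply: pairxT; lia.
- rewrite opxS; last exact: leq_trans h.
  move: h; rewrite leq_eqVlt => /predU1P[<-|h]; first by rewrite !opT_hi opxS.
  by rewrite !opT_gt // pairxT ?opxS //; lia.
- by rewrite opxS // !opT_lo !opxS // !pairx_lin.
Qed.

Lemma opxT0 g j : (0 < n)%N -> (j <= n)%N ->
  opT 0 (opx (opT 0 (opx (opT 0 g)))) j = - opx (opT 0 (opx g)) j.
Proof.
move=> n0 jn; case: j jn => [|[|j]] jn; last first.
- have h : (1 < j.+2)%N by []. have h0 : (0 < j.+2)%N by [].
  by rewrite !(opT_gt _ h, opxS _ h0); apply: pairxT0; lia.
- have h1 : (0 < 1)%N by [].
  rewrite (opT_hi 0) opx0 opT_lo !(opxS _ h1) !(opT_hi 0) !opx0 !pairx_lin.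
  by rewrite !pairxi_sq ?scaler0 !addr0 ?scaler0 ?addr0 pairxix.
- have h1 : (0 < 1)%N by [].
  rewrite !(opT_lo, opT_hi 0, opx0, opxS _ h1).
  rewrite !pairx_lin !pairxi_sq !pairxix !scaler0 !addr0 opprK.
  by rewrite scaler0 addr0 scalerN addrK.
Qed.

Definition model : Type := {ffun 'I_n.+1 -> B}.
HB.instance Definition _ := GRing.Lmodule.on model.
Definition mcoord (v : model) j : B := v (inord j).
Definition mkmodel g : model := [ffun j : 'I_n.+1 => g j].

Lemma mkmodelE g j : (j <= n)%N -> mcoord (mkmodel g) j = g j.
Proof. by move=> jn; rewrite /mcoord ffunE inordK. Qed.
Lemma mcoordP (v w : model) :
  (forall j, (j <= n)%N -> mcoord v j = mcoord w j) -> v = w.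
Proof.
move=> h; apply/ffunP=> j; have := h j (leq_ord j).
by rewrite /mcoord inord_val.
Qed.
Lemma mcoordD v w j : mcoord (v + w) j = mcoord v j + mcoord w j.
Proof. by rewrite /mcoord ffunE. Qed.
Lemma mcoordN v j : mcoord (- v) j = - mcoord v j.
Proof. by rewrite /mcoord ffunE. Qed.
Lemma mcoordZ a v j : mcoord (a *: v) j = a *: mcoord v j.
Proof. by rewrite /mcoord ffunE. Qed.
Lemma mcoord0 j : mcoord 0 j = 0.
Proof. by rewrite /mcoord ffunE. Qed.

Definition mdelta j p : model := mkmodel (fun i => if i == j then p else 0).
(** The vector of 1 = b_n, from which coordinates of ring elements are read off. *)
Definition mvac : model := mdelta n ((1, 0) : B).

Lemma mvac_neq0 : mvac != 0.
Proof.
apply/eqP=> /(congr1 (fun v => (mcoord v n).1)).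
by rewrite mkmodelE // eqxx mcoord0 /=; apply/eqP/oner_neq0.
Qed.
Notation End := (endo mvac_neq0).

Lemma mT_linear i : linear (fun v => mkmodel (opT i (mcoord v))).
Proof.
move=> a v w; apply: mcoordP => j jn.
rewrite mcoordD mcoordZ !mkmodelE // /opT !(mcoordD, mcoordZ).
case: ifP => _ //; case: ifP => _; last by case: ifP => _; rewrite linearP.
by rewrite !scalerDr !scalerA mulrC addrACA.
Qed.
Definition mT i : End := EndoMap (mT_linear i).
Lemma mX0_linear : linear (fun v => mkmodel (opx (mcoord v))).
Proof.
move=> a v w; apply: mcoordP => j jn.
rewrite mcoordD mcoordZ !mkmodelE // /opx !(mcoordD, mcoordZ).
by case: ifP => _; rewrite linearP.
Qed.
Definition mX0 : End := EndoMap mX0_linear.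

Lemma mTE i v j : (j <= n)%N -> mcoord (mT i v) j = opT i (mcoord v) j.
Proof. exact: mkmodelE. Qed.
Lemma mX0E v j : (j <= n)%N -> mcoord (mX0 v) j = opx (mcoord v) j.
Proof. exact: mkmodelE. Qed.

(** Lets operators be composed on coordinate formulas. Beyond [n] the values of [mcoord] have no
    meaning; [opT i] with i < n never looks there. *)
Definition coords v g := forall j, (j <= n)%N -> mcoord v j = g j.

Lemma coords_refl v : coords v (mcoord v). Proof. by []. Qed.
Lemma coords_T i v g : (i < n)%N -> coords v g -> coords (mT i v) (opT i g).
Proof.
by move=> i_n h j jn; rewrite mTE // /opT !h // ltnW.
Qed.
Lemma coords_x v g : coords v g -> coords (mX0 v) (opx g).
Proof. by move=> h j jn; rewrite mX0E // /opx !h. Qed.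

Lemma mT_rels : hecke_rels hbar n.+1 mT.
Proof.
split=> [i i_n|i i_n|i j ij jn]; apply/endoP=> v; apply: mcoordP => l ln;
  have cv := coords_refl v; rewrite !endoE ?mcoordD ?mcoordZ.
- have {}i_n : (i < n)%N by [].
  have h1 := coords_T i_n cv; have h2 := coords_T i_n h1.
  by rewrite (h2 l ln) (h1 l ln) opT_quad.
- have {}i_n : (i.+1 < n)%N by []. have i_n' := ltnW i_n.
  have h1 := coords_T i_n (coords_T i_n' cv); have h2 := coords_T i_n' h1.
  have h3 := coords_T i_n' (coords_T i_n cv); have h4 := coords_T i_n h3.
  exact: etrans (h2 l ln) (etrans (opT_braid _ i_n ln) (esym (h4 l ln))).
- have {}jn : (j < n)%N by []. have i_n : (i < n)%N by lia.
  have h1 := coords_T i_n (coords_T jn cv).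
  have h2 := coords_T jn (coords_T i_n cv).
  by rewrite (h1 l ln) (h2 l ln) opT_far.
Qed.

Lemma mX0_sq : mX0 * mX0 = 0.
Proof.
apply/endoP=> v; apply: mcoordP => l ln; have cv := coords_refl v.
by rewrite !endoE (coords_x (coords_x cv)) // opx_sq // mcoord0.
Qed.
Lemma mX0T i : (0 < i)%N -> (i.+1 < n.+1)%N -> mX0 * mT i = mT i * mX0.
Proof.
move=> i0 i_n'; have i_n : (i < n)%N := i_n'; apply/endoP=> v; apply: mcoordP => l ln; have cv := coords_refl v.
have h1 := coords_x (coords_T i_n cv); have h2 := coords_T i_n (coords_x cv).
by rewrite !endoE (h1 l ln) (h2 l ln) opxT ?i0.
Qed.
Lemma mX0T0 : (1 < n.+1)%N -> mT 0 * mX0 * mT 0 * mX0 * mT 0 = - (mX0 * mT 0 * mX0).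
Proof.
move=> n0'; have n0 : (0 < n)%N := n0'; apply/endoP=> v; apply: mcoordP => l ln; have cv := coords_refl v.
have h1 := coords_T n0 (coords_x (coords_T n0 (coords_x (coords_T n0 cv)))).
have h2 := coords_x (coords_T n0 (coords_x cv)).
by rewrite !endoE mcoordN (h1 l ln) (h2 l ln) opxT0.
Qed.

Definition mX := xi_tower hbar mT mX0.
Lemma mX_rels : xi_rels hbar n.+1 mT mX.
Proof. apply: (xi_tower_rels mT_rels mX0_sq).
exact mX0T. exact mX0T0. Qed.
End Model.

(** * The universal property of R_k in terms of the indexed relations *)

Section GenEval.
Variables (F : fieldType) (hbar : F) (k : nat) (S : algType F).
Variables (T X : nat -> S).
Hypotheses (hT : hecke_rels hbar k T) (hX : xi_rels hbar k T X).

Definition rels_eval (y : dgh k hbar) : S := dgh_eval (gen_eval T X) y.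
Let hTX := gen_eval_rel hT hX.

Lemma rels_evalM y z : rels_eval (y * z) = rels_eval y * rels_eval z.
Proof. exact: (dgh_evalM hTX). Qed.
Lemma rels_eval1 : rels_eval 1 = 1.
Proof. exact: (dgh_eval1 hTX). Qed.
Lemma rels_eval_linear : linear rels_eval.
Proof. exact: (dgh_eval_linear hTX). Qed.
Lemma rels_eval_tt i : (i.+1 < k)%N -> rels_eval (tt hbar k i) = T i.
Proof.
by move=> /ord_pred_ex[o ->]; rewrite tt_ord; apply: (dgh_evalG hTX).
Qed.
Lemma rels_eval_xx j : (j < k)%N -> rels_eval (xx hbar k j) = X j.
Proof.
by move=> /ord_ex[o ->]; rewrite xx_ord; apply: (dgh_evalG hTX).
Qed.
End GenEval.

Lemma dgh_nat_ind (F : fieldType) (k : nat) (hbar : F) (P : dgh k hbar -> Prop) :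
    P 1 -> (forall i y, (i.+1 < k)%N -> P y -> P (tt hbar k i * y)) ->
    (forall j y, (j < k)%N -> P y -> P (xx hbar k j * y)) -> P 0 ->
    (forall y z, P y -> P z -> P (y + z)) -> (forall a y, P y -> P (a *: y)) ->
  forall y, P y.
Proof.
move=> P1 PT PX P0 PD PZ; apply: dgh_ind => // -[i|j] y Py.
  have := PT i y (ltn_ord_predS i) Py; by rewrite tt_ord.
by have := PX j y (ltn_ord j) Py; rewrite xx_ord.
Qed.

(** * The inclusion of R_n in R_(n+1) and the basis b_j *)

Section Inclusion.
Variables (F : fieldType) (hbar : F) (n : nat).
Local Notation R := (dgh n hbar).
Local Notation R' := (dgh n.+1 hbar).
Local Notation T := (tt hbar n.+1).
Local Notation X := (xx hbar n.+1).

Lemma hecke_rels_incl : hecke_rels hbar n T.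
Proof.
case: (tt_rels hbar n.+1) => quad braid far; split=> [i h|i h|i j h h'].
- by apply: quad; apply: leqW.
- by apply: braid; apply: leqW.
- by apply: far => //; apply: leqW.
Qed.
Lemma xi_rels_incl : xi_rels hbar n T X.
Proof.
case: (xx_rels hbar n.+1) => sq anti lo hi far.
split=> [j h|i j /andP[h h']|i h|i h|i j h h'].
- by apply: sq; apply: leqW.
- by apply: anti; rewrite h leqW.
- by apply: lo; apply: leqW.
- by apply: hi; apply: leqW.
- by apply: far; apply: leqW.
Qed.

Definition incl : R -> R' := rels_eval T X.

Lemma inclM y z : incl (y * z) = incl y * incl z.
Proof. exact: (rels_evalM hecke_rels_incl xi_rels_incl). Qed.
Lemma incl1 : incl 1 = 1.
Proof. exact: (rels_eval1 hecke_rels_incl xi_rels_incl). Qed.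
Lemma incl_linear : linear incl.
Proof. exact: (rels_eval_linear hecke_rels_incl xi_rels_incl). Qed.
HB.instance Definition _ := GRing.isLinear.Build F R R' *:%R incl incl_linear.
HB.instance Definition _ :=
  GRing.isMonoidMorphism.Build R R' incl (incl1, inclM).
Lemma incl_tt i : (i.+1 < n)%N -> incl (tt hbar n i) = T i.
Proof. exact: (rels_eval_tt hecke_rels_incl xi_rels_incl). Qed.
Lemma incl_xx j : (j < n)%N -> incl (xx hbar n j) = X j.
Proof. exact: (rels_eval_xx hecke_rels_incl xi_rels_incl). Qed.
Lemma inclD y z : incl (y + z) = incl y + incl z.
Proof. exact: linearD. Qed.
Lemma inclN y : incl (- y) = - incl y.
Proof. exact: linearN. Qed.
Lemma inclZ a y : incl (a *: y) = a *: incl y.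
Proof. exact: linearZ. Qed.
Lemma incl0 : incl 0 = 0.
Proof. exact: linear0. Qed.

Definition bb j : R' := \prod_(j <= i < n) T i.
Definition emb (p : ext_pair hbar n) : R' := incl p.1 + X n * incl p.2.

Lemma bbn : bb n = 1. Proof. by rewrite /bb big_geq. Qed.
Lemma bbE j : (j < n)%N -> bb j = T j * bb j.+1.
Proof. by move=> jn; rewrite /bb big_ltn. Qed.

Let rT := tt_rels hbar n.+1.
Let rX := xx_rels hbar n.+1.

(** Downward induction, adapted to b_n = 1 and b_j = T_j b_(j+1). *)
Lemma bb_ind (P : nat -> Prop) : P n ->
  (forall j, (j < n)%N -> P j.+1 -> P j) -> forall j, (j <= n)%N -> P j.
Proof.
move=> Pn PS j jn; rewrite -(subKn jn); elim: (n - j)%N (leq_subr j n) => [|m IH] h.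
  by rewrite subn0.
apply: PS; first by lia.
have -> : (n - m.+1).+1 = (n - m)%N by lia.
by apply: IH; apply: ltnW.
Qed.

Lemma T_bb_gt i j : (j <= n)%N -> (i.+1 < j)%N -> T i * bb j = bb j * T i.
Proof.
move: j; apply: bb_ind => [_|j jn IH ij]; first by rewrite bbn mulr1 mul1r.
have h : T i * T j = T j * T i by exact: (rels_far rT ij jn).
have h' : T i * bb j.+1 = bb j.+1 * T i by apply: IH; apply: leqW.
by rewrite bbE // mulrA h -mulrA h' mulrA.
Qed.

Lemma T_bbS i : (i < n)%N -> T i * bb i.+1 = bb i.
Proof. by move=> h; rewrite (bbE h). Qed.
Lemma T_bb i : (i < n)%N -> T i * bb i = bb i.+1 + hbar *: bb i.
Proof.
by move=> h; rewrite (bbE h) mulrA (rels_quad rT) // mulrDl mul1r scalerAl.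
Qed.

(** T_i moves right inside b_j until it meets T_(i-1) T_i; there the braid relation produces T_(i-1)
    T_i T_(i-1), and the last factor commutes with b_(i+1). *)
Lemma T_bb_lt i j : (i < n)%N -> (j < i)%N -> T i * bb j = bb j * T i.-1.
Proof.
move=> i_n ji; have jn : (j <= n)%N by lia.
move: j jn ji; apply: bb_ind => [|j jn IH ji]; first by lia.
move: ji; rewrite leq_eqVlt => /predU1P[ij|ji].
  rewrite -{}ij /= in i_n IH *; rewrite (bbE jn) (bbE i_n) !mulrA.
  rewrite -(rels_braid rT) // -!mulrA; congr (_ * (_ * _)).
  by apply: T_bb_gt.
have h : T i * T j = T j * T i by apply/esym/(rels_far rT).
by rewrite (bbE jn) mulrA h -mulrA IH // mulrA.
Qed.

Lemma X_bb j : (j <= n)%N -> X j * bb j = bb j * X n.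
Proof.
move: j; apply: bb_ind => [|j jn IH]; first by rewrite bbn mulr1 mul1r.
by rewrite bbE // mulrA (rels_lo rX) // -[LHS]mulrA IH mulrA.
Qed.
Lemma X_bb_gt i j : (i < j)%N -> (j <= n)%N -> X i * bb j = bb j * X i.
Proof.
move=> ij jn; move: j jn ij; apply: bb_ind => [_|j jn IH ij].
  by rewrite bbn mulr1 mul1r.
have h : X i * T j = T j * X i by apply: (rels_xiT rX); lia.
by rewrite bbE // mulrA h -mulrA IH ?mulrA // ltnW.
Qed.

Lemma emb_linear : linear emb.
Proof.
move=> a p q; rewrite /emb /= !(inclD, inclZ) mulrDr scalerDr -scalerAr.
by rewrite addrACA.
Qed.
HB.instance Definition _ :=
  GRing.isLinear.Build F (ext_pair hbar n) R' *:%R emb emb_linear.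
Lemma embD p q : emb (p + q) = emb p + emb q. Proof. exact: linearD. Qed.
Lemma embZ a p : emb (a *: p) = a *: emb p. Proof. exact: linearZ. Qed.

Lemma XnT i : (i.+1 < n)%N -> X n * T i = T i * X n.
Proof. by move=> h; apply: (rels_xiT rX); lia. Qed.
Lemma XnX i : (i < n)%N -> X n * X i = - (X i * X n).
Proof. by move=> h; rewrite [in RHS](rels_anti rX) ?opprK ?h ?leqnn. Qed.

Lemma emb_pairT i p : (i.+1 < n)%N -> emb (pairT i p) = T i * emb p.
Proof.
by move=> h; rewrite /emb !inclM incl_tt // mulrDr !mulrA XnT.
Qed.
Lemma emb_pairx p : (0 < n)%N -> emb (pairx p) = X 0 * emb p.
Proof.
move=> h; rewrite /emb inclN !inclM incl_xx // mulrDr !mulrN !mulrA XnX //.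
by rewrite mulNr opprK.
Qed.
Lemma emb_pairxi p : emb (pairxi p) = X n * emb p.
Proof. by rewrite /emb incl0 add0r mulrDr mulrA (rels_sq rX) // mul0r addr0. Qed.
Lemma emb_mul p y : emb (p.1 * y, p.2 * y) = emb p * incl y.
Proof. by rewrite /emb !inclM mulrDl mulrA. Qed.

Definition comb (g : nat -> ext_pair hbar n) : R' :=
  \sum_(0 <= j < n.+1) bb j * emb (g j).

Lemma eq_comb g g' : (forall j, (j <= n)%N -> g j = g' j) -> comb g = comb g'.
Proof. by move=> h; apply: eq_big_nat => j /andP[_ jn]; rewrite h. Qed.

Lemma comb_opT i g : (i < n)%N -> comb (opT i g) = T i * comb g.
Proof.
move=> i_n; rewrite /comb mulr_sumr.
have lt2 : (i.+2 <= n.+1)%N by [].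
have lt1 : (i.+1 <= n.+1)%N by exact: ltnW.
rewrite !(@big_cat_nat _ _ _ i.+2 0%N n.+1) //=.
rewrite !(@big_nat_recr _ _ _ i.+1) // !(@big_nat_recr _ _ _ i) //=.
congr (_ + _); last first.
  apply: eq_big_nat => j /andP[ij jn]; rewrite opT_gt // emb_pairT; last by lia.
  by rewrite !mulrA T_bb_gt.
rewrite -!addrA; congr (_ + _).
  apply: eq_big_nat => j /andP[_ ji]; rewrite opT_lt // emb_pairT; last by lia.
  by rewrite !mulrA T_bb_lt.
rewrite opT_hi opT_lo embD embZ mulrDr !mulrA T_bb // T_bbS // mulrDl.
by rewrite -scalerAl -scalerAr addrC -!addrA; congr (_ + _); rewrite addrC.
Qed.

Lemma comb_opx g : comb (opx g) = X 0 * comb g.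
Proof.
rewrite /comb mulr_sumr; apply: eq_big_nat => -[|j] /andP[_ jn].
  by rewrite opx0 emb_pairxi !mulrA X_bb.
by rewrite opxS // emb_pairx ?mulrA ?X_bb_gt //; lia.
Qed.


(** ** Coordinates *)

Notation End := (endo (mvac_neq0 hbar n)).
Local Notation mT := (@mT F hbar n).
Local Notation mX := (@mX F hbar n).

Definition act (z : R') : End := rels_eval mT mX z.
Definition bcoord (z : R') : nat -> ext_pair hbar n :=
  mcoord (act z (mvac hbar n)).

Let hT := @mT_rels F hbar n.
Let hX := @mX_rels F hbar n.

Lemma act_mul y z v : act (y * z) v = act y (act z v).
Proof. by rewrite /act (rels_evalM hT hX). Qed.
Lemma act1 v : act 1 v = v.
Proof. by rewrite /act (rels_eval1 hT hX). Qed.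
Lemma act_linear a y z v : act (a *: y + z) v = a *: act y v + act z v.
Proof. by rewrite /act (rels_eval_linear hT hX). Qed.
Lemma act_T i v : (i < n)%N -> act (T i) v = mT i v.
Proof. by move=> h; rewrite /act (rels_eval_tt hT hX). Qed.
Lemma act_X j v : (j <= n)%N -> act (X j) v = mX j v.
Proof. by move=> h; rewrite /act (rels_eval_xx hT hX). Qed.
Lemma act0 v : act 0 v = 0.
Proof.
by have := act_linear (-1) 0 0 v; rewrite scaler0 addr0 scaleN1r addNr.
Qed.
Lemma actD y z v : act (y + z) v = act y v + act z v.
Proof. by have := act_linear 1 y z v; rewrite !scale1r. Qed.
Lemma actZ a y v : act (a *: y) v = a *: act y v.
Proof. by have := act_linear a y 0 v; rewrite act0 !addr0. Qed.
Lemma actN y v : act (- y) v = - act y v.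
Proof. by rewrite -(scaleN1r y) actZ scaleN1r. Qed.

Definition mcomb (v : model hbar n) : R' := comb (mcoord v).

Lemma comb_linear a g g' :
  comb (fun j => a *: g j + g' j) = a *: comb g + comb g'.
Proof.
rewrite /comb scaler_sumr -big_split; apply: eq_bigr => j _ /=.
by rewrite embD embZ mulrDr scalerAr.
Qed.
Lemma mcomb_linear a v w : mcomb (a *: v + w) = a *: mcomb v + mcomb w.
Proof.
rewrite -comb_linear; apply: eq_comb => j _.
by rewrite mcoordD mcoordZ.
Qed.
Lemma mcomb_mT i v : (i < n)%N -> mcomb (mT i v) = T i * mcomb v.
Proof.
by move=> h; rewrite -comb_opT //; apply: eq_comb => j jn; rewrite mTE.
Qed.
Lemma mcomb_mX0 v : mcomb (mX0 hbar n v) = X 0 * mcomb v.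
Proof.
by rewrite -comb_opx //; apply: eq_comb => j jn; rewrite mX0E.
Qed.

Lemma Tinv_act j v : Tinv hbar mT j v = - hbar *: v + mT j v.
Proof. by rewrite /Tinv !endoE addrC scaleNr. Qed.

Lemma mcomb_mX j v : (j <= n)%N -> mcomb (mX j v) = X j * mcomb v.
Proof.
elim: j v => [|j IH] v jn; first exact: mcomb_mX0.
have jn' : (j <= n)%N by exact: ltnW.
have -> : mX j.+1 v = - hbar *: mX j (mT j v) + mT j (mX j (mT j v)).
  by rewrite -Tinv_act.
by rewrite mcomb_linear mcomb_mT // !IH // mcomb_mT // xx_tower // Tinv_mulE.
Qed.

(** Recombining coordinates is R_(n+1)-linear. Applied to [mvac], this shows that the b_j span. *)
Lemma mcomb_act z v : mcomb (act z v) = z * mcomb v.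
Proof.
elim/dgh_nat_ind: z => [|i z h IH|j z h IH||y z IH IH'|a y IH].
- by rewrite act1 mul1r.
- by rewrite act_mul act_T // mcomb_mT // IH mulrA.
- by rewrite act_mul act_X // mcomb_mX // IH mulrA.
- have := mcomb_linear (-1) v v.
  by rewrite act0 scaleN1r addNr => ->; rewrite mul0r scaleN1r addNr.
- by rewrite actD -[act y v]scale1r mcomb_linear scale1r IH IH' mulrDl.
- have := mcomb_linear (-1) v v; rewrite scaleN1r addNr scaleN1r addNr => h0.
  by rewrite actZ -[_ *: _]addr0 mcomb_linear h0 addr0 IH scalerAl.
Qed.

Lemma mcomb_mdelta j p : (j <= n)%N -> mcomb (mdelta j p) = bb j * emb p.
Proof.
move=> jn; rewrite /mcomb /comb (bigD1_seq j) ?mem_index_iota ?iota_uniq //=.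
rewrite mkmodelE // eqxx big_seq_cond big1 ?addr0 // => i.
rewrite mem_index_iota => /andP[/andP[_ i_n] ij].
by rewrite mkmodelE // (negPf ij) linear0 mulr0.
Qed.

Lemma comb_coord z : comb (bcoord z) = z.
Proof.
rewrite -[LHS]/(mcomb _) mcomb_act mcomb_mdelta // bbn mul1r /emb /=.
by rewrite incl1 incl0 mulr0 addr0 mulr1.
Qed.

Lemma coords_mdelta j (p : ext_pair hbar n) : coords (mdelta j p) (fun i => if i == j then p else 0).
Proof. by move=> i i_n; apply: mkmodelE. Qed.

Lemma mT_mdelta_gt i j p : (j <= n)%N -> (i.+1 < j)%N ->
  mT i (mdelta j p) = mdelta j (pairT i p).
Proof.
move=> jn ij; have i_n : (i < n)%N by lia.
apply: mcoordP => l ln; rewrite (coords_T i_n (coords_mdelta j p) ln).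
rewrite mkmodelE //; case: (ltngtP l i) => h; last first.
- rewrite h opT_lo /= (ltn_eqF ij) ltn_eqF ?scaler0 ?addr0 //; lia.
- move: h; rewrite leq_eqVlt => /predU1P[<-|h].
    by rewrite opT_hi /= !ltn_eqF //; lia.
  by rewrite opT_gt //=; case: eqP => // _; rewrite linear0.
- by rewrite opT_lt //= ltn_eqF ?linear0 //; lia.
Qed.

Lemma mT_mdeltaS i p : (i < n)%N -> mT i (mdelta i.+1 p) = mdelta i p.
Proof.
move=> i_n; apply: mcoordP => l ln.
rewrite (coords_T i_n (coords_mdelta i.+1 p) ln) mkmodelE //.
case: (ltngtP l i) => h; last first.
- by rewrite h opT_lo /= eqxx ltn_eqF // scaler0 addr0.
- move: h; rewrite leq_eqVlt => /predU1P[<-|h].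
    by rewrite opT_hi /= !ltn_eqF.
  by rewrite opT_gt //= !gtn_eqF ?linear0 //; lia.
- by rewrite opT_lt //= ltn_eqF ?linear0 // leqW.
Qed.

Lemma mdelta_linear j a (p q : ext_pair hbar n) :
  mdelta j (a *: p + q) = a *: mdelta j p + mdelta j q.
Proof.
apply: mcoordP => i i_n; rewrite mcoordD mcoordZ !mkmodelE //.
by case: ifP => // _; rewrite scaler0 addr0.
Qed.

Lemma mX_mdelta_lt i j (p : ext_pair hbar n) : (j <= n)%N -> (i < j)%N ->
  mX i (mdelta j p) = mdelta j ((xx hbar n i * p.1, - (xx hbar n i * p.2))).
Proof.
move=> jn; elim: i p => [|i IH] p ij.
  apply: mcoordP => l ln; rewrite (coords_x (coords_mdelta j p) ln) mkmodelE //.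
  case: l ln => [|l] ln; first by rewrite opx0 ltn_eqF // linear0.
  by rewrite opxS //=; case: eqP => // _; rewrite linear0.
have ij' := ltnW ij; rewrite -[LHS]/(Tinv hbar mT i (mX i (mT i (mdelta j p)))).
rewrite mT_mdelta_gt // IH // Tinv_act mT_mdelta_gt // -mdelta_linear.
congr mdelta; apply: pairP; rewrite /= xx_tower ?(leq_trans ij jn) //.
  by rewrite Tinv_mulE.
by rewrite Tinv_mulE scalerN mulrN opprD.
Qed.

Lemma mX_mdelta j (p : ext_pair hbar n) : (j <= n)%N ->
  mX j (mdelta j p) = mdelta j (pairxi p).
Proof.
elim: j => [|j IH] jn.
  apply: mcoordP => l ln; rewrite (coords_x (coords_mdelta 0 p) ln) mkmodelE //.
  by case: l ln => [|l] ln; rewrite ?opx0 // opxS // linear0.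
rewrite -[LHS]/(Tinv hbar mT j (mX j (mT j (mdelta j.+1 p)))).
rewrite mT_mdeltaS // IH; last exact: ltnW.
rewrite -mT_mdeltaS //.
have := Tinv_TK hT jn => /endoP/(_ (mdelta j.+1 (pairxi p))).
by rewrite endo_mulE endo_oneE.
Qed.

Lemma act_bb j (p : ext_pair hbar n) : (j <= n)%N ->
  act (bb j) (mdelta n p) = mdelta j p.
Proof.
move: j; apply: bb_ind => [|j jn IH]; first by rewrite bbn act1.
by rewrite bbE // act_mul IH act_T // mT_mdeltaS.
Qed.

(** Restricted to vectors without xi-part, because on the xi-part [incl y] acts through the sign
    automorphism. *)
Lemma act_incl y (p : ext_pair hbar n) : p.2 = 0 ->
  act (incl y) (mdelta n p) = mdelta n (y * p.1, 0).
Proof.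
case: p => p p' /= ->.
have mdelta0 : mdelta n (0 : ext_pair hbar n) = 0.
  by have := mdelta_linear n (-1) 0 0; rewrite scaleN1r addNr scaleN1r addNr.
elim/dgh_nat_ind: y p => [|i y h IH|j y h IH||y z IH IH'|a y IH] p.
- by rewrite incl1 act1 mul1r.
- rewrite inclM incl_tt // act_mul IH act_T 1?ltnW // mT_mdelta_gt //.
  by congr mdelta; apply: pairP; rewrite /= ?mulr0 ?mulrA.
- rewrite inclM incl_xx // act_mul IH act_X 1?ltnW // mX_mdelta_lt //.
  by congr mdelta; apply: pairP; rewrite /= ?mulr0 ?oppr0 ?mulrA.
- by rewrite incl0 act0 mul0r -[LHS]mdelta0.
- rewrite inclD actD IH IH' -[mdelta n (y * p, 0)]scale1r -mdelta_linear.
  by congr mdelta; apply: pairP; rewrite /= ?scaler0 ?addr0 // scale1r mulrDl.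
- rewrite inclZ actZ IH -[RHS]addr0 -[X in _ = _ + X]mdelta0 -[LHS]addr0.
  rewrite -{1}mdelta0 -mdelta_linear -[X in _ = X + _]scale1r -mdelta_linear.
  by congr mdelta; apply: pairP; rewrite /= ?scaler0 ?addr0 // scale1r scalerAl.
Qed.

Lemma act_emb (p : ext_pair hbar n) : act (emb p) (mvac hbar n) = mdelta n p.
Proof.
rewrite /emb actD act_mul /mvac !act_incl //= !mulr1 act_X // mX_mdelta //.
rewrite -[mdelta n (p.1, 0)]scale1r -mdelta_linear.
by congr mdelta; apply: pairP; rewrite /= ?scale1r ?scaler0 ?addr0 ?add0r.
Qed.

(** Independence of the b_j over B: b_j [emb p] sends [mvac] to the vector with the single
    coordinate [p] at j. Together with [comb_coord], this is freeness. *)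
Lemma coord_comb g j : (j <= n)%N -> bcoord (comb g) j = g j.
Proof.
move=> jn; rewrite /bcoord /comb.
have sumE (r : seq nat) : act (\sum_(i <- r) bb i * emb (g i)) (mvac hbar n) =
    \sum_(i <- r) act (bb i * emb (g i)) (mvac hbar n).
  by elim: r => [|i r IH]; rewrite ?big_nil ?act0 // !big_cons actD IH.
have csumE (r : seq nat) (f : nat -> model hbar n) :
    mcoord (\sum_(i <- r) f i) j = \sum_(i <- r) mcoord (f i) j.
  elim: r => [|i r IH]; first by rewrite !big_nil mcoord0.
  by rewrite !big_cons mcoordD IH.
rewrite sumE csumE (bigD1_seq j) ?mem_index_iota ?iota_uniq //=.
rewrite act_mul act_emb act_bb // mkmodelE // eqxx big_seq_cond big1 ?addr0 // => i.
rewrite mem_index_iota => /andP[/andP[_ i_n] ij].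
by rewrite act_mul act_emb act_bb // mkmodelE // eq_sym (negPf ij).
Qed.


End Inclusion.

(** * The differential in coordinates *)

Section DiffNat.
Variables (F : fieldType) (hbar : F) (k : nat).
Local Notation T := (tt hbar k).
Local Notation X := (xx hbar k).

Lemma diff_tt i : (i.+1 < k)%N -> dgh_diff (T i) = X i - X i.+1.
Proof.
move=> h; have [o e] := ord_pred_ex h.
by rewrite e tt_ord dgh_diffT -!xx_ord.
Qed.
Lemma diff_xx j : (j < k)%N -> dgh_diff (X j) = 0.
Proof. by move=> /ord_ex[o ->]; rewrite xx_ord dgh_diffX. Qed.
Lemma sgn_tt i : (i.+1 < k)%N -> dgh_sgn (T i) = T i.
Proof. by move=> /ord_pred_ex[o ->]; rewrite tt_ord dgh_sgnT. Qed.
Lemma sgn_xx j : (j < k)%N -> dgh_sgn (X j) = - X j.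
Proof. by move=> /ord_ex[o ->]; rewrite xx_ord dgh_sgnX. Qed.
End DiffNat.

Section Diff.
Variables (F : fieldType) (hbar : F) (n : nat).
Local Notation R := (dgh n hbar).
Local Notation R' := (dgh n.+1 hbar).
Local Notation T := (tt hbar n.+1).
Local Notation X := (xx hbar n.+1).
Local Notation incl := (@incl F hbar n).
Local Notation bb := (bb hbar n).
Local Notation d := dgh_diff.
Local Notation B := (ext_pair hbar n).
Implicit Types (y : R) (z w : R') (p : B).

Lemma diff_incl y : d (incl y) = incl (d y).
Proof.
elim/dgh_nat_ind: y => [|i y h IH|j y h IH||y z IH IH'|a y IH].
- by rewrite dgh_diff1 incl1 incl0 dgh_diff1.
- rewrite inclM !dgh_diffM IH inclD !inclM incl_tt // !diff_tt ?leqW //.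
  by rewrite inclD inclN !sgn_tt ?leqW // incl_tt // !incl_xx // ltnW.
- rewrite inclM !dgh_diffM IH inclD !inclM incl_xx // !diff_xx ?leqW //.
  by rewrite incl0 !sgn_xx ?leqW // inclN incl_xx.
- by rewrite incl0 !dgh_diff0 incl0.
- by rewrite inclD !dgh_diffD IH IH' inclD.
- by rewrite inclZ !dgh_diffZ IH inclZ.
Qed.

Lemma sgn_bb j : (j <= n)%N -> dgh_sgn (bb j) = bb j.
Proof.
move: j; apply: bb_ind => [|j jn IH]; first by rewrite bbn dgh_sgn1.
by rewrite bbE // dgh_sgnM IH sgn_tt.
Qed.

(** Differentiating the factor T_i leaves T_j ... T_(i-1) (xi_i - xi_(i+1)) b_(i+1). Here b_(i+1)
    moves to the left past everything, turning xi_(i+1) into xi_n. *)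
Lemma diff_bb j : (j <= n)%N ->
  d (bb j) = \sum_(j <= i < n) bb i.+1 * (\prod_(j <= l < i) T l) * (X i - X n).
Proof.
move: j; apply: bb_ind => [|j jn IH]; first by rewrite bbn dgh_diff1 big_geq.
rewrite bbE // dgh_diffM IH sgn_tt // diff_tt // [RHS]big_ltn //.
congr (_ + _).
  by rewrite (big_geq (leqnn _)) mulr1 mulrBl mulrBr X_bb_gt // X_bb.
rewrite mulr_sumr; apply: eq_big_nat => i /andP[ji i_n].
rewrite (big_ltn ji) !mulrA T_bb_gt //.
Qed.

Definition pairX i p : B := (xx hbar n i * p.1, - (xx hbar n i * p.2)).
Definition pairL y p : B := (y * p.1, y * p.2).
Definition pairD p : B := (d p.1, - d p.2).

Lemma diff_emb p : d (emb p) = emb (pairD p).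
Proof.
rewrite /emb dgh_diffD diff_incl dgh_diffM diff_incl diff_xx // mul0r add0r.
by rewrite sgn_xx // inclN mulrN mulNr.
Qed.
Lemma emb_pairX i p : (i < n)%N -> emb (pairX i p) = X i * emb p.
Proof.
move=> h; rewrite /emb inclN !inclM incl_xx // mulrDr !mulrN !mulrA XnX //.
by rewrite mulNr opprK.
Qed.
Lemma incl_prodT j i : (i < n)%N ->
  incl (\prod_(j <= l < i) tt hbar n l) = \prod_(j <= l < i) T l.
Proof.
move=> i_n; rewrite rmorph_prod; apply: eq_big_nat => l /andP[_ li].
by rewrite /= incl_tt //; lia.
Qed.
Lemma XnprodT j i : (i < n)%N ->
  X n * (\prod_(j <= l < i) T l) = (\prod_(j <= l < i) T l) * X n.
Proof.
move=> i_n; have : (i <= i)%N by [].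
elim: {1 3 4}i => [|m IH] mi; first by rewrite big_geq ?mulr1 ?mul1r.
have [jm|mj] := leqP j m; last by rewrite big_geq ?mulr1 ?mul1r.
rewrite big_nat_recr //= mulrA IH 1?ltnW // -!mulrA XnT //; lia.
Qed.
Lemma emb_prodT j i p : (i < n)%N ->
  emb (pairL (\prod_(j <= l < i) tt hbar n l) p) =
  \prod_(j <= l < i) T l * emb p.
Proof.
by move=> i_n; rewrite /emb /= !inclM incl_prodT // mulrDr !mulrA XnprodT.
Qed.
Definition prodT j i : R := \prod_(j <= l < i) tt hbar n l.
(** The summand i = l - 1 of [diff_bb] lands on b_l, so off the diagonal only coordinates j < l
    contribute. The [pairxi] terms are the part d_n that raises the xi_n-degree. *)
Definition coord_diff (g : nat -> B) l : B := pairD (g l) +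
  \sum_(0 <= j < l) pairL (prodT j l.-1) (pairX l.-1 (g j) - pairxi (g j)).

Lemma embN p : emb (- p) = - emb p.
Proof. exact: linearN. Qed.
Lemma emb_sum (r : seq nat) (f : nat -> B) :
  emb (\sum_(j <- r) f j) = \sum_(j <- r) emb (f j).
Proof. exact: linear_sum. Qed.

Lemma diff_bb_emb j p : (j <= n)%N -> d (bb j * emb p) = bb j * emb (pairD p) +
  \sum_(j <= i < n) bb i.+1 * emb (pairL (prodT j i) (pairX i p - pairxi p)).
Proof.
move=> jn; rewrite dgh_diffM sgn_bb // diff_emb diff_bb // addrC mulr_suml.
congr (_ + _); apply: eq_big_nat => i /andP[ji i_n].
by rewrite emb_prodT // embD embN emb_pairX // emb_pairxi -mulrBl !mulrA.
Qed.

Lemma diff_comb g : d (comb g) = comb (coord_diff g).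
Proof.
pose t j i := bb i.+1 * emb (pairL (prodT j i) (pairX i (g j) - pairxi (g j))).
have -> : comb (coord_diff g) = comb (fun l => pairD (g l)) +
    \sum_(0 <= i < n) \sum_(0 <= j < i.+1) t j i.
  rewrite [X in _ + X](_ : _ = \sum_(0 <= l < n.+1) \sum_(0 <= j < l) t j l.-1).
    rewrite /comb -big_split; apply: eq_big_nat => -[|l] _ /=.
      by rewrite /coord_diff !big_geq ?addr0.
    rewrite /coord_diff embD mulrDr emb_sum mulr_sumr; congr (_ + _).
  by rewrite [RHS]big_nat_recl //= [X in _ = X + _]big_geq // add0r.
rewrite /comb raddf_sum /=.
under eq_big_nat => j /andP[_ jn] do rewrite diff_bb_emb //.
rewrite big_split /=; congr (_ + _).
rewrite (eq_big_nat _ _ (F2 := fun j => \sum_(0 <= i < n | (j <= i)%N) t j i)).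
  rewrite (exchange_big_dep_nat predT) //=; apply: eq_big_nat => i /andP[_ i_n].
  by rewrite [RHS](@big_nat_widen _ _ _ _ _ n.+1) //= ltnW.
by move=> j _; rewrite (big_nat_widenl _ 0).
Qed.

Lemma coordD z w j : bcoord (z + w) j = bcoord z j + bcoord w j.
Proof. by rewrite /bcoord actD mcoordD. Qed.
Lemma coordN z j : bcoord (- z) j = - bcoord z j.
Proof. by rewrite /bcoord actN mcoordN. Qed.
Lemma coord_d z l : (l <= n)%N -> bcoord (d z) l = coord_diff (bcoord z) l.
Proof. by move=> ln; rewrite -{1}(comb_coord z) diff_comb coord_comb. Qed.
Lemma coord_incl y j : (j <= n)%N ->
  bcoord (incl y) j = if j == n then ((y, 0) : B) else 0.
Proof.
move=> jn; rewrite /bcoord act_incl // coords_mdelta //=.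
by rewrite mulr1.
Qed.
Lemma coord_mulr z y j : (j <= n)%N ->
  bcoord (z * incl y) j = ((bcoord z j).1 * y, (bcoord z j).2 * y).
Proof.
move=> jn; rewrite -{1}(comb_coord z).
have -> : comb (bcoord z) * incl y =
    comb (fun j => ((bcoord z j).1 * y, (bcoord z j).2 * y)).
  rewrite /comb mulr_suml; apply: eq_big_nat => i _.
  by rewrite emb_mul mulrA.
by rewrite coord_comb.
Qed.

(* The coefficient of b_0 xi_n: a chain map to R_n up to sign. *)
Definition top_coord z : R := (bcoord z 0).2.

Lemma top_coordD z w : top_coord (z + w) = top_coord z + top_coord w.
Proof. by rewrite /top_coord coordD. Qed.
Lemma top_coordN z : top_coord (- z) = - top_coord z.
Proof. by rewrite /top_coord coordN. Qed.
Lemma top_coord_diff z : top_coord (d z) = - d (top_coord z).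
Proof. by rewrite /top_coord coord_d // /coord_diff big_geq // addr0. Qed.
Lemma top_coord_mulr z y : top_coord (z * incl y) = top_coord z * y.
Proof. by rewrite /top_coord coord_mulr. Qed.
Lemma top_coord_incl y : top_coord (incl y) = 0.
Proof. by rewrite /top_coord coord_incl //; case: eqP. Qed.

Lemma pair2_sum (r : seq nat) (f : nat -> B) :
  (\sum_(j <- r) f j).2 = \sum_(j <- r) (f j).2.
Proof. by elim: r => [|j r IH]; rewrite ?big_nil // !big_cons -IH. Qed.

Lemma coord_diff2 (u : nat -> R) l :
  (coord_diff (fun j => (u j, 0)) l).2 =
    - \sum_(0 <= j < l) prodT j l.-1 * u j.
Proof.
rewrite /coord_diff /= pair2_sum dgh_diff0 oppr0 add0r -sumrN.
by apply: eq_bigr => j _; rewrite /= mulr0 oppr0 add0r mulrN.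
Qed.

Lemma prodTnn l : prodT l l = 1. Proof. by rewrite /prodT big_geq. Qed.

(** Forward substitution: up to sign and a shift of index, d_n is a lower triangular system whose
    diagonal entries are [prodT l l = 1]. [prodT_inj] is uniqueness for the same system. *)
Lemma solve_prodT (f : nat -> R) m : exists u : nat -> R,
  forall l, (l < m)%N -> \sum_(0 <= j < l.+1) prodT j l * u j = f l.
Proof.
elim: m => [|m [u IH]]; first by exists f.
exists (fun j => if j == m then f m - \sum_(0 <= i < m) prodT i m * u i else u j).
move=> l; rewrite ltnS leq_eqVlt => /predU1P[->|lm].
  rewrite big_nat_recr //= eqxx prodTnn mul1r.
  rewrite (eq_big_nat _ _ (F2 := fun i => prodT i m * u i)) => [|i /andP[_ im]].
    by rewrite addrC subrK.
  by rewrite ltn_eqF.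
rewrite -[RHS]IH //; apply: eq_big_nat => i /andP[_ il].
by rewrite ltn_eqF // (leq_ltn_trans _ lm).
Qed.

Lemma prodT_inj (u : nat -> R) m :
  (forall l, (l < m)%N -> \sum_(0 <= j < l.+1) prodT j l * u j = 0) ->
  forall l, (l < m)%N -> u l = 0.
Proof.
move=> h; elim/ltn_ind => l IH lm.
have := h l lm; rewrite big_nat_recr //= prodTnn mul1r.
rewrite big_nat_cond big1 ?add0r // => j; rewrite andbT => /andP[_ jl].
by rewrite IH ?mulr0 // (ltn_trans jl).
Qed.

(* Modulo exact elements, an element without b_0 xi_n part can be freed from
   its xi_n part altogether; then closedness forces the b_j parts, j < n, to
   vanish too. *)
Lemma descend w y : d w = incl y -> top_coord w = 0 ->
  exists y' v, w = incl y' + d v.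
Proof.
move=> dw w0.
have [u hu] := solve_prodT (fun l => (bcoord w l.+1).2) n.
(* [coord_diff2] carries a minus sign, so adding this boundary cancels the second components at 1,
   ..., n; the one at 0 is zero by [w0]. *)
pose w2 := w + d (comb (fun j => ((u j, 0) : B))).
have w22 l : (l <= n)%N -> (bcoord w2 l).2 = 0.
  move=> ln; rewrite coordD diff_comb coord_comb //.
  rewrite [X in X = _](_ : _ = (bcoord w l).2 + (coord_diff (fun j => (u j, 0)) l).2) //.
  rewrite coord_diff2; case: l ln => [|l] ln; last by rewrite hu // subrr.
  by rewrite big_geq // oppr0 addr0.
have dw2 : d w2 = incl y by rewrite dgh_diffD dgh_diff_diff addr0.
pose g l := (bcoord w2 l).1.
have w2E : w2 = comb (fun j => (g j, 0)).
  rewrite -[LHS]comb_coord; apply: eq_comb => j jn.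
  by rewrite (surjective_pairing (bcoord w2 j)) w22.
have g0 : forall l, (l < n)%N -> g l = 0.
  apply: prodT_inj => l ln; apply: oppr_inj; rewrite oppr0.
  have := coord_diff2 g l.+1; rewrite -(coord_comb (coord_diff _)) //.
  rewrite -diff_comb -w2E dw2 coord_incl //= => <-.
  by case: eqP.
exists (g n), (- comb (fun j => (u j, 0))).
rewrite dgh_diffN; apply: (canRL (addrK _)); rewrite -/w2 w2E.
rewrite /comb big_nat_recr //= bbn mul1r /emb /= incl0 mulr0 addr0.
rewrite big_nat_cond big1 ?add0r // => j; rewrite andbT => /andP[_ jn].
by rewrite g0 // incl0 addr0 mulr0.
Qed.

End Diff.

(** * The elements h_(k,i) *)

Section Step.
Variable S : nzRingType.
(** Makes the decision procedure for noncommutative ring identities available. It knows no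
    relations, so later proofs write the difference of two sides explicitly as a combination of
    terms that the relations kill. *)
#[local] Instance nzring_ops :
  @Ncring.Ring_ops S 0 1 +%R *%R (fun x y => x - y) -%R eq := {}.
#[local] Instance nzring_ring : Ncring.Ring (Ro := nzring_ops).
Proof.
split; first exact: RelationClasses.eq_equivalence.
- by move=> x y e u v e'; apply: (congr2 _ e e').
- by move=> x y e u v e'; apply: (congr2 _ e e').
- by move=> x y e u v e'; apply: (congr2 _ e e').
- by move=> x y e; apply: (congr1 _ e).
- exact: add0r.
- exact: addrC.
- exact: addrA.
- exact: mul1r.
- exact: mulr1.
- exact: mulrA.
- exact: mulrDl.
- by move=> x y z; apply: mulrDr.
- by [].
- exact: subrr.
Qed.

Implicit Types t u v x y a b c e : S.

Definition hstep t v a b c := a - v * b + b * t - v * c * t.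

Lemma hstep_comm u t v a b c : u * t = t * u -> u * v = v * u ->
    u * a = a * u -> u * b = b * u -> u * c = c * u ->
  u * hstep t v a b c = hstep t v a b c * u.
Proof.
move=> ut uv ua ub uc; apply: commrB; last by do 2?apply: commrM.
by apply: commrD; [apply: commrB => //|]; apply: commrM.
Qed.

Lemma hstep_anti u t v a b c : u * t = t * u -> u * v = v * u ->
    u * a = - (a * u) -> u * b = - (b * u) -> u * c = - (c * u) ->
  u * hstep t v a b c = - (hstep t v a b c * u).
Proof.
move=> ut uv ua ub uc.
have e1 : u * (v * b) = - (v * b * u) by rewrite mulrA uv -mulrA ub mulrN mulrA.
have e2 : u * (b * t) = - (b * t * u) by rewrite mulrA ub mulNr -!mulrA ut.
have e3 : u * (v * c * t) = - (v * c * t * u).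
  by rewrite !mulrA uv -!mulrA (mulrA u) uc mulNr !mulrN -!mulrA ut.
by rewrite mulrBr mulrDr mulrBr ua e1 e2 e3 mulrBl mulrDl mulrBl !opprD.
Qed.

(* On generating series this is the telescoping
   [d ((1 - s v) h (1 + s t)) = s {y, (1 - s v) h (1 + s t)}]. *)
Lemma hstep_diff t v x y b c e : y * v = v * x -> x * t = t * y ->
  (x * b + b * x) - ((x - y) * b + v * (x * c + c * x))
    + ((x * c + c * x) * t - b * (x - y))
    - ((x - y) * (c * t) + v * ((x * e + e * x) * t - c * (x - y))) =
  y * hstep t v b c e + hstep t v b c e * y.
Proof.
move=> yv xt; apply: subr0_eq.
(* The difference of the two sides as an element of the ideal generated by the two hypotheses. *)
transitivity ((y * v - v * x) * (c + e * t) + (c - v * e) * (x * t - t * y)).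
  rewrite /hstep; Ncring_tac.non_commutative_ring.
by rewrite yv xt !subrr mul0r mulr0 addr0.
Qed.
End Step.

#[local] Existing Instance nzring_ops.
#[local] Existing Instance nzring_ring.

Section HElements.
Variables (F : fieldType) (hbar : F) (k : nat).
Local Notation R := (dgh k hbar).
Local Notation T := (tt hbar k).
Local Notation V := (Tinv hbar T).
Local Notation X := (xx hbar k).
Local Notation d := dgh_diff.

(* The first index is shifted: [hh m i] is h_(m+1,i). *)
Definition hh (m : nat) (i : int) : R := dgh_h k hbar m.+1 i.

Lemma hh0 i : hh 0 i = if i == 1 then X 0 else 0.
Proof. by rewrite xx.unlock. Qed.
Lemma hhS m i : hh m.+1 i =
  hstep (T m) (V m) (hh m i) (hh m (i - 1)) (hh m (i - 2)).
Proof. by rewrite /Tinv tt.unlock. Qed.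

Let rT := tt_rels hbar k.
Let rX := xx_rels hbar k.

Lemma hh_T m i j : (m < j)%N -> (j.+1 < k)%N -> T j * hh m i = hh m i * T j.
Proof.
elim: m i => [|m IH] i mj jk.
  rewrite hh0; case: eqP => _; last by rewrite mulr0 mul0r.
  by apply/esym/(rels_xiT rX) => //; lia.
have mj' := ltnW mj.
have c : T m * T j = T j * T m by apply: (rels_far rT).
rewrite hhS; apply: hstep_comm; rewrite ?IH //.
by apply/esym; apply: comm_Tinv.
Qed.

Lemma hh_X m i j : (m < j < k)%N -> X j * hh m i = - (hh m i * X j).
Proof.
elim: m i => [|m IH] i /andP[mj jk].
  rewrite hh0; case: eqP => _; last by rewrite mulr0 mul0r oppr0.
  by rewrite [in RHS](rels_anti rX) ?opprK // mj.
have mj' : (m < j < k)%N by rewrite ltnW.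
have c : X j * T m = T m * X j by apply: (rels_xiT rX); lia.
rewrite hhS; apply: hstep_anti; rewrite ?IH //.
by apply/esym/comm_Tinv.
Qed.

Lemma hh_sgn m i : (m < k)%N -> dgh_sgn (hh m i) = - hh m i.
Proof.
elim: m i => [|m IH] i mk.
  by rewrite hh0; case: eqP => _; rewrite ?dgh_sgn0 ?oppr0 // sgn_xx.
have mk' := ltnW mk.
have sV : dgh_sgn (V m) = V m.
  by rewrite /Tinv dgh_sgnD dgh_sgnN dgh_sgnZ dgh_sgn1 sgn_tt.
rewrite hhS /hstep !(dgh_sgnD, dgh_sgnN) !dgh_sgnM sV sgn_tt // !IH //.
by rewrite !(mulrN, mulNr) !opprD !opprK.
Qed.

Lemma xV m : (m.+1 < k)%N -> X m.+1 * V m = V m * X m.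
Proof.
move=> mk; rewrite -[X m.+1]mul1r -(Tinv_TK rT mk) -!mulrA (mulrA (T m)).
by rewrite -(rels_lo rX) // -!mulrA (T_TinvK rT) // mulr1.
Qed.

Lemma hh_diff m i : (m < k)%N ->
  d (hh m i) = X m * hh m (i - 1) + hh m (i - 1) * X m.
Proof.
elim: m i => [|m IH] i mk.
  rewrite !hh0; have -> : d (if i == 1 then X 0 else 0) = 0.
    by case: eqP => _; rewrite ?dgh_diff0 ?diff_xx.
  by case: eqP => _; rewrite ?(rels_sq rX) // ?mulr0 ?mul0r addr0.
have mk' := ltnW mk.
have sV : dgh_sgn (V m) = V m.
  by rewrite /Tinv dgh_sgnD dgh_sgnN dgh_sgnZ dgh_sgn1 sgn_tt.
have dV : d (V m) = X m - X m.+1.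
  by rewrite /Tinv dgh_diffD dgh_diffN dgh_diffZ dgh_diff1 scaler0 subr0 diff_tt.
rewrite (hhS m (i - 1)) -(hstep_diff _ _ _ (xV mk) (rels_lo rX mk)).
have e1 : i - 1 - 1 = i - 2 :> int by lia.
have e2 : i - 1 - 2 = i - 2 - 1 :> int by lia.
rewrite hhS /hstep -mulrA !(dgh_diffD, dgh_diffN) !dgh_diffM !IH //.
by rewrite dV sV !hh_sgn // diff_tt // !mulNr e1 e2.
Qed.

(** If T commutes with the two lower terms b and c, conjugation disappears: - T^-1 b + b T = (T -
    T^-1) b = hbar b and T^-1 c T = c. *)
Lemma hstep_lowE m i : (m.+1 < k)%N ->
  T m * hh m (i - 1) = hh m (i - 1) * T m ->
  T m * hh m (i - 2) = hh m (i - 2) * T m ->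
  hh m.+1 i = hh m i + hbar *: hh m (i - 1) - hh m (i - 2).
Proof.
move=> mk h1 h2; rewrite hhS /hstep -mulrA -h2 mulrA (Tinv_TK rT) // mul1r.
congr (_ - _); rewrite /Tinv mulrBl mulr_algl -h1 opprB addrA.
by rewrite subrK.
Qed.

(** For i <= m the element h_(m+1,i) already comes from R_m, which commutes with [T m]. The
    commutation one rank down is what [hstep_lowE] needs to express it there. *)
Lemma hh_lowT m i : (m.+1 < k)%N -> i <= m%:Z -> T m * hh m i = hh m i * T m.
Proof.
elim: m i => [|m IH] i mk im.
  by rewrite hh0; case: eqP => [e|_]; [move: im; rewrite e|rewrite mulr0 mul0r].
have mk' := ltnW mk.
rewrite hstep_lowE ?IH //; [|lia..].
rewrite mulrBr mulrDr mulrBl mulrDl -scalerAl -scalerAr !hh_T //.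
Qed.

(* So h_(m+2,i) lies in R_(m+1) for i <= m+1. *)
Lemma hh_low m i : (m.+1 < k)%N -> i <= m.+1%:Z ->
  hh m.+1 i = hh m i + hbar *: hh m (i - 1) - hh m (i - 2).
Proof. by move=> mk im; apply: hstep_lowE; rewrite ?hh_lowT //; lia. Qed.

Lemma hh_lowX m i : (m < k)%N -> i <= m%:Z -> X m * hh m i = - (hh m i * X m).
Proof.
case: m => [|m] mk im.
  by rewrite hh0; case: eqP => [e|_]; [move: im; rewrite e|rewrite mulr0 mul0r oppr0].
have h : (m < m.+1 < k)%N by rewrite leqnn.
rewrite hh_low // mulrBr mulrDr mulrBl mulrDl -scalerAl -scalerAr !hh_X //.
by rewrite scalerN !opprD.
Qed.

(** The differential is the anticommutator of xi with the element of index i - 1 <= m, which lies in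
    the smaller algebra and therefore anticommutes with xi. *)
Lemma hh_closed m i : (m < k)%N -> i <= m.+1%:Z -> d (hh m i) = 0.
Proof.
move=> mk im; rewrite hh_diff // hh_lowX ?addNr //; lia.
Qed.
End HElements.

(** * Inclusions and the coefficient of b_0 xi_n in h_(n+1,n+1) *)

Section HIncl.
Variables (F : fieldType) (hbar : F) (n : nat).

Lemma incl_hh m i : (m < n)%N -> incl (hh hbar n m i) = hh hbar n.+1 m i.
Proof.
elim: m i => [|m IH] i mn.
  by rewrite !hh0; case: eqP => _; rewrite ?incl_xx ?incl0.
have mn' := ltnW mn.
have iV : incl (Tinv hbar (tt hbar n) m) = Tinv hbar (tt hbar n.+1) m.
  by rewrite /Tinv inclD inclN inclZ incl1 incl_tt.
rewrite !hhS /hstep !(inclD, inclN) !inclM iV incl_tt // !IH //.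
Qed.

Lemma incl2_T m (y : dgh m hbar) :
  tt hbar m.+2 m * incl (incl y) = incl (incl y) * tt hbar m.+2 m.
Proof.
have rT := tt_rels hbar m.+2; have rX := xx_rels hbar m.+2.
elim/dgh_nat_ind: y => [|i y h IH|j y h IH||y z IH IH'|a y IH].
- by rewrite !incl1 mulr1 mul1r.
- rewrite inclM incl_tt // inclM incl_tt ?leqW // mulrA -(rels_far rT) //.
  by rewrite -!mulrA IH.
- rewrite inclM incl_xx // inclM incl_xx ?leqW // mulrA -(rels_xiT rX) //; try lia.
  by rewrite -!mulrA IH.
- by rewrite !incl0 mulr0 mul0r.
- by rewrite !inclD mulrDr mulrDl IH IH'.
- by rewrite !inclZ -scalerAl -scalerAr IH.
Qed.

(** Right multiplication by T_m carries the basis b_j of R_(m+1) over its B to the first m + 1 basis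
    elements one rank up, and xi_m T_m = T_m xi_(m+1) carries xi-parts to xi-parts. *)
Lemma top_coord_mulT m (y : dgh m.+1 hbar) :
  top_coord (incl y * tt hbar m.+2 m) = incl (top_coord y).
Proof.
have rT := tt_rels hbar m.+2; have rX := xx_rels hbar m.+2.
pose g j : ext_pair hbar m.+1 :=
  if j == m.+1 then 0 else (incl (bcoord y j).1, incl (bcoord y j).2).
have bT j : (j <= m)%N -> incl (bb hbar m j) * tt hbar m.+2 m = bb hbar m.+1 j.
  move=> jm; rewrite /bb big_nat_recr //= rmorph_prod; congr (_ * _).
  by apply: eq_big_nat => i /andP[_ im]; rewrite /= incl_tt.
have eT (p : ext_pair hbar m) : incl (emb p) * tt hbar m.+2 m =
    tt hbar m.+2 m * emb ((incl p.1, incl p.2) : ext_pair hbar m.+1).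
  rewrite /emb /= inclD inclM incl_xx // mulrDl mulrDr -incl2_T; congr (_ + _).
  by rewrite -mulrA -incl2_T mulrA (rels_lo rX) // mulrA.
have -> : incl y * tt hbar m.+2 m = comb g.
  rewrite -{1}(comb_coord y) /comb linear_sum mulr_suml [RHS]big_nat_recr //=.
  rewrite /g eqxx linear0 mulr0 addr0; apply: eq_big_nat => j /andP[_ jm].
  by rewrite inclM -mulrA eT mulrA bT // ltn_eqF.
by rewrite /top_coord coord_comb.
Qed.

End HIncl.

Section HTop.
Variables (F : fieldType) (hbar : F).

Lemma top_coord_T m : top_coord (tt hbar m.+2 m) = 0.
Proof.
by rewrite /top_coord /bcoord act_T // mT_mdeltaS // coords_mdelta //; case: eqP.
Qed.

(** Of the four terms of the recursion, the outer two lie in R_(m+1): the last one because T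
    commutes with h_(m+1,m). The term with T^-1 on the left has no b_0 xi part, so only h_(m+1,m+1)
    T contributes. *)
Lemma top_coord_hh m : top_coord (hh hbar m.+1 m m.+1%:Z) = 1.
Proof.
elim: m => [|m IH].
  by rewrite hh0 /top_coord /bcoord act_X // mX_mdelta // coords_mdelta.
have hT := @hh_lowT F hbar m.+2 m m%:Z (ltnSn _) (lexx _).
rewrite hhS /hstep.
have -> : m.+2%:Z - 1 = m.+1%:Z by lia.
have -> : m.+2%:Z - 2 = m%:Z by lia.
rewrite -[_ * hh _ _ m _ * _]mulrA -hT mulrA (Tinv_TK (tt_rels hbar m.+2)) // mul1r.
rewrite -!(incl_hh hbar _ (ltnSn m)) !top_coordD !top_coordN !top_coord_incl.
rewrite top_coord_mulT IH incl1 top_coord_mulr.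
have -> : top_coord (Tinv hbar (tt hbar m.+2) m) = 0.
  rewrite /Tinv top_coordD top_coordN top_coord_T.
  by rewrite -incl1 -inclZ top_coord_incl oppr0 addr0.
by rewrite mul0r oppr0 !addr0 add0r.
Qed.
End HTop.

(** * The reflection equation *)

Section Reflection.
Variable S : nzRingType.

(** The parameters are central ring elements rather than scalars, so that formal variables of
    polynomial rings over R_k can be used. *)
Definition central (c : S) := forall y, c * y = y * c.

Variable h : S.
Hypothesis hC : central h.

(** After the cubic terms cancel by the braid relation, the difference of the sides is a multiple of
    t - u; the last hypothesis says that its coefficient vanishes. *)
Lemma yang_baxter (a1 b1 a2 b2 a3 b3 t u : S) :
    central a1 -> central b1 -> central a2 -> central b2 ->
    central a3 -> central b3 ->
    t * t = 1 + h * t -> u * u = 1 + h * u -> t * u * t = u * t * u ->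
    a2 * (a3 * b1 + b3 * a1 + b3 * b1 * h) = b2 * (a3 * a1) ->
  (a1 + b1 * t) * (a2 + b2 * u) * (a3 + b3 * t) =
  (a3 + b3 * u) * (a2 + b2 * t) * (a1 + b1 * u).
Proof.
move=> c1 d1 c2 d2 c3 d3 tt uu tut e; apply: subr0_eq.
have e1 (x y : S) : (a1 + b1 * t) * x * (a3 + b3 * y) =
    a3 * (a1 * x + b1 * (t * x)) + b3 * (a1 * (x * y) + b1 * (t * x * y)).
  by rewrite mulrDr -c3 (mulrA _ b3) -d3; Ncring_tac.non_commutative_ring.
have e2 (x y : S) : (a3 + b3 * u) * x * (a1 + b1 * y) =
    a1 * (a3 * x + b3 * (u * x)) + b1 * (a3 * (x * y) + b3 * (u * x * y)).
  by rewrite mulrDr -c1 (mulrA _ b1) -d1; Ncring_tac.non_commutative_ring.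
have e0 (P Q x : S) : P * (a2 + b2 * x) * Q = a2 * (P * 1 * Q) + b2 * (P * x * Q).
  by rewrite mulrDr -(c2 P) (mulrA P) -(d2 P); Ncring_tac.non_commutative_ring.
have f1 : (a1 + b1 * t) * 1 * (a3 + b3 * t) =
    a3 * a1 + b3 * b1 + (a3 * b1 + b3 * a1 + b3 * b1 * h) * t.
  by rewrite e1 !mulr1 tt; Ncring_tac.non_commutative_ring.
have f2 : (a3 + b3 * u) * 1 * (a1 + b1 * u) =
    a3 * a1 + b3 * b1 + (a3 * b1 + b3 * a1 + b3 * b1 * h) * u.
  rewrite e2 !mulr1 mul1r uu.
  rewrite !mulrDr !mulrA (c1 a3) (c1 b3) -(c3 b1) -(d3 b1).
  Ncring_tac.non_commutative_ring.
have f3 : (a1 + b1 * t) * u * (a3 + b3 * t) - (a3 + b3 * u) * t * (a1 + b1 * u) =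
    a3 * a1 * (u - t).
  rewrite e1 e2 !mulrDr !mulrA (c1 a3) (c1 b3) -(c3 b1) -(d3 b1).
  have -> : b3 * b1 * t * u * t = b3 * b1 * u * t * u.
    by rewrite -!mulrA (mulrA t) tut !mulrA.
  Ncring_tac.non_commutative_ring.
rewrite !e0 f1 f2; transitivity (b2 * ((a1 + b1 * t) * u * (a3 + b3 * t)
   - (a3 + b3 * u) * t * (a1 + b1 * u)) +
   a2 * (a3 * b1 + b3 * a1 + b3 * b1 * h) * (t - u)).
  Ncring_tac.non_commutative_ring.
by rewrite f3 e; Ncring_tac.non_commutative_ring.
Qed.

Variables (k : nat) (T : nat -> S) (x : S).
Hypotheses (quad : forall i, (i.+1 < k)%N -> T i * T i = 1 + h * T i)
  (braid : forall i, (i.+2 < k)%N -> T i * T i.+1 * T i = T i.+1 * T i * T i.+1)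
  (far : forall i j, (i.+1 < j)%N -> (j.+1 < k)%N -> T i * T j = T j * T i)
  (x_sq : x * x = 0)
  (xT : forall i, (0 < i)%N -> (i.+1 < k)%N -> x * T i = T i * x)
  (xT0 : (1 < k)%N -> T 0 * x * T 0 * x * T 0 = - (x * T 0 * x)).

(** With T^-1 = T - h, the three factors are 1 + s T, 1 - s T^-1 and 1 + s T - t T^-1. The first two
    are the third with t = 0, respectively with parameters 0 and s. *)
Definition baxp s m : S := 1 + s * T m.
Definition baxm s m : S := (1 + s * h) + (- s) * T m.
Definition baxz s t m : S := (1 + t * h) + (s - t) * T m.

(* The generating series of the h_(m+1,i), with variable [s]. *)
Fixpoint hgen s m : S :=
  if m is m'.+1 then baxm s m' * hgen s m' * baxp s m' else s * x.

Lemma centralD c c' : central c -> central c' -> central (c + c').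
Proof. by move=> cC cC' y; rewrite mulrDl mulrDr cC cC'. Qed.
Lemma centralN c : central c -> central (- c).
Proof. by move=> cC y; rewrite mulNr mulrN cC. Qed.
Lemma centralM c c' : central c -> central c' -> central (c * c').
Proof. by move=> cC cC' y; rewrite -mulrA cC' mulrA cC mulrA. Qed.
Lemma central1 : central 1.
Proof. by move=> y; rewrite mulr1 mul1r. Qed.
#[local] Hint Resolve centralD centralN centralM central1 hC : core.

Lemma baxz_baxp s t m : central s -> central t -> (m.+2 < k)%N ->
  baxp s m * baxz s t m.+1 * baxm t m = baxm t m.+1 * baxz s t m * baxp s m.+1.
Proof.
move=> sC tC mk; have mk' := ltnW mk.
apply: yang_baxter; rewrite ?quad ?braid //; try by auto.
rewrite (_ : (1 + t * h) * s + - t * 1 + - t * s * h = s - t).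
  by rewrite mulr1; have -> := (centralD sC (centralN tC)) (1 + t * h).
apply: subr0_eq; transitivity (t * (h * s - s * h)).
  Ncring_tac.non_commutative_ring.
by rewrite hC subrr mulr0.
Qed.

Lemma baxp_baxz s t m : central s -> central t -> (m.+2 < k)%N ->
  baxp s m.+1 * baxp t m * baxz t s m.+1 = baxz t s m * baxp t m.+1 * baxp s m.
Proof.
move=> sC tC mk; have mk' := ltnW mk.
apply: yang_baxter; rewrite ?quad ?braid //; try by auto.
apply: subr0_eq; transitivity (s * (h * s - s * h)).
  Ncring_tac.non_commutative_ring.
by rewrite hC subrr mulr0.
Qed.

Lemma baxz_baxm s t m : central s -> central t -> (m.+2 < k)%N ->
  baxz s t m.+1 * baxm t m * baxm s m.+1 = baxm s m * baxm t m.+1 * baxz s t m.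
Proof.
move=> sC tC mk; have mk' := ltnW mk.
apply: yang_baxter; rewrite ?quad ?braid //; try by auto.
rewrite (_ : (1 + s * h) * (s - t) + - s * (1 + t * h) + - s * (s - t) * h =
  - (t * (1 + s * h))).
  have thC : central (1 + t * h) by auto.
  by rewrite thC !mulNr !mulrA.
apply: subr0_eq; transitivity (s * (h * s - s * h) - (s * h * t - t * (s * h))).
  Ncring_tac.non_commutative_ring.
by rewrite (tC (s * h)) hC !subrr mulr0 subrr.
Qed.

(** The product is central because T - T^-1 = h; this lets the inner factors of h(s)^2 cancel out in
    [hgen_sq]. *)
Lemma baxp_baxm s m : central s -> (m.+1 < k)%N ->
  baxp s m * baxm s m = 1 + s * h - s * s.
Proof.
move=> sC mk; apply: subr0_eq.
transitivity (s * (T m * s - s * T m) * (h - T m) - s * s * (T m * T m - 1 - h * T m)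
   + s * (s * (T m * h - h * T m))).
  rewrite /baxp /baxm; Ncring_tac.non_commutative_ring.
have -> : T m * T m - 1 - h * T m = 0 by rewrite (quad mk) -addrA -opprD subrr.
by rewrite (sC (T m)) (hC (T m)) !subrr !mulr0 mul0r subrr addr0.
Qed.

Lemma hgen_comm s m j : central s -> (m < j)%N -> (j.+1 < k)%N ->
  hgen s m * T j = T j * hgen s m.
Proof.
move=> sC; elim: m => [|m IH] mj jk /=; first by rewrite -mulrA xT // mulrA sC -mulrA.
have mj' := ltnW mj; have TT := far mj jk.
have TC : GRing.comm (T j) (T m) by [].
have scomm y : central y -> GRing.comm (T j) y by move=> yC; apply: esym.
apply/esym; rewrite -/(GRing.comm _ _).
apply: commrM; first apply: commrM.
- apply: commrD; first by apply: scomm; auto.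
  by apply: commrM => //; apply: scomm; auto.
- by apply/esym; apply: IH.
- apply: commrD; first exact: commr1.
  by apply: commrM => //; apply: scomm.
Qed.

Lemma centralCA c y z : central c -> y * (c * z) = c * (y * z).
Proof. by move=> cC; rewrite !mulrA cC. Qed.

Lemma bax_comm (c1 c2 : S) y j : central c1 -> central c2 -> y * T j = T j * y ->
  (c1 + c2 * T j) * y = y * (c1 + c2 * T j).
Proof.
by move=> d1 d2 yT; rewrite mulrDl mulrDr d1 -mulrA -yT !mulrA d2.
Qed.

(** The defect of the reflection equation, with a plus sign between its sides because the series are
    odd. *)
Definition reflection s t m :=
  hgen s m * baxz s t m * hgen t m * baxz t s m +
  baxz s t m * hgen t m * baxz t s m * hgen s m.

Lemma reflection0 s t : central s -> central t -> (1 < k)%N -> reflection s t 0 = 0.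
Proof.
move=> sC tC k1; set w := x * T 0 * x.
have TT := quad k1.
(* [xT0] reads T w T = - w; multiplying the claim by the invertible T on the left reduces it to this
   and the quadratic relation. *)
have wT : w * T 0 + T 0 * w = h * w.
  have inj y : T 0 * y = 0 -> y = 0.
    move=> Ty; rewrite -[y]mul1r; have -> : 1 = (T 0 - h) * T 0.
      by rewrite mulrBl TT addrK.
    by rewrite -mulrA Ty mulr0.
  apply: subr0_eq; apply: inj; rewrite mulrBr mulrDr.
  rewrite (mulrA (T 0) w) (mulrA (T 0) (T 0)) TT.
  have -> : T 0 * w * T 0 = - w by rewrite /w !mulrA xT0.
  by rewrite mulrDl mul1r addrA addNr add0r !mulrA hC subrr.
have xZx a c : central a -> central c -> x * (a + c * T 0) * x = c * w.
  move=> aC cC; rewrite mulrDr mulrDl -aC -mulrA x_sq mulr0 add0r.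
  by rewrite mulrA -cC /w !mulrA.
have stC : central (s * t) by auto.
have cC : central (s - t) by auto.
rewrite /reflection /=.
have -> : s * x * baxz s t 0 * (t * x) * baxz t s 0 =
    s * (t * ((s - t) * w * baxz t s 0)).
  rewrite -(xZx (1 + t * h)) //; last by auto.
  by rewrite (centralCA _ _ tC) -!mulrA (centralCA t _ sC).
have -> : baxz s t 0 * (t * x) * baxz t s 0 * (s * x) =
    s * (t * (baxz s t 0 * ((t - s) * w))).
  rewrite -(xZx (1 + s * h)) //; [|by auto..].
  by rewrite (centralCA _ _ sC) (centralCA _ _ tC) -!mulrA.
rewrite -!mulrDr; have -> : (s - t) * w * baxz t s 0 + baxz s t 0 * ((t - s) * w) = 0.
  rewrite (centralCA _ _ _); last by auto.
  transitivity ((s - t) * (w * (1 + s * h) - (1 + t * h) * w + w * (- (s - t) * T 0)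
     - (s - t) * (T 0 * w))).
    rewrite /baxz; Ncring_tac.non_commutative_ring.
  rewrite (centralCA _ _ (centralN cC)).
  have -> : w * (1 + s * h) = (1 + s * h) * w.
    by have /(_ w) -> : central (1 + s * h) by auto.
  transitivity ((s - t) * ((s - t) * (h * w - (w * T 0 + T 0 * w)))).
    Ncring_tac.non_commutative_ring.
  by rewrite wT subrr !mulr0.
by rewrite !mulr0.
Qed.

(** Primes mark the same factor with T_(m+1) in place of T_m. Two Yang-Baxter moves and two
    commutations bring the first summand of the reflection equation at m + 1 to a conjugate of the
    one at m; [conj_right] gives the second summand with the same outer factors. *)
Lemma conj_left (a A b c B d z z1 u u1 b' c' d' : S) :
  b * u * c = c' * z * b' -> b' * d * u1 = z1 * d' * b ->
  c' * A = A * c' -> b' * B = B * b' ->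
  a * A * b * u * (c * B * d) * u1 = a * c' * (A * z * B * z1) * d' * b.
Proof.
move=> y1 y3 c1 c2; apply: subr0_eq.
transitivity (a * A * (b * u * c - c' * z * b') * B * d * u1
  - a * (c' * A - A * c') * z * b' * B * d * u1
  + a * c' * A * z * (b' * B - B * b') * d * u1
  + a * c' * A * z * B * (b' * d * u1 - z1 * d' * b)).
  Ncring_tac.non_commutative_ring.
by rewrite y1 y3 c1 c2 !subrr !(mulr0, mul0r) subrr !addr0.
Qed.

Lemma conj_right (a A b c B d z z1 u u1 a' c' d' : S) :
  d * u1 * a = a' * z1 * d' -> u * c * a' = a * c' * z ->
  a' * B = B * a' -> d' * A = A * d' ->
  u * (c * B * d) * u1 * (a * A * b) = a * c' * (z * B * z1 * A) * d' * b.
Proof.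
move=> y2 y4 c3 c4; apply: subr0_eq.
transitivity (u * c * B * (d * u1 * a - a' * z1 * d') * A * b
  - u * c * (a' * B - B * a') * z1 * d' * A * b
  + (u * c * a' - a * c' * z) * B * z1 * d' * A * b
  + a * c' * z * B * z1 * (d' * A - A * d') * b).
  Ncring_tac.non_commutative_ring.
by rewrite y2 y4 c3 c4 !subrr !(mulr0, mul0r) subrr !addr0.
Qed.

Lemma reflectionP s t m : central s -> central t -> (m.+1 < k)%N ->
  reflection s t m = 0.
Proof.
move=> sC tC; elim: m => [|m IH] mk; first exact: reflection0.
have mk' := ltnW mk.
have comm r c1 c2 : central r -> central c1 -> central c2 ->
  (c1 + c2 * T m.+1) * hgen r m = hgen r m * (c1 + c2 * T m.+1).
  by move=> rC d1 d2; apply: bax_comm => //; apply: hgen_comm.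
have Y1 := baxz_baxp sC tC mk; have Y2 := baxz_baxp tC sC mk.
have Y3 := baxp_baxz sC tC mk; have Y4 := baxz_baxm sC tC mk.
have C1 : baxm t m.+1 * hgen s m = hgen s m * baxm t m.+1 by apply: comm; auto.
have C2 : baxp s m.+1 * hgen t m = hgen t m * baxp s m.+1 by apply: comm; auto.
have C3 : baxm s m.+1 * hgen t m = hgen t m * baxm s m.+1 by apply: comm; auto.
have C4 : baxp t m.+1 * hgen s m = hgen s m * baxp t m.+1 by apply: comm; auto.
transitivity (baxm s m * baxm t m.+1 * reflection s t m * baxp t m.+1 * baxp s m);
  last by rewrite IH // mulr0 !mul0r.
have dist (l p q r1 r2 : S) : l * (p + q) * r1 * r2 = l * p * r1 * r2 + l * q * r1 * r2.
  by rewrite mulrDr !mulrDl.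
rewrite /reflection [RHS]dist /=; congr (_ + _).
  exact: conj_left Y1 Y3 C1 C2.
exact: conj_right Y2 Y4 C3 C4.
Qed.

Lemma hgen_sq s m : central s -> (m < k)%N -> hgen s m * hgen s m = 0.
Proof.
move=> sC; elim: m => [|m IH] mk /=.
  by rewrite -mulrA (centralCA _ _ sC) x_sq !mulr0.
have cC : central (1 + s * h - s * s) by auto.
rewrite !mulrA -(mulrA _ (baxp s m) (baxm s m)) baxp_baxm // -cC -!mulrA.
by rewrite (mulrA (hgen s m)) IH ?mul0r ?mulr0 // ltnW.
Qed.
End Reflection.

(** * Extracting coefficients from the reflection equation *)

Lemma central_polyC (R : nzRingType) (c : R) : central c -> central c%:P.
Proof. by move=> cC p; apply/polyP=> i; rewrite coefCM coefMC cC. Qed.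
Lemma central_polyX (R : nzRingType) : central ('X : {poly R}).
Proof. by move=> p; rewrite commr_polyX. Qed.

Lemma hgen_morph (R S : nzRingType) (f : {rmorphism R -> S}) h T x s m :
  f (hgen h T x s m) = hgen (f h) (fun i => f (T i)) (f x) (f s) m.
Proof.
elim: m => [|m IH] /=; first by rewrite rmorphM.
by rewrite !rmorphM IH /= /baxm /baxp !(rmorphD, rmorphN, rmorphM, rmorph1).
Qed.

Section Coefficients.
Variables (R : nzRingType) (h : R) (k : nat) (T : nat -> R) (x : R).
Hypotheses (hC : central h)
  (quad : forall i, (i.+1 < k)%N -> T i * T i = 1 + h * T i)
  (braid : forall i, (i.+2 < k)%N -> T i * T i.+1 * T i = T i.+1 * T i * T i.+1)
  (far : forall i j, (i.+1 < j)%N -> (j.+1 < k)%N -> T i * T j = T j * T i)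
  (x_sq : x * x = 0)
  (xT : forall i, (0 < i)%N -> (i.+1 < k)%N -> x * T i = T i * x)
  (xT0 : (1 < k)%N -> T 0 * x * T 0 * x * T 0 = - (x * T 0 * x)).

Definition hpoly m : {poly R} := hgen h%:P (fun i => (T i)%:P) x%:P 'X m.
Local Notation a m i := ((hpoly m)`_i).

Lemma anti_take (S : nzRingType) (p w : {poly S}) n :
  (forall i, (i < n)%N -> (p`_i)%:P * w = - (w * (p`_i)%:P)) ->
  take_poly n p * w = - (w * take_poly n p).
Proof.
move=> H; rewrite /take_poly poly_def mulr_suml mulr_sumr -sumrN.
apply: eq_bigr => i _; rewrite -mul_polyC -mulrA -commr_polyXn mulrA H //.
by rewrite mulNr -!mulrA.
Qed.

Lemma anti_polyXn (S : nzRingType) (p w : {poly S}) n :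
  p * 'X^n * w + w * (p * 'X^n) = (p * w + w * p) * 'X^n.
Proof. by rewrite mulrDl -mulrA -commr_polyXn !mulrA. Qed.

Lemma hpoly_sq m : (m < k)%N -> hpoly m * hpoly m = 0.
Proof.
move=> mk; apply: (@hgen_sq _ _ _ k) => //.
- exact: central_polyC.
- by move=> i ik; rewrite -!polyCM quad // polyCD polyC1.
- by rewrite -polyCM x_sq.
- exact: central_polyX.
Qed.

(* The terms of degree at most [m] anticommute with h(t), so the
   coefficient of degree [2m + 2] of h(t)^2 is the square below. *)
Lemma hpoly_top_sq m : (m < k)%N ->
  (forall i, (i <= m)%N -> (a m i)%:P * hpoly m = - (hpoly m * (a m i)%:P)) ->
  a m m.+1 * a m m.+1 = 0.
Proof.
move=> mk anti; set p := hpoly m; pose p0 := take_poly m.+1 p.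
pose p1 := drop_poly m.+1 p.
have pE : p = p0 + p1 * 'X^(m.+1) by rewrite poly_take_drop.
have pp : p * p = 0 by apply: hpoly_sq.
have p0p : p0 * p + p * p0 = 0 by rewrite anti_take ?addNr.
have e : p1 * p1 * 'X^(m.+1 + m.+1) = p0 * p0.
  have X_p1 : p1 * 'X^(m.+1) * (p1 * 'X^(m.+1)) = p1 * p1 * 'X^(m.+1 + m.+1).
    by rewrite exprD !mulrA -(mulrA p1 'X^_ p1) -commr_polyXn mulrA.
  rewrite -X_p1; apply: subr0_eq.
  transitivity (p * p - (p0 * p + p * p0)); last by rewrite pp p0p subrr.
  by rewrite pE; Ncring_tac.non_commutative_ring.
have := congr1 (fun q : {poly R} => q`_(m.+1 + m.+1)) e.
rewrite coefMXn ltnn subnn coef0M coef_drop_poly add0n => ->.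
apply: nth_default; apply: leq_trans (size_polyMleq _ _) _.
have := size_take_poly m.+1 p; rewrite -/p0; lia.
Qed.

(** With s the outer and t the inner variable, the reflection equation says that h(s) anticommutes
    with W = Z(s,t) h(t) Z(t,s). By assumption the coefficients of h(s) up to degree m do so
    separately and can be removed. In the rest, the lowest coefficient in s pairs the one of degree
    m + 1 with W at s = 0, which is (1 - t T^-1) h(t) (1 + t T), the next series. *)
Lemma hpoly_reflection m : (m.+1 < k)%N ->
  (forall i, (i <= m)%N -> T m * a m i = a m i * T m) ->
  (forall i, (i <= m)%N -> (a m i)%:P * hpoly m = - (hpoly m * (a m i)%:P)) ->
  (a m m.+1)%:P * hpoly m.+1 = - (hpoly m.+1 * (a m m.+1)%:P).
Proof.
move=> mk low anti.
pose Q := {poly R}; pose S := {poly Q}.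
pose h2 : S := h%:P%:P; pose T2 i : S := (T i)%:P%:P; pose x2 : S := x%:P%:P.
pose s : S := 'X; pose t : S := 'X%:P.
have hC2 : central h2 by do 2![apply: central_polyC].
have sC : central s by exact: central_polyX.
have tC : central t by apply/central_polyC/central_polyX.
pose A : S := map_poly polyC (hpoly m); pose B : S := (hpoly m)%:P.
have AE : A = hgen h2 T2 x2 s m.
  rewrite /A /hpoly hgen_morph /= map_polyX !map_polyC /=.
  by congr (hgen _ _ _ _ m); apply/funext=> i; rewrite map_polyC.
have BE : B = hgen h2 T2 x2 t m by rewrite /B /hpoly hgen_morph.
have refl : reflection h2 T2 x2 s t m = 0.
  apply: (@reflectionP _ _ hC2 k) => //.
  - by move=> i ik; rewrite /T2 -!polyCM quad // !polyCD !polyC1.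
  - by move=> i ik; rewrite /T2 -!polyCM braid.
  - by move=> i j ij jk; rewrite /T2 -!polyCM far.
  - by rewrite -!polyCM x_sq.
  - by move=> i i0 ik; rewrite /T2 /x2 -!polyCM xT.
  - by move=> k1; rewrite /T2 /x2 -!polyCM xT0 // !polyCN.
pose z0 : Q := baxm h%:P (fun i => (T i)%:P) 'X m.
pose z1 : Q := baxp (fun i => (T i)%:P) 'X m.
pose Z := baxz h2 T2 s t m; pose Z1 := baxz h2 T2 t s m.
have Z0 : Z`_0 = z0.
  have -> : Z = z0%:P + s * T2 m.
    rewrite /z0 /baxm !polyCD polyC1 !polyCM polyCN /Z /baxz mulrBl mulNr.
    by rewrite addrA addrAC.
  by rewrite coefD coefC coefXM addr0.
have Z10 : Z1`_0 = z1.
  have -> : Z1 = z1%:P + s * (h2 - T2 m).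
    rewrite /z1 /baxp !polyCD polyC1 !polyCM /Z1 /baxz -/t -/(T2 m) mulrBl mulrBr -!addrA.
    by rewrite [s * h2 + _]addrCA.
  by rewrite coefD coefC coefXM addr0.
pose W := Z * B * Z1.
have AW : A * W + W * A = 0.
  by rewrite -refl /reflection -AE -BE /W !mulrA.
have A0W : take_poly m.+1 A * W = - (W * take_poly m.+1 A).
  apply: anti_take => i im; rewrite coef_map /=.
  set c : S := _%:P.
  have cT : c * T2 m = T2 m * c by rewrite /c /T2 -!polyCM low.
  have cZ (u v : S) : central u -> central v ->
      c * (u + v * T2 m) = (u + v * T2 m) * c.
    by move=> uC vC; rewrite (bax_comm uC vC).
  have cB : c * B = - (B * c) by rewrite /c /B -!polyCM anti // polyCN.
  have cZ0 : c * Z = Z * c.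
    apply: cZ; last by apply: centralD => //; apply: centralN.
    by apply: centralD; [apply: central1|apply: centralM].
  have cZ1 : c * Z1 = Z1 * c.
    apply: cZ; last by apply: centralD => //; apply: centralN.
    by apply: centralD; [apply: central1|apply: centralM].
  by rewrite /W !mulrA cZ0 -(mulrA Z c B) cB mulrN mulNr -!mulrA cZ1.
have : (drop_poly m.+1 A * W + W * drop_poly m.+1 A) * 'X^(m.+1) = 0.
  move: AW; rewrite -{1 2}(poly_take_drop m.+1 A) mulrDl mulrDr A0W addrACA addNr add0r.
  by rewrite anti_polyXn.
move=> /(congr1 (fun q : S => q`_m.+1)); rewrite coefMXn ltnn subnn coef0.
rewrite coefD !coef0M coef_drop_poly add0n coef_map /= Z0 Z10 coefC /=.
by move/eqP; rewrite addr_eq0 => /eqP.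
Qed.
End Coefficients.

Lemma polyC_comm (R : nzRingType) (a b : R) : a * b = b * a ->
  a%:P * b%:P = b%:P * a%:P.
Proof. by rewrite -!polyCM => ->. Qed.

Lemma polyC_anti (R : nzRingType) (h a b c : R) (p : {poly R}) : central h ->
    a%:P * p = - (p * a%:P) -> b%:P * p = - (p * b%:P) ->
    c%:P * p = - (p * c%:P) ->
  (a + h * b - c)%:P * p = - (p * (a + h * b - c)%:P).
Proof.
move=> /central_polyC hC pa pb pc; rewrite polyCB polyCD polyCM.
rewrite mulrBr mulrDr mulrBl mulrDl -(mulrA h%:P) pa pb pc.
by rewrite mulrN (mulrA p h%:P) -hC -(mulrA h%:P) !opprD.
Qed.

Section HPoly.
Variables (R : nzRingType) (h : R) (T : nat -> R) (x : R).

(** The variable is absorbed into the outer factors so that [hstep_anti] applies to whole series. *)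
Lemma hpoly_step m : hpoly h T x m.+1 =
  hstep ((T m)%:P * 'X) ((T m - h)%:P * 'X)
    (hpoly h T x m) (hpoly h T x m) (hpoly h T x m).
Proof.
have -> : hpoly h T x m.+1 = baxm h%:P (fun i => (T i)%:P) 'X m * hpoly h T x m *
  baxp (fun i => (T i)%:P) 'X m by [].
have -> : baxm h%:P (fun i => (T i)%:P) 'X m = 1 - 'X * (T m - h)%:P.
  by rewrite /baxm polyCB mulrBr mulNr opprB addrA.
have -> : 'X * (T m - h)%:P = (T m - h)%:P * 'X by rewrite commr_polyX.
have -> : baxp (fun i => (T i)%:P) 'X m = 1 + (T m)%:P * 'X.
  by rewrite /baxp commr_polyX.
by rewrite /hstep; Ncring_tac.non_commutative_ring.
Qed.

Lemma hpolyS m : hpoly h T x m.+1 = hpoly h T x m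
  - (T m - h)%:P * hpoly h T x m * 'X + hpoly h T x m * (T m)%:P * 'X
  - (T m - h)%:P * hpoly h T x m * (T m)%:P * 'X^2.
Proof.
rewrite hpoly_step /hstep expr2; set p := hpoly _ _ _ _.
set v := (T m - h)%:P; set t := (T m)%:P; set X := 'X; apply: subr0_eq.
transitivity (v * (p * X - X * p) + v * (p * t * X - X * (p * t)) * X).
  by Ncring_tac.non_commutative_ring.
by rewrite (commr_polyX p) (commr_polyX (p * t)) !subrr mulr0 mul0r addr0.
Qed.

Lemma hpoly_coefS m i : (hpoly h T x m.+1)`_i.+2 =
  hstep (T m) (T m - h) (hpoly h T x m)`_i.+2 (hpoly h T x m)`_i.+1
    (hpoly h T x m)`_i.
Proof.
by rewrite hpolyS !(coefB, coefD) !coefMX coefMXn /= subn2 !(coefMC, coefCM).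
Qed.
End HPoly.

(** * Anticommutation of the h_(k,i) *)

Section Anticommute.
Variables (F : fieldType) (hbar : F) (k : nat).
Local Notation R := (dgh k hbar).
Local Notation T := (tt hbar k).
Local Notation X := (xx hbar k).
Local Notation hh := (hh hbar k).
Local Notation h := (hbar%:A : R).
Local Notation hp := (hpoly h T (X 0)).

Let rT := tt_rels hbar k.
Let rX := xx_rels hbar k.

Lemma hh_nonpos m i : i <= 0 -> hh m i = 0.
Proof.
elim: m i => [|m IH] i i0; first by rewrite hh0; case: eqP => // e; move: i0; rewrite e.
rewrite hhS /hstep !IH; [|lia..].
by rewrite !(mulr0, mul0r) !subr0 addr0.
Qed.

Lemma coef_hp m (i : nat) : (hp m)`_i = hh m i%:Z.
Proof.
elim: m i => [|m IH] i.
  rewrite hh0 /hpoly /= coefXM coefC; case: i => [|[|i]] //.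
case: i => [|[|i]].
- rewrite hpolyS !(coefB, coefD) !coefMX coefMXn /= IH hh_nonpos // hh_nonpos //.
  by rewrite !subr0 addr0.
- rewrite hpolyS !(coefB, coefD) !coefMX coefMXn /= !(coefMC, coefCM) !IH hhS /hstep.
  rewrite [hh m (_ - 1)]hh_nonpos // [hh m (_ - 2)]hh_nonpos //.
  by rewrite !(mulr0, mul0r).
rewrite hpoly_coefS !IH hhS; congr (hstep _ _ _ _ _); congr (hh m _); lia.
Qed.

Lemma hbar_central : central h.
Proof. by move=> y; rewrite mulr_algl mulr_algr. Qed.
Let quad i : (i.+1 < k)%N -> T i * T i = 1 + h * T i.
Proof. by move=> ik; rewrite mulr_algl (rels_quad rT). Qed.
Let xT i : (0 < i)%N -> (i.+1 < k)%N -> X 0 * T i = T i * X 0.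
Proof. by move=> i0 ik; apply: (rels_xiT rX); lia. Qed.

(** By [hh_low] the elements at rank m + 1 combine elements of rank m with index at most m + 1, so
    [key] treats those. For index m + 1 it is the reflection equation; smaller indices commute with
    T_m and pass through the recursion. *)
Lemma hp_anti m (i : nat) : (m < k)%N -> (i <= m)%N ->
  (hh m i)%:P * hp m = - (hp m * (hh m i)%:P).
Proof.
elim: m i => [|m IH] i mk im.
  by rewrite hh_nonpos ?mul0r ?mulr0 ?oppr0 //; lia.
have mk' := ltnW mk.
have low (j : int) : j <= m%:Z -> T m * hh m j = hh m j * T m.
  exact: hh_lowT.
have key (j : int) : j <= m.+1%:Z -> (hh m j)%:P * hp m.+1 = - (hp m.+1 * (hh m j)%:P).
  move=> jm; have [j0|j0] := lerP j 0.
    by rewrite hh_nonpos // mul0r mulr0 oppr0.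
  have [l jl] : exists l : nat, j = l by exists `|j|%N; lia.
  rewrite {}jl in jm j0 *; have [lm|lm] := leqP l m; last first.
    have -> : l = m.+1 by lia.
    rewrite -coef_hp; apply: (@hpoly_reflection _ _ k) => //.
    - exact: hbar_central.
    - exact: rels_braid rT.
    - exact: rels_far rT.
    - by apply: (rels_sq rX); apply: leq_ltn_trans mk.
    - exact: xT0_rel.
    - by move=> i' im'; rewrite coef_hp low.
    - by move=> i' im'; rewrite coef_hp IH.
  have cT : T m * hh m l = hh m l * T m by apply: low.
  have cV : (T m - h) * hh m l = hh m l * (T m - h).
    by rewrite mulrBl mulrBr cT hbar_central.
  have := IH l mk' lm.
  have cT' : (T m)%:P * (hh m l)%:P = (hh m l)%:P * (T m)%:P.
    exact: polyC_comm.
  have cV' : (T m - h)%:P * (hh m l)%:P = (hh m l)%:P * (T m - h)%:P.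
    exact: polyC_comm.
  move: (hh m l)%:P cT' cV' => c cT' cV' cp.
  rewrite hpoly_step; apply: hstep_anti => //; rewrite mulrA.
    by rewrite -cT' -!mulrA commr_polyX.
  by rewrite -cV' -!mulrA commr_polyX.
have -> : hh m.+1 i = hh m i%:Z + h * hh m (i%:Z - 1) - hh m (i%:Z - 2).
  by rewrite mulr_algl; apply: hh_low.
apply: polyC_anti.
- exact: hbar_central.
- exact: key.
- by apply: key; lia.
- by apply: key; lia.
Qed.

Lemma hh_top_sq m : (m < k)%N -> hh m m.+1%:Z * hh m m.+1%:Z = 0.
Proof.
move=> mk; rewrite -coef_hp; apply: (@hpoly_top_sq _ _ k) => //.
- exact: hbar_central.
- by apply: (rels_sq rX); apply: leq_ltn_trans mk.
- exact: xT0_rel.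
- by move=> i im; rewrite coef_hp hp_anti.
Qed.

(** If one index is at most m, this is a coefficient of [hp_anti]; two top indices need
    [hh_top_sq]. *)
Lemma hh_anti m (i j : nat) : (m < k)%N -> (i <= m.+1)%N -> (j <= m.+1)%N ->
  hh m i%:Z * hh m j%:Z = - (hh m j%:Z * hh m i%:Z).
Proof.
move=> mk; have lt a b : (a <= m)%N -> hh m a%:Z * hh m b%:Z = - (hh m b%:Z * hh m a%:Z).
  move=> am; have := congr1 (fun p : {poly R} => p`_b) (hp_anti mk am).
  by rewrite coefCM coefN coefMC coef_hp.
rewrite leq_eqVlt => /predU1P[->|]; last by rewrite ltnS => im _; apply: lt.
rewrite leq_eqVlt => /predU1P[->|]; first by rewrite hh_top_sq ?oppr0.
by rewrite ltnS => jm; rewrite (lt j) // opprK.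
Qed.
End Anticommute.

(** * Exterior algebras *)

Section ExtUniversal.
Variables (F : fieldType) (n : nat) (S : algType F) (u : 'I_n -> S).
Hypothesis u_sq : forall v : 'rV[F]_n,
  (\sum_i v 0 i *: u i) * (\sum_i v 0 i *: u i) = 0.

Definition ext_eval (x : exterior F n) : S := free_eval u (quot_repr x).

Lemma free_eval_vec v : free_eval u (ext_vec v) = \sum_i v 0 i *: u i.
Proof.
rewrite /ext_vec linear_sum; apply: eq_bigr => i _.
by rewrite /= free_evalZ free_eval_gen.
Qed.

Lemma ext_evalE x : ext_eval (@quot_proj _ _ (@ext_ideal F n) x) = free_eval u x.
Proof.
apply/eqP; rewrite -subr_eq0 -free_evalN -free_evalD; apply/eqP.
apply: (@rel_span_kernel _ _ (@ext_rel F n)); last first.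
  by apply/asboolP; apply: (@quot_proj_repr _ _ (@ext_ideal F n)).
by move=> l r [v]; rewrite /= free_evalM free_eval0 free_eval_vec.
Qed.

Lemma ext_eval_linear : linear ext_eval.
Proof.
move=> a x y; rewrite -(quot_reprK x) -(quot_reprK y) -linearP !ext_evalE.
by rewrite free_evalD free_evalZ.
Qed.
Lemma ext_evalM x y : ext_eval (x * y) = ext_eval x * ext_eval y.
Proof.
by rewrite -(quot_reprK x) -(quot_reprK y) -quot_projM !ext_evalE free_evalM.
Qed.
Lemma ext_eval1 : ext_eval 1 = 1.
Proof.
by rewrite -(rmorph1 (@quot_proj _ _ (@ext_ideal F n))) ext_evalE free_eval1.
Qed.
Lemma ext_eval_gen i : ext_eval (ext_gen F i) = u i.
Proof. by rewrite ext_evalE free_eval_gen. Qed.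
Lemma ext_evalD x y : ext_eval (x + y) = ext_eval x + ext_eval y.
Proof. by have := ext_eval_linear 1 x y; rewrite !scale1r. Qed.
Lemma ext_eval0 : ext_eval 0 = 0.
Proof. by have := ext_eval_linear (-1) 0 0; rewrite !scaleN1r !addNr. Qed.
Lemma ext_evalZ a x : ext_eval (a *: x) = a *: ext_eval x.
Proof. by have := ext_eval_linear a x 0; rewrite ext_eval0 !addr0. Qed.
Lemma ext_evalN x : ext_eval (- x) = - ext_eval x.
Proof. by rewrite -!scaleN1r ext_evalZ. Qed.
End ExtUniversal.

Section ExtBasics.
Variables (F : fieldType) (n : nat).
Local Notation E := (exterior F n).

Lemma ext_ind (P : E -> Prop) : P 1 -> (forall i x, P x -> P (ext_gen F i * x)) ->
    P 0 -> (forall x y, P x -> P y -> P (x + y)) -> (forall a x, P x -> P (a *: x)) ->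
  forall x, P x.
Proof.
move=> P1 PG P0 PD PZ x; rewrite -(quot_reprK x).
elim/free_alg_ind: (quot_repr x) => [m||y z Py Pz|a y Py].
- elim/fmonom_ind: m => [|g m IH]; first by rewrite free_word1 rmorph1.
  by rewrite free_wordM rmorphM; apply: PG.
- by rewrite raddf0.
- by rewrite raddfD; apply: PD.
- by rewrite linearZ; apply: PZ.
Qed.

Definition ext_lin (v : 'rV[F]_n) : E := \sum_i v 0 i *: ext_gen F i.

Lemma ext_lin_sq v : ext_lin v * ext_lin v = 0.
Proof.
have -> : ext_lin v = @quot_proj _ _ (@ext_ideal F n) (ext_vec v).
  rewrite /ext_lin /ext_vec linear_sum; apply: eq_bigr => i _.
  by rewrite /= linearZ.
rewrite -quot_projM -[RHS](raddf0 (@quot_proj _ _ (@ext_ideal F n))).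
by apply/quot_projP/rel_idealP.
Qed.
Lemma ext_lin_linear : linear ext_lin.
Proof.
move=> a v w; rewrite /ext_lin scaler_sumr -big_split; apply: eq_bigr => i _.
by rewrite !mxE scalerDl scalerA.
Qed.
Lemma ext_linD v w : ext_lin (v + w) = ext_lin v + ext_lin w.
Proof. by have := ext_lin_linear 1 v w; rewrite !scale1r. Qed.
Lemma ext_lin_delta i : ext_lin (delta_mx 0 i) = ext_gen F i.
Proof.
rewrite /ext_lin (bigD1 i) //= !mxE !eqxx scale1r big1 ?addr0 // => j ji.
by rewrite !mxE (negPf ji) andbF scale0r.
Qed.
Lemma ext_lin_anti v w : ext_lin v * ext_lin w = - (ext_lin w * ext_lin v).
Proof.
apply/eqP; rewrite -addr_eq0; apply/eqP.
have := ext_lin_sq (v + w); rewrite ext_linD mulrDl !mulrDr !ext_lin_sq.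
by rewrite add0r addr0.
Qed.
End ExtBasics.

(** The sum y anticommutes with each u_j, hence with itself, so 2 y^2 = 0; here the characteristic
    enters. *)
Lemma sum_sq0 (F : fieldType) (S : algType F) (I : finType) (c : I -> F) (u : I -> S) :
    2%N \notin [pchar F] -> (forall i j, u i * u j = - (u j * u i)) ->
  (\sum_i c i *: u i) * (\sum_i c i *: u i) = 0.
Proof.
move=> char2 anti; set y := \sum_i _.
have yu j : y * u j = - (u j * y).
  rewrite mulr_suml mulr_sumr -sumrN; apply: eq_bigr => i _.
  by rewrite -scalerAl -scalerAr anti scalerN.
have yy : y * y = - (y * y).
  transitivity (\sum_i c i *: (y * u i)).
    by rewrite {2}/y mulr_sumr; apply: eq_bigr => i _; rewrite -scalerAr.
  transitivity (- (\sum_i c i *: (u i * y))).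
    by rewrite -sumrN; apply: eq_bigr => i _; rewrite yu scalerN.
  congr (- _); rewrite {2}/y mulr_suml.
  by apply: eq_bigr => i _; rewrite -scalerAl.
have : (2%:R : F) *: (y * y) = 0.
  by rewrite scaler_nat mulr2n {2}yy subrr.
move/eqP; rewrite scaler_eq0 => /orP[/eqP h2|/eqP //].
by case/negP: char2; rewrite inE /= h2 eqxx.
Qed.

(** * Comparison of R_n with the exterior algebra *)

Section Main.
Variables (F : fieldType) (hbar : F).
Hypothesis charF : 2%N \notin [pchar F].
Local Notation R n := (dgh n hbar).
Local Notation d := dgh_diff.

Definition hv n (i : nat) : R n := dgh_h n hbar n i.+1%:Z.

Lemma hvS m i : hv m.+1 i = hh hbar m.+1 m i.+1%:Z. Proof. by []. Qed.
Lemma hv_closed n i : (i < n)%N -> d (hv n i) = 0.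
Proof. by case: n => // m im; rewrite hvS hh_closed. Qed.
Lemma hv_anti n i j : (i < n)%N -> (j < n)%N -> hv n i * hv n j = - (hv n j * hv n i).
Proof. by case: n => // m im jm; rewrite !hvS hh_anti. Qed.

Definition extR n : exterior F n -> R n := ext_eval (fun i : 'I_n => hv n i).

Lemma hv_sq n (v : 'rV[F]_n) :
  (\sum_i v 0 i *: hv n (i : 'I_n)) * (\sum_i v 0 i *: hv n i) = 0.
Proof. by apply: (sum_sq0 (fun i => v 0 i) charF) => i j; apply: hv_anti. Qed.

Lemma extRM n (x y : exterior F n) : extR (x * y) = extR x * extR y.
Proof. exact/ext_evalM/hv_sq. Qed.
Lemma extRD n (x y : exterior F n) : extR (x + y) = extR x + extR y.
Proof. exact/ext_evalD/hv_sq. Qed.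
Lemma extRZ n a (x : exterior F n) : extR (a *: x) = a *: extR x.
Proof. exact/ext_evalZ/hv_sq. Qed.
Lemma extRN n (x : exterior F n) : extR (- x) = - extR x.
Proof. exact/ext_evalN/hv_sq. Qed.
Lemma extR1 n : extR (1 : exterior F n) = 1.
Proof. exact/ext_eval1/hv_sq. Qed.
Lemma extR0 n : extR (0 : exterior F n) = 0.
Proof. exact/ext_eval0/hv_sq. Qed.
Lemma extR_gen n (i : 'I_n) : extR (ext_gen F i) = hv n i.
Proof. exact/ext_eval_gen/hv_sq. Qed.

Lemma extR_closed n (x : exterior F n) : d (extR x) = 0.
Proof.
elim/ext_ind: x => [|i x IH||x y IH IH'|a x IH].
- by rewrite extR1 dgh_diff1.
- by rewrite extRM extR_gen dgh_diffM IH hv_closed // mulr0 mul0r addr0.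
- by rewrite extR0 dgh_diff0.
- by rewrite extRD dgh_diffD IH IH' addr0.
- by rewrite extRZ dgh_diffZ IH scaler0.
Qed.

Section Step.
Variable n : nat.
Local Notation E := (exterior F n).
Local Notation E' := (exterior F n.+1).

Definition stdv j : 'rV[F]_n.+1 := delta_mx 0 (inord j).
(* The pair (w_j, w_(j-1)), where w_j is the vector that represents the image of
   h_(n,j+1) in R_(n+1). *)
Fixpoint lowv2 (j : nat) : 'rV[F]_n.+1 * 'rV[F]_n.+1 :=
  if j is i.+1 then (stdv j - hbar *: (lowv2 i).1 + (lowv2 i).2, (lowv2 i).1)
  else (stdv 0, 0).
Definition lowv j := (lowv2 j).1.

Definition ext_low : E -> E' := ext_eval (fun i : 'I_n => ext_lin (lowv i)).

Lemma ext_linZ m a (v : 'rV[F]_m) : ext_lin (a *: v) = a *: ext_lin v.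
Proof.
have := ext_lin_linear a v 0; rewrite addr0 => ->.
have := ext_lin_linear (-1) 0 (0 : 'rV[F]_m).
by rewrite !scaleN1r !addNr => ->; rewrite addr0.
Qed.
Lemma ext_lin0 m : ext_lin (0 : 'rV[F]_m) = 0.
Proof. by rewrite -(scale0r (0 : 'rV[F]_m)) ext_linZ scale0r. Qed.
Lemma ext_lin_sum m (I : finType) (c : I -> F) (w : I -> 'rV[F]_m) :
  \sum_i c i *: ext_lin (w i) = ext_lin (\sum_i c i *: w i).
Proof.
rewrite (big_morph (@ext_lin F m) (@ext_linD F m) (ext_lin0 m)).
by apply: eq_bigr => i _; rewrite ext_linZ.
Qed.

Lemma lowv_sq (v : 'rV[F]_n) :
  (\sum_i v 0 i *: ext_lin (lowv (i : 'I_n))) * (\sum_i v 0 i *: ext_lin (lowv i)) = 0.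
Proof. by rewrite ext_lin_sum ext_lin_sq. Qed.

Lemma ext_lowM x y : ext_low (x * y) = ext_low x * ext_low y.
Proof. exact/ext_evalM/lowv_sq. Qed.
Lemma ext_lowD x y : ext_low (x + y) = ext_low x + ext_low y.
Proof. exact/ext_evalD/lowv_sq. Qed.
Lemma ext_lowZ a x : ext_low (a *: x) = a *: ext_low x.
Proof. exact/ext_evalZ/lowv_sq. Qed.
Lemma ext_lowN x : ext_low (- x) = - ext_low x.
Proof. exact/ext_evalN/lowv_sq. Qed.
Lemma ext_low1 : ext_low 1 = 1.
Proof. exact/ext_eval1/lowv_sq. Qed.
Lemma ext_low0 : ext_low 0 = 0.
Proof. exact/ext_eval0/lowv_sq. Qed.
Lemma ext_low_gen (i : 'I_n) : ext_low (ext_gen F i) = ext_lin (lowv i).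
Proof. exact/ext_eval_gen/lowv_sq. Qed.

Lemma ext_lin_stdv j : (j <= n)%N ->
  extR (ext_lin (stdv j)) = hv n.+1 j.
Proof. by move=> jn; rewrite ext_lin_delta extR_gen inordK. Qed.

(** The vectors [lowv] solve the recursion [hh_low] for the elements of lower rank. *)
Lemma extR_lowv2 j : (j < n)%N ->
  extR (ext_lin (lowv2 j).1) = hh hbar n.+1 n.-1 j.+1%:Z /\
  extR (ext_lin (lowv2 j).2) = hh hbar n.+1 n.-1 j%:Z.
Proof.
have low i : (i < n)%N -> hv n.+1 i = hh hbar n.+1 n.-1 i.+1%:Z +
    hbar *: hh hbar n.+1 n.-1 (i.+1%:Z - 1) - hh hbar n.+1 n.-1 (i.+1%:Z - 2).
  by case: n => // m im; rewrite hvS hh_low.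
elim: j => [|j IH] jn /=.
  split; last by rewrite ext_lin0 extR0 hh_nonpos.
  rewrite ext_lin_stdv // low //.
  rewrite [hh _ _ _ (_ - 1)]hh_nonpos // [hh _ _ _ (_ - 2)]hh_nonpos //.
  by rewrite scaler0 addr0 subr0.
have [IH1 IH2] := IH (ltnW jn); split => //.
rewrite ext_linD ext_linD -scaleN1r !ext_linZ scaleN1r extRD extRD extRN extRZ.
rewrite IH1 IH2 ext_lin_stdv 1?ltnW // low //.
have -> : j.+2%:Z - 1 = j.+1%:Z by lia.
have -> : j.+2%:Z - 2 = j%:Z by lia.
by rewrite addrAC subrK addrK.
Qed.

Lemma extR_low x : extR (ext_low x) = incl (extR x).
Proof.
elim/ext_ind: x => [|i x IH||x y IH IH'|a x IH].
- by rewrite ext_low1 !extR1 incl1.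
- rewrite ext_lowM !extRM IH inclM extR_gen ext_low_gen; congr (_ * _).
  have [-> _] := extR_lowv2 (ltn_ord i).
  case: n i => [[]//|m] i; by rewrite hvS incl_hh.
- by rewrite ext_low0 !extR0 incl0.
- by rewrite ext_lowD !extRD IH IH' inclD.
- by rewrite ext_lowZ !extRZ IH inclZ.
Qed.

(** The change of basis is inverted by reading the recursion of [lowv2] backwards. *)
Lemma lowvE j : (j < n)%N -> exists w, ext_lin (stdv j) = ext_low w.
Proof.
move=> jn; have lw i : (i < n)%N -> exists w, ext_lin (lowv i) = ext_low w.
  by move=> i_n; exists (ext_gen F (Ordinal i_n)); rewrite ext_low_gen.
have [w0 e0] := lw j jn; case: j jn e0 => [|j] jn e0; first by exists w0.
have [w1 e1] := lw j (ltnW jn).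
have [w2 e2] : exists w, ext_lin (lowv2 j).2 = ext_low w.
  case: j jn {e0 e1} => [|j] jn /=; last exact: lw (ltnW (ltnW jn)).
  by exists 0; rewrite ext_lin0 ext_low0.
exists (w0 + hbar *: w1 - w2).
rewrite !ext_lowD ext_lowN ext_lowZ -e0 -e1 -e2 -ext_linZ -scaleN1r -ext_linZ.
by rewrite -!ext_linD scaleN1r /lowv /= addrAC addrK subrK.
Qed.

Local Notation top := (ext_gen F (ord_max : 'I_n.+1)).

(** The exterior counterpart of H(R_n) + h H(R_n): generators other than [top] come from the smaller
    algebra and move past [top] with a sign, while [top] squares to zero. *)
Lemma ext_split (x : E') : exists a b, x = ext_low a + top * ext_low b.
Proof.
have topE : top = ext_lin (delta_mx 0 ord_max) by rewrite ext_lin_delta.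
elim/ext_ind: x => [|i x [a [b ->]]||x y [a [b ->]] [a' [b' ->]]|c x [a [b ->]]].
- by exists 1, 0; rewrite ext_low1 ext_low0 mulr0 addr0.
- have [->|i_n] := eqVneq i ord_max.
    exists 0, a; rewrite mulrDr mulrA {2 3}topE ext_lin_sq mul0r addr0.
    by rewrite ext_low0 add0r.
  have lt_in : (i < n)%N.
    by rewrite ltn_neqAle -ltnS ltn_ord andbT -[n]/(nat_of_ord (ord_max : 'I_n.+1)).
  have [w e] := lowvE lt_in; have iE : ext_gen F i = ext_low w.
    by rewrite -e ext_lin_delta inord_val.
  exists (w * a), (- (w * b)).
  rewrite mulrDr ext_lowN ext_lowM iE; congr (_ + _).
  rewrite mulrA -e topE ext_lin_anti -topE e ext_lowM mulNr mulrN.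
  by rewrite -mulrA.
- by exists 0, 0; rewrite ext_low0 mulr0 addr0.
- by exists (a + a'), (b + b'); rewrite !ext_lowD mulrDr addrACA.
- by exists (c *: a), (c *: b); rewrite !ext_lowZ scalerDr scalerAr.
Qed.

Lemma extR_split a b : extR (ext_low a + top * ext_low b) =
  incl (extR a) + hv n.+1 n * incl (extR b).
Proof. by rewrite extRD extRM !extR_low extR_gen. Qed.
End Step.

(** Injectivity and surjectivity of the map to cohomology, stated with representatives. *)
Definition ext_inj n := forall x w, extR x = d w -> x = 0 :> exterior F n.
Definition ext_surj n :=
  forall z : R n, d z = 0 -> exists (x : exterior F n) w, z = extR x + d w.

Lemma incl_inj n : injective (@incl F hbar n).
Proof.
move=> y z e; have := congr1 (fun w => (bcoord w n).1) e.
by rewrite !coord_incl // eqxx.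
Qed.

Lemma top_hv n (y : R n) : top_coord (hv n.+1 n * incl y) = y.
Proof. by rewrite top_coord_mulr top_coord_hh mul1r. Qed.

Lemma diff_hv n (y : R n) : d (hv n.+1 n * incl y) =
  dgh_sgn (hv n.+1 n) * incl (d y).
Proof. by rewrite dgh_diffM hv_closed // mul0r add0r diff_incl. Qed.

Lemma ext_injS n : ext_inj n -> ext_inj n.+1.
Proof.
move=> inj x w; have [a [b ->]] := ext_split x; rewrite extR_split => e.
(* Taking top coefficients exhibits [extR b] as a boundary in R_n. *)
have b0 : b = 0.
  apply: (inj b (- top_coord w)); rewrite dgh_diffN -top_coord_diff -e.
  by rewrite top_coordD top_coord_incl top_hv add0r.
rewrite {}b0 extR0 incl0 mulr0 addr0 in e *; rewrite ext_low0 mulr0 addr0.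
have dp : d (top_coord w) = 0.
  by apply: oppr_inj; rewrite -top_coord_diff -e top_coord_incl oppr0.
(* The top coefficient of [w] is closed, so removing it with h_(n+1,n+1) changes no boundary and
   makes [descend] applicable. *)
pose w' := w - hv n.+1 n * incl (top_coord w).
have dw' : d w' = incl (extR a).
  by rewrite dgh_diffD dgh_diffN diff_hv dp incl0 mulr0 subr0.
have tw' : top_coord w' = 0 by rewrite top_coordD top_coordN top_hv subrr.
have [y [v e']] := descend dw' tw'.
suff -> : a = 0 by rewrite ext_low0.
apply: (inj a y); apply: incl_inj; rewrite -dw' e' dgh_diffD dgh_diff_diff addr0.
by rewrite diff_incl.
Qed.

Lemma ext_surjS n : ext_surj n -> ext_surj n.+1.
Proof.
move=> surj z dz; have dp : d (top_coord z) = 0.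
  by apply: oppr_inj; rewrite -top_coord_diff dz /top_coord /bcoord act0 mcoord0 oppr0.
have [b [q pE]] := surj _ dp.
pose c := hv n.+1 n * incl q.
(* The boundary enters with a plus sign because [top_coord] anticommutes with d; its top coefficient
   is - d q. *)
pose z' := z - hv n.+1 n * incl (extR b) + d c.
have dz' : d z' = incl 0.
  rewrite !dgh_diffD dgh_diffN diff_hv extR_closed dgh_diff_diff dz.
  by rewrite incl0 mulr0 subrr addr0.
have tz' : top_coord z' = 0.
  rewrite !top_coordD top_coordN top_hv top_coord_diff top_hv pE.
  by rewrite addrAC addrK subrr.
have [y [v e]] := descend dz' tz'.
have dy : d y = 0.
  apply: incl_inj; rewrite -dz' e dgh_diffD dgh_diff_diff addr0.
  by rewrite diff_incl.
have [a [r yE]] := surj _ dy.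
exists (ext_low a + ext_gen F ord_max * ext_low b), (incl r + v - c).
rewrite extR_split !dgh_diffD dgh_diffN diff_incl.
have -> : z = z' - d c + hv n.+1 n * incl (extR b) by rewrite addrK subrK.
rewrite e yE inclD -!addrA; congr (_ + _).
by rewrite [RHS]addrC -!addrA.
Qed.

Lemma dgh0_scalar (y : R 0) : exists c, y = c%:A.
Proof.
elim/dgh_nat_ind: y => [|//|//||y z [c ->] [c' ->]|a y [c ->]].
- by exists 1; rewrite scale1r.
- by exists 0; rewrite scale0r.
- by exists (c + c'); rewrite scalerDl.
- by exists (a * c); rewrite scalerA.
Qed.

Lemma ext0_scalar (x : exterior F 0) : exists c, x = c%:A.
Proof.
elim/ext_ind: x => [|[]//||y z [c ->] [c' ->]|a y [c ->]].
- by exists 1; rewrite scale1r.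
- by exists 0; rewrite scale0r.
- by exists (c + c'); rewrite scalerDl.
- by exists (a * c); rewrite scalerA.
Qed.

Lemma ext_inj0 : ext_inj 0.
Proof.
move=> x w; have [c ->] := ext0_scalar x; have [c' ->] := dgh0_scalar w.
rewrite extRZ extR1 dgh_diffZ dgh_diff1 scaler0 => /eqP.
by rewrite scaler_eq0 oner_eq0 orbF => /eqP ->; rewrite scale0r.
Qed.

Lemma ext_surj0 : ext_surj 0.
Proof.
move=> z _; have [c ->] := dgh0_scalar z.
by exists c%:A, 0; rewrite extRZ extR1 dgh_diff0 addr0.
Qed.

Lemma ext_injP n : ext_inj n.
Proof. by elim: n => [|n IH]; [apply: ext_inj0|apply: ext_injS]. Qed.
Lemma ext_surjP n : ext_surj n.
Proof. by elim: n => [|n IH]; [apply: ext_surj0|apply: ext_surjS]. Qed.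

(** * Passage to cohomology classes *)

Section Cohomology.
Variable n : nat.

Fact extR_dgh_closed (x : exterior F n) : dgh_closed (extR x).
Proof. by apply/eqP/extR_closed. Qed.
Definition ext_cocycle x : cocycle n hbar := Cocycle (extR_dgh_closed x).
Definition ext_coh x : cohomology n hbar := coh_class (ext_cocycle x).

Lemma ext_coh_linear : linear ext_coh.
Proof.
move=> a x y; rewrite /ext_coh /coh_class -linearP; congr quot_proj.
by apply: val_inj; rewrite /= extRD extRZ.
Qed.
HB.instance Definition _ := GRing.isLinear.Build F (exterior F n)
  (cohomology n hbar) *:%R ext_coh ext_coh_linear.
Lemma ext_coh_monoid : monoid_morphism ext_coh.
Proof.
split=> [|x y].
  rewrite /ext_coh /coh_class -(rmorph1 (@quot_proj _ _ (@coboundary F n hbar))).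
  by congr quot_proj; apply: val_inj; rewrite /= extR1.
rewrite /ext_coh /coh_class -quot_projM; congr quot_proj.
by apply: val_inj; rewrite /= extRM.
Qed.
HB.instance Definition _ := GRing.isMonoidMorphism.Build (exterior F n)
  (cohomology n hbar) ext_coh ext_coh_monoid.

Lemma ext_coh_inj : injective ext_coh.
Proof.
move=> x y /coh_classP[w e]; apply/subr0_eq/(@ext_injP n _ w).
by rewrite extRD extRN.
Qed.
Lemma ext_coh_surj z : exists x, ext_coh x = z.
Proof.
rewrite -(quot_reprK z); case: (quot_repr z) => y yC.
have [x [w e]] := ext_surjP (eqP yC).
exists x; apply/esym/coh_classP; exists w.
by rewrite /= e addrAC subrr add0r.
Qed.
Lemma ext_coh_bij : bijective ext_coh.
Proof.
have [g gK] := choice ext_coh_surj.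
by exists g => // x; apply: ext_coh_inj; rewrite gK.
Qed.
End Cohomology.
End Main.

Theorem proposition6p1p11 (F : fieldType) (hbar : F) (k : nat)
  (hbar_neq0 : hbar != 0) (k_ge1 : (1 <= k)%N) (charF : 2%N \notin [pchar F]) :
  exists hZ : forall i : 'I_k, dgh_closed (dgh_h k hbar k i.+1%:Z),
  exists phi : {lrmorphism exterior F k -> cohomology k hbar},
    bijective phi /\
    forall i : 'I_k, phi (ext_gen F i) = coh_class (Cocycle (hZ i)).
Proof.
have hZ (i : 'I_k) : dgh_closed (dgh_h k hbar k i.+1%:Z).
  by apply/eqP; apply: hv_closed.
exists hZ, (ext_coh hbar charF (n := k)).
split; first exact: ext_coh_bij.
move=> i; congr coh_class; apply: val_inj; exact: extR_gen.
Qed.
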